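(* Let $f:\mathbb{R}^d\to\mathbb{R}^d$ be of class $\mathcal{C}^2$ and assume that there exists $q\in\mathbb{N}$ such that \[ \sup_{x\in\mathbb{R}^d}\frac{\|f(x)\|+\sum_{j=1}^{2}\sup_{\|h_1\|,\ldots,\|h_j\|\le 1}\|D^jf(x).(h_1,\ldots,h_j)\|}{1+\|x\|^q}<\infty, \] and that there exists $\gamma>0$ such that for all $x_1,x_2\in\mathbb{R}^d$ \[ \langle f(x_2)-f(x_1),x_2-x_1\rangle\le-\gamma\|x_2-x_1\|^2 . \] Let $\mu_\star$ be the unique invariant distribution of the SDE $dX(t)=f(X(t))dt+\sum_{k=1}^K\sigma_k d\beta^k(t)$ on $\mathbb{R}^d$, and let $(X_n)_{n\ge 0}$ be defined by the tamed Euler–Maruyama scheme with time-step size $\Delta t$ and $X_0=x_0$, \[ X_{n+1}=X_n+\frac{\Delta t}{1+\alpha\Delta t\|f(X_n)\|}f(X_n)+\sum_{k=1}^K\sigma_k\,\Delta\beta_n^k,\qquad n\ge 0 . \] Then for every $r\in\mathbb{N}$ there exist polynomial functions $\mathcal{P}_r:\mathbb{R}^2\to\mathbb{R}$ and $\mathcal{Q}_r:\mathbb{R}\to\mathbb{R}$ such that the following holds: if $\varphi:\mathbb{R}^d\to\mathbb{R}$ is a function of class $\mathcal{C}^2$ such that \[ \mathcal{N}_r(\varphi)=\sup_{x\in\mathbb{R}^d}\frac{|\varphi(x)|+\sum_{j=1}^{2}\sup_{\|h_1\|,\ldots,\|h_j\|\le 1}|D^j\varphi(x).(h_1,\ldots,h_j)|}{1+\|x\|^r}<\infty,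 \] then for all $N\in\mathbb{N}$, $x_0\in\mathbb{R}^d$ and $\Delta t\in(0,\Delta t_0]$, \[ \Bigl|\mathbb{E}[\varphi(X_N)]-\int\varphi\,d\mu_\star\Bigr|\le \mathcal{N}_r(\varphi)\Bigl(\exp(-\gamma N\Delta t)\,\mathcal{Q}_r(\|x_0\|)+\Delta t\,\mathcal{P}_r(N\Delta t,\|x_0\|)\Bigr). \]
   Context: $d\in\mathbb{N}$; $\langle\cdot,\cdot\rangle$ and $\|\cdot\|$ are the standard inner product and norm on $\mathbb{R}^d$. $D^jg(x).(h_1,\ldots,h_j)$ denotes the $j$-th derivative of $g$ at $x$ in directions $h_1,\ldots,h_j\in\mathbb{R}^d$. $\sigma_1,\ldots,\sigma_K\in\mathbb{R}^d$ are fixed vectors, and $\beta^1,\ldots,\beta^K$ are independent standard real-valued Wiener processes on a probability space satisfying the usual conditions. Under the assumptions on $f$, the SDE is globally well-posed for any deterministic initial condition, its solutions have moments of all orders bounded uniformly in time, and it admits a unique invariant probability distribution $\mu_\star$. $\Delta t_0>0$ is arbitrarily fixed, $\Delta t\in(0,\Delta t_0]$ is the time-step size, $t_n=n\Delta t$, and $\Delta\beta_n^k=\beta^k(t_{n+1})-\beta^k(t_n)$. $\alpha\in(0,\infty)$ is a fixed parameter and $x_0\in\mathbb{R}^d$ is deterministic. The polynomials $\mathcal{P}_r,\mathcal{Q}_r$ may depend on $r$ and on the fixed data $f,\gamma,\sigma_1,\ldots,\sigma_K,\alpha,\Delta t_0,d$, but not on $\varphi,N,x_0,\Delta t$. *)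

(* Defs.v *)
From HB Require Import structures.
From mathcomp Require Import all_boot all_order all_algebra.
From mathcomp Require Import all_classical all_reals all_analysis.

Set Implicit Arguments.
Unset Strict Implicit.
Unset Printing Implicit Defensive.
Import Order.TTheory GRing.Theory Num.Theory.
Import numFieldNormedType.Exports.
Local Open Scope classical_set_scope.
Local Open Scope ring_scope.

(* The norm that the library puts on 'rV[R]_d is the maximum norm. It is used
   below only through the topology it induces (differentiability, continuity,
   Borel sets); every quantitative bound uses the Euclidean norm enorm. *)
Definition inner (R : realType) (d : nat) (u v : 'rV[R]_d) : R :=
  \sum_(i < d) u 0 i * v 0 i.

Definition enorm (R : realType) (d : nat) (u : 'rV[R]_d) : R :=
  Num.sqrt (inner u u).

(* R^d with its Borel sigma-algebra; the carrier is 'rV[R]_d. *)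
Definition borelRd (R : realType) (d : nat) :=
  g_sigma_algebraType (@open 'rV[R]_d).

(* D g(x).h and D^2 g(x).(h1, h2). *)
Definition D1 (R : realType) (d : nat) (V : normedModType R)
    (g : 'rV[R]_d -> V) (x h : 'rV[R]_d) : V :=
  'D_h g x.

Definition D2 (R : realType) (d : nat) (V : normedModType R)
    (g : 'rV[R]_d -> V) (x h1 h2 : 'rV[R]_d) : V :=
  'D_h2 (fun y => D1 g y h1) x.

(* R^d is finite-dimensional, so differentiability of Dg and continuity of
   D^2 g are equivalent to the same properties of their values in all fixed
   directions. *)
Definition class_C2 (R : realType) (d : nat) (V : normedModType R)
    (g : 'rV[R]_d -> V) : Prop :=
  [/\ forall x, differentiable g x,
      forall h x, differentiable (fun y => D1 g y h) x &
      forall h1 h2, continuous (fun x => D2 g x h1 h2)].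

(* The weighted C^2 norm, with values in [0, +oo]; nrm is the norm of the
   target space (enorm for f, the absolute value for the test function). *)
Definition growth_norm (R : realType) (d : nat) (V : normedModType R)
    (nrm : V -> R) (r : nat) (g : 'rV[R]_d -> V) : \bar R :=
  ereal_sup [set
    (((nrm (g x))%:E
      + ereal_sup [set (nrm (D1 g x h))%:E |
                    h in [set h : 'rV[R]_d | (enorm h <= 1)%R]]
      + ereal_sup [set (nrm (D2 g x h.1 h.2))%:E |
                    h in [set h : 'rV[R]_d * 'rV[R]_d |
                            (enorm h.1 <= 1)%R /\ (enorm h.2 <= 1)%R]])
     * ((1 + enorm x ^+ r)^-1)%:E)%E | x in [set: 'rV[R]_d]].

(* Processes and filtrations are indexed by all reals, but only their values
   at times t >= 0 are constrained. *)
Definition usual_conditions (R : realType) (dO : measure_display)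
    (Omega : measurableType dO) (P : probability Omega R)
    (F : R -> set (set Omega)) : Prop :=
  [/\ forall t : R, 0 <= t -> sigma_algebra setT (F t) /\ F t `<=` measurable,
      forall s t : R, 0 <= s -> s <= t -> F s `<=` F t,
      forall t : R, 0 <= t -> \bigcap_(s in [set s : R | t < s]) F s `<=` F t &
      forall A, P.-negligible A -> F 0 A].

Definition adapted (R : realType) (dO : measure_display)
    (Omega : measurableType dO) (F : R -> set (set Omega))
    (dT : measure_display) (T : measurableType dT) (X : R -> Omega -> T) :
    Prop :=
  forall t : R, 0 <= t -> forall B, measurable B -> F t (X t @^-1` B).

(* The second parameter of normal_prob is the standard deviation. *)
Definition wiener (R : realType) (dO : measure_display)
    (Omega : measurableType dO) (P : probability Omega R)
    (F : R -> set (set Omega)) (b : R -> Omega -> R) : Prop :=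
  [/\ adapted F b,
      {ae P, forall w, b 0 w = 0},
      {ae P, forall w, {within `[0, +oo[, continuous (b ^~ w)}},
      forall s t : R, 0 <= s -> s < t -> forall B : set R, measurable B ->
        P ((b t \- b s) @^-1` B) = normal_prob 0 (Num.sqrt (t - s)) B &
      forall s t : R, 0 <= s -> s < t -> forall (A : set Omega) (B : set R),
        F s A -> measurable B ->
        P (A `&` (b t \- b s) @^-1` B)
        = (P A * P ((b t \- b s)%R @^-1` B))%E].

Definition generated_sigma (R : realType) (dO : measure_display)
    (Omega : measurableType dO) (b : R -> Omega -> R) : set (set Omega) :=
  <<s \bigcup_(t in [set t : R | 0 <= t])
        preimage_set_system setT (b t) measurable >>.

Definition independent_processes (R : realType) (dO : measure_display)
    (Omega : measurableType dO) (P : probability Omega R) (K : nat)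
    (beta : 'I_K -> R -> Omega -> R) : Prop :=
  forall (J : {set 'I_K}) (A : 'I_K -> set Omega),
    (forall k, k \in J -> generated_sigma (beta k) (A k)) ->
    P (\bigcap_(k in [set` J]) A k) = (\prod_(k in J) P (A k))%E.

Definition independent_wieners (R : realType) (dO : measure_display)
    (Omega : measurableType dO) (P : probability Omega R)
    (F : R -> set (set Omega)) (K : nat) (beta : 'I_K -> R -> Omega -> R) :
    Prop :=
  (forall k, wiener P F (beta k)) /\ independent_processes P beta.

(* The noise is additive, so the stochastic integrals are sigma_k beta^k(t) and
   the integral form of the equation is pathwise. *)
Definition sde_solution (R : realType) (dO : measure_display)
    (Omega : measurableType dO) (P : probability Omega R)
    (F : R -> set (set Omega)) (d K : nat) (f : 'rV[R]_d -> 'rV[R]_d)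
    (sigma : 'I_K -> 'rV[R]_d) (beta : 'I_K -> R -> Omega -> R)
    (x0 : 'rV[R]_d) (X : R -> Omega -> 'rV[R]_d) : Prop :=
  [/\ adapted F (X : R -> Omega -> borelRd R d),
      {ae P, forall w, {within `[0, +oo[, continuous (X ^~ w)}} &
      {ae P, forall w, forall t : R, 0 <= t ->
        X t w = x0
          + \row_i (\int[lebesgue_measure]_(s in `[0, t]) f (X s w) 0 i)
          + \sum_(k < K) beta k t w *: sigma k}].

(* Invariance under the transition probabilities P(X^x(t) \in A), where X^x is
   the solution started at x. *)
Definition invariant_distribution (R : realType) (dO : measure_display)
    (Omega : measurableType dO) (P : probability Omega R)
    (F : R -> set (set Omega)) (d K : nat) (f : 'rV[R]_d -> 'rV[R]_d)
    (sigma : 'I_K -> 'rV[R]_d) (beta : 'I_K -> R -> Omega -> R)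
    (mu : probability (borelRd R d) R) : Prop :=
  exists X : 'rV[R]_d -> R -> Omega -> 'rV[R]_d,
    (forall x, sde_solution P F f sigma beta x (X x)) /\
    forall (t : R) (A : set (borelRd R d)), 0 <= t -> measurable A ->
      (\int[mu]_x P (X x t @^-1` A) = mu A)%E.

Fixpoint tamed_euler (R : realType) (Omega : Type) (d K : nat)
    (f : 'rV[R]_d -> 'rV[R]_d) (sigma : 'I_K -> 'rV[R]_d) (alpha dt : R)
    (beta : 'I_K -> R -> Omega -> R) (x0 : 'rV[R]_d) (n : nat) (w : Omega) :
    'rV[R]_d :=
  if n is m.+1 then
    let x := tamed_euler f sigma alpha dt beta x0 m w in
    x + (dt / (1 + alpha * dt * enorm (f x))) *: f x
      + \sum_(k < K) (beta k (m.+1%:R * dt) w - beta k (m%:R * dt) w) *: sigma k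
  else x0.

(* Main.v *)
Require Import Defs.
From mathcomp Require Import all_boot all_order all_algebra.
From mathcomp Require Import all_classical all_reals all_analysis.
From mathcomp Require Import measurable_realfun.
From mathcomp Require Import ring lra.

Set Implicit Arguments.
Unset Strict Implicit.
Unset Printing Implicit Defensive.
Import Order.TTheory GRing.Theory Num.Theory.
Import numFieldNormedType.Exports.
Local Open Scope classical_set_scope.
Local Open Scope ring_scope.

(** The noise is additive, so the tamed scheme with step [dt] is the image of
    one path under a deterministic map, and it can be compared path by path
    with the scheme of step [dt / m] driven by the same path.  Over one coarse
    step the taming and the drift increments contribute O(dt^2), except for the
    term [Df(y).(increment)], which has conditional mean zero; dissipativity
    absorbs the rest, so the mean square distance at time [T] is at most
    [dt^2 (1 + K T)^2] with [K] polynomial in [1 + |x0| + T], uniformly in [m].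
    As [m] grows the fine scheme converges to the solution along almost every
    path, and Fatou's lemma gives strong order one without Ito calculus and
    without the Kolmogorov equation.

    Two solutions driven by the same path contract like [exp(-gamma t)].  Since
    [mu] is invariant, starting the solution from [mu] independently of the
    noise leaves its law equal to [mu]; contraction then bounds the moments of
    [mu] by those of the solution started at 0, and compares the solution
    started at [x0] with the one started from [mu]. *)

(** * Euclidean norm *)

(** The drift is only locally Lipschitz, so every estimate over a coarse step carries a random
    coefficient, and such a coefficient in front of the squared error could not be separated from it
    in the mean. Dissipativity therefore serves to keep the squared error with factor exactly 1, and
    every other contribution is made at most linear in the error. Cauchy-Schwarz then leaves the
    deterministic recursion u' <= u + dt^2 L sqrt u + dt^3 L, and sqrt u grows only linearly in
    time. The coefficients need moments of all orders, uniform in the fine step and polynomial in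
    the horizon. They come from a pathwise bound of the scheme by Riemann sums of powers of the
    noise: Jensen's inequality gives such sums moments that do not see the number of grid points. In
    the comparison with [mu] the exponential must multiply a polynomial in |x0| alone. The solution
    started at x0 is there bounded through the stationary one, whose moments do not depend on
    time. *)

Section euclidean.
Variables (R : realType) (d : nat).
Implicit Types u v w : 'rV[R]_d.

Lemma innerC u v : inner u v = inner v u.
Proof. by apply: eq_bigr => i _; rewrite mulrC. Qed.

Lemma innerDl u v w : inner (u + v) w = inner u w + inner v w.
Proof. by rewrite -big_split/=; apply: eq_bigr => i _; rewrite mxE mulrDl. Qed.

Lemma innerZl a u v : inner (a *: u) v = a * inner u v.
Proof. by rewrite big_distrr/=; apply: eq_bigr => i _; rewrite mxE mulrA. Qed.

Lemma innerDr u v w : inner w (u + v) = inner w u + inner w v.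
Proof. by rewrite innerC innerDl !(innerC w). Qed.

Lemma innerZr a u v : inner v (a *: u) = a * inner v u.
Proof. by rewrite innerC innerZl innerC. Qed.

Lemma innerNl u v : inner (- u) v = - inner u v.
Proof. by rewrite -scaleN1r innerZl mulN1r. Qed.

Lemma innerNr u v : inner v (- u) = - inner v u.
Proof. by rewrite innerC innerNl innerC. Qed.

Lemma inner0r u : inner u 0 = 0.
Proof. by rewrite -(scale0r u) innerZr mul0r. Qed.

Lemma inner_sumr (I : Type) (s : seq I) (P : pred I) (F : I -> 'rV[R]_d) u :
  inner u (\sum_(i <- s | P i) F i) = \sum_(i <- s | P i) inner u (F i).
Proof.
elim/big_rec2: _ => [|i a b _ <-]; first exact: inner0r.
by rewrite innerDr.
Qed.

Lemma inner_ge0 u : 0 <= inner u u.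
Proof. by apply: sumr_ge0 => i _; rewrite -expr2 sqr_ge0. Qed.

Lemma enorm_ge0 u : 0 <= enorm u.
Proof. exact: sqrtr_ge0. Qed.

Lemma enorm_sqr u : enorm u ^+ 2 = inner u u.
Proof. by rewrite sqr_sqrtr ?inner_ge0. Qed.

Lemma coord_le_enorm u i : `|u 0 i| <= enorm u.
Proof.
rewrite -(@ler_pXn2r _ 2) ?nnegrE ?enorm_ge0// enorm_sqr real_normK ?num_real//.
rewrite /inner (bigD1 i)//= expr2 lerDl; apply: sumr_ge0 => j _.
by rewrite -expr2 sqr_ge0.
Qed.

Lemma enorm_eq0 u : enorm u = 0 -> u = 0.
Proof.
move=> u0; apply/rowP => i; rewrite mxE; apply/eqP.
by rewrite -normr_le0 -u0 coord_le_enorm.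
Qed.

Lemma enorm0 : enorm (0 : 'rV[R]_d) = 0.
Proof. by rewrite /enorm inner0r sqrtr0. Qed.

Lemma enormZ a u : enorm (a *: u) = `|a| * enorm u.
Proof.
by rewrite /enorm innerZl innerZr mulrA -expr2 sqrtrM ?sqr_ge0// sqrtr_sqr.
Qed.

Lemma enormN u : enorm (- u) = enorm u.
Proof. by rewrite -scaleN1r enormZ normrN1 mul1r. Qed.

Lemma enorm_distC u v : enorm (u - v) = enorm (v - u).
Proof. by rewrite -enormN opprB. Qed.

(** Expand the nonnegative square of [enorm v *: u - enorm u *: v] and divide by
    [enorm u * enorm v]; null vectors are set aside to make the divisor positive. *)
Lemma inner_le u v : inner u v <= enorm u * enorm v.
Proof.
have [u0|u0] := eqVneq (enorm u) 0.
  by rewrite u0 mul0r (enorm_eq0 u0) innerC inner0r.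
have [v0|v0] := eqVneq (enorm v) 0.
  by rewrite v0 mulr0 (enorm_eq0 v0) inner0r.
have ab : 0 < enorm u * enorm v.
  by rewrite mulr_gt0// lt_neqAle enorm_ge0 eq_sym ?u0 ?v0.
have := inner_ge0 (enorm v *: u - enorm u *: v).
rewrite innerDl !innerDr !innerNl !innerNr !innerZl !innerZr -!enorm_sqr (innerC v u).
move=> h; rewrite -(ler_pM2l ab); nra.
Qed.

Lemma inner_norm_le u v : `|inner u v| <= enorm u * enorm v.
Proof. 
rewrite ler_norml inner_le andbT lerNl -innerNl.
by rewrite (le_trans (inner_le _ _))// enormN. Qed.

Lemma enormD u v : enorm (u + v) <= enorm u + enorm v.
Proof.
rewrite -(@ler_pXn2r _ 2) ?nnegrE ?addr_ge0 ?enorm_ge0//.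
rewrite enorm_sqr innerDl !innerDr -!enorm_sqr (innerC v u).
by have := inner_le u v; nra.
Qed.

Lemma enormB u v : enorm (u - v) <= enorm u + enorm v.
Proof. by rewrite (le_trans (enormD _ _))// enormN. Qed.

Lemma enormD_sqr u v :
  enorm (u + v) ^+ 2 = enorm u ^+ 2 + 2 * inner u v + enorm v ^+ 2.
Proof. by rewrite !enorm_sqr innerDl !innerDr (innerC v u); ring. Qed.

Lemma enorm_sum (I : Type) (s : seq I) (P : pred I) (F : I -> 'rV[R]_d) :
  enorm (\sum_(i <- s | P i) F i) <= \sum_(i <- s | P i) enorm (F i).
Proof.
elim/big_rec2: _ => [|i a b _ h]; first by rewrite enorm0.
by rewrite (le_trans (enormD _ _))// lerD2l.
Qed.

Lemma enorm_le_sum u : enorm u <= \sum_(i < d) `|u 0 i|.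
Proof.
have S0 : 0 <= \sum_(i < d) `|u 0 i| by apply: sumr_ge0.
rewrite -(@ler_pXn2r _ 2) ?nnegrE ?enorm_ge0// enorm_sqr expr2 big_distrl/=.
apply: ler_sum => i _; rewrite (le_trans (ler_norm _))// normrM ler_wpM2l//.
by rewrite (bigD1 i)//= lerDl; apply: sumr_ge0.
Qed.

Lemma continuous_inner (T : topologicalType) (g h : T -> 'rV[R]_d) :
  continuous g -> continuous h -> continuous (fun x => inner (g x) (h x)).
Proof.
move=> cg ch x; rewrite /continuous_at /inner.
elim: (index_enum _) => [|i s IH].
  rewrite [X in X @ _](_ : _ = cst 0); last by apply/funext => y; rewrite big_nil.
  by rewrite big_nil; exact: cvg_cst.
rewrite big_cons [X in X @ _](_ : _ = fun y => g y 0 i * h y 0 i +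
    \sum_(j <- s) g y 0 j * h y 0 j); last by apply/funext => y; rewrite big_cons.
apply: cvgD; last exact: IH.
apply: cvgM; apply: (@cvg_comp _ _ _ _ (fun M : 'rV[R]_d => M 0 i));
  [exact: cg|exact: coord_continuous|exact: ch|exact: coord_continuous].
Qed.

Lemma continuous_enorm : continuous (@enorm R d).
Proof.
have ci : continuous (fun x : 'rV[R]_d => inner x x).
  by apply: continuous_inner => x; exact: cvg_id.
by move=> x; exact: cvg_comp (ci x) (@sqrt_continuous R _).
Qed.

End euclidean.

(** * Growth of drift and test functions *)

Section growth.
Variables (R : realType) (d : nat).

(** All three summands are nonnegative, so a finite supremum of their sum bounds each one
    separately; the estimates can then work with a real constant. *)
Lemma growth_normP (V : normedModType R) (nrm : V -> R) r (g : 'rV[R]_d -> V) :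
  (forall u, 0 <= nrm u) -> (growth_norm nrm r g < +oo)%E ->
  exists2 N, 0 <= N & growth_norm nrm r g = N%:E /\ forall x,
    [/\ nrm (g x) <= N * (1 + enorm x ^+ r),
      forall h, enorm h <= 1 -> nrm (D1 g x h) <= N * (1 + enorm x ^+ r) &
      forall h1 h2, enorm h1 <= 1 -> enorm h2 <= 1 ->
        nrm (D2 g x h1 h2) <= N * (1 + enorm x ^+ r)].
Proof.
move=> nrm0 gy.
pose s1 x := ereal_sup [set (nrm (D1 g x h))%:E | h in [set h | enorm h <= 1]].
pose s2 x := ereal_sup [set (nrm (D2 g x h.1 h.2))%:E |
  h in [set h : 'rV[R]_d * 'rV[R]_d | enorm h.1 <= 1 /\ enorm h.2 <= 1]].
have s1_ge x h : enorm h <= 1 -> ((nrm (D1 g x h))%:E <= s1 x)%E.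
  by move=> h1; apply: ereal_sup_ubound; exists h.
have s2_ge x h1 h2 : enorm h1 <= 1 -> enorm h2 <= 1 ->
    ((nrm (D2 g x h1 h2))%:E <= s2 x)%E.
  by move=> ? ?; apply: ereal_sup_ubound; exists (h1, h2).
(* The zero direction lies in the unit ball, which makes the inner suprema nonnegative instead of
   [-oo]. *)
have e01 : enorm (0 : 'rV[R]_d) <= 1 by rewrite enorm0.
have s10 x : (0 <= s1 x)%E by rewrite (le_trans _ (s1_ge x 0 e01))// lee_fin.
have s20 x : (0 <= s2 x)%E by rewrite (le_trans _ (s2_ge x 0 0 e01 e01))// lee_fin.
have w0 (x : 'rV[R]_d) : 0 < 1 + enorm x ^+ r by rewrite ltr_pwDl// exprn_ge0// enorm_ge0.
have T_le x : (((nrm (g x))%:E + s1 x + s2 x) * (1 + enorm x ^+ r)^-1%:E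
    <= growth_norm nrm r g)%E by apply: ereal_sup_ubound; exists x.
have T0 x : (0 <= ((nrm (g x))%:E + s1 x + s2 x) * (1 + enorm x ^+ r)^-1%:E)%E.
  apply: mule_ge0; last by rewrite lee_fin invr_ge0 ltW.
  by apply: adde_ge0 => //; apply: adde_ge0 => //; rewrite lee_fin.
have gfin : growth_norm nrm r g \is a fin_num.
  by rewrite ge0_fin_numE// (le_trans (T0 0) (T_le 0)).
exists (fine (growth_norm nrm r g)).
  by rewrite fine_ge0// (le_trans (T0 0) (T_le 0)).
rewrite fineK//; split=> // x.
have := T_le x; rewrite -[X in (_ <= X)%E]fineK// lee_pdivrMr// -EFinM => Tx.
split=> [|h h1|h1 h2 h11 h21]; rewrite -lee_fin; apply: le_trans Tx.
- by rewrite -addeA leeDl// adde_ge0.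
- rewrite (le_trans (s1_ge x h h1))// addeAC leeDr// adde_ge0// lee_fin.
  exact: nrm0.
- rewrite (le_trans (s2_ge x h1 h2 _ _))// leeDr// adde_ge0// lee_fin.
  exact: nrm0.
Qed.

Lemma enorm_normalize (h : 'rV[R]_d) :
  exists2 u : 'rV[R]_d, enorm u <= 1 & h = enorm h *: u.
Proof.
have [h0|h0] := eqVneq (enorm h) 0.
  by exists 0; rewrite ?enorm0// h0 (enorm_eq0 h0) scaler0.
exists ((enorm h)^-1 *: h); last by rewrite scalerA divff// scale1r.
by rewrite enormZ ger0_norm ?invr_ge0 ?enorm_ge0// mulVf.
Qed.

Lemma D1_scale (V : normedModType R) (g : 'rV[R]_d -> V) x a h :
  differentiable g x -> D1 g x (a *: h) = a *: D1 g x h.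
Proof. by move=> dg; rewrite /D1 !deriveE// linearZ. Qed.

Lemma D1_sum (V : normedModType R) (g : 'rV[R]_d -> V) x (I : Type) (s : seq I)
    (P : pred I) (F : I -> 'rV[R]_d) : differentiable g x ->
  D1 g x (\sum_(i <- s | P i) F i) = \sum_(i <- s | P i) D1 g x (F i).
Proof.
move=> dg; rewrite /D1 deriveE// linear_sum.
by apply: eq_bigr => i _; rewrite deriveE.
Qed.

Lemma D1D (V : normedModType R) (g : 'rV[R]_d -> V) x h1 h2 :
  differentiable g x -> D1 g x (h1 + h2) = D1 g x h1 + D1 g x h2.
Proof. by move=> dg; rewrite /D1 !deriveE// linearD. Qed.

Lemma D2_scale (V : normedModType R) (g : 'rV[R]_d -> V) x a h :
  class_C2 g -> D2 g x (a *: h) (a *: h) = (a ^+ 2) *: D2 g x h h.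
Proof.
case=> dg ddg _; rewrite /D2.
rewrite (_ : (fun y => D1 g y (a *: h)) = (a \*: (fun y => D1 g y h))); last first.
  by apply/funext => y; rewrite D1_scale.
have db : derivable (fun y => D1 g y h) x (a *: h) by exact: diff_derivable.
have E : 'D_(a *: h) (fun y => D1 g y h) x = a *: 'D_h (fun y => D1 g y h) x.
  by rewrite !deriveE// linearZ.
by rewrite (deriveZ _ db) E scalerA expr2.
Qed.

Lemma mean_value (g : 'rV[R]_d -> R) (x v : 'rV[R]_d) :
  (forall y, differentiable g y) ->
  exists2 s, 0 <= s <= 1 & g (x + v) - g x = D1 g (x + s *: v) v.
Proof.
move=> dg; pose G (s : R) := g (x + s *: v).
have Gd (s : R) : is_derive s (1 : R) G (D1 g (x + s *: v) v).
  have e : (fun h : R => h^-1 *: (G (h *: (1 : R) + s) - G s)) =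
      (fun h : R => h^-1 *: (g (h *: v + (x + s *: v)) - g (x + s *: v))).
    apply/funext => h; rewrite /G; congr (_ *: (g _ - _)).
    by rewrite [h *: 1]mulr1 scalerDl addrCA.
  have dv : derivable g (x + s *: v) v by exact: diff_derivable.
  apply: DeriveDef.
    by rewrite /derivable /= e.
  by rewrite /derive /= e.
have [] := @MVT R G (fun s => D1 g (x + s *: v) v) 0 1.
- by [].
- apply: continuous_subspaceT => s; apply: differentiable_continuous.
  by apply/derivable1_diffP; case: (Gd s).
move=> s; rewrite in_itv/= => /andP[s0 s1].
rewrite /G scale1r scale0r addr0 subr0 mulr1 => ->.
by exists s; rewrite // (ltW s0) (ltW s1).
Qed.

(** The mean value theorem is applied along [v], then to the derivative in direction [v] along
    [s *: v]; the factor [s <= 1] stands in for the 1/2 of Taylor's formula. *)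
Lemma mean_value2 (g : 'rV[R]_d -> R) (x v : 'rV[R]_d) : class_C2 g ->
  exists2 s, 0 <= s <= 1 & exists2 t, 0 <= t <= 1 &
    g (x + v) - g x - D1 g x v = s * D2 g (x + t *: v) v v.
Proof.
case=> dg ddg _; have [s s01 ->] := mean_value x v dg.
have [t /andP[t0 t1]] := mean_value x (s *: v) (ddg v).
rewrite (D1_scale s v (ddg v _)) => ->; exists s => //.
exists (t * s); last by rewrite scalerA.
by case/andP: s01 => s0 s1; rewrite mulr_ge0//= mulr_ile1.
Qed.

Lemma enorm_segment (x y : 'rV[R]_d) s : 0 <= s <= 1 ->
  enorm (x + s *: (y - x)) <= enorm x + enorm y.
Proof.
case/andP=> s0 s1.
rewrite (_ : x + _ = (1 - s) *: x + s *: y); last first.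
  by rewrite scalerBr scalerBl scale1r -addrA (addrC (- _)).
rewrite (le_trans (enormD _ _))// !enormZ !ger0_norm ?subr_ge0//.
by rewrite lerD// ler_piMl ?enorm_ge0// lerBlDr lerDl.
Qed.

(** Weights of the form [(1 + b) ^+ q] replace those of the norm: they are at least 1, monotone in
    [b], and their products and powers have the same form. *)
Lemma weight_le (a b : R) q : 0 <= a -> a <= b -> 1 + a ^+ q <= 2 * (1 + b) ^+ q.
Proof.
move=> a0 ab; rewrite mulr2n mulrDl !mul1r lerD//.
  by rewrite exprn_ege1// lerDl (le_trans a0).
by rewrite lerXn2r// ?nnegrE; lra.
Qed.

(** Homogeneity carries the bound from the unit ball, over which the norm takes its supremum, to
    every direction. *)
Lemma D1_growth (V : normedModType R) (nrm : V -> R) (g : 'rV[R]_d -> V) N q x h :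
  (forall a u, nrm (a *: u) = `|a| * nrm u) -> differentiable g x ->
  (forall h, enorm h <= 1 -> nrm (D1 g x h) <= N * (1 + enorm x ^+ q)) ->
  nrm (D1 g x h) <= N * (1 + enorm x ^+ q) * enorm h.
Proof.
move=> nZ dg b; have [u u1 hE] := enorm_normalize h.
rewrite {1}hE D1_scale// nZ ger0_norm ?enorm_ge0// mulrC.
by rewrite ler_wpM2r ?enorm_ge0// b.
Qed.

Lemma D2_growth (V : normedModType R) (nrm : V -> R) (g : 'rV[R]_d -> V) N q x h :
  (forall a u, nrm (a *: u) = `|a| * nrm u) -> class_C2 g ->
  (forall h1 h2, enorm h1 <= 1 -> enorm h2 <= 1 ->
     nrm (D2 g x h1 h2) <= N * (1 + enorm x ^+ q)) ->
  nrm (D2 g x h h) <= N * (1 + enorm x ^+ q) * enorm h ^+ 2.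
Proof.
move=> nZ dg b; have [u u1 hE] := enorm_normalize h.
rewrite {1 2}hE D2_scale// nZ ger0_norm ?sqr_ge0// mulrC.
by rewrite ler_wpM2r ?sqr_ge0// b.
Qed.

Lemma lipschitz_of_growth (g : 'rV[R]_d -> R) N q : 0 <= N ->
  (forall x, differentiable g x) ->
  (forall x h, `|D1 g x h| <= N * (1 + enorm x ^+ q) * enorm h) ->
  forall x y,
    `|g y - g x| <= 2 * N * (1 + enorm x + enorm y) ^+ q * enorm (y - x).
Proof.
move=> N0 dg b x y; have [s s01] := mean_value x (y - x) dg.
rewrite (addrC x (y - x)) subrK => ->.
rewrite (le_trans (b _ _))// ler_wpM2r ?enorm_ge0// -mulrA mulrCA ler_wpM2l//.
by rewrite -addrA weight_le ?enorm_ge0// enorm_segment.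
Qed.

Lemma taylor_of_growth (g : 'rV[R]_d -> R) N q : 0 <= N -> class_C2 g ->
  (forall x h, `|D2 g x h h| <= N * (1 + enorm x ^+ q) * enorm h ^+ 2) ->
  forall x y, `|g y - g x - D1 g x (y - x)|
    <= 2 * N * (1 + enorm x + enorm y) ^+ q * enorm (y - x) ^+ 2.
Proof.
move=> N0 dg b x y; have [s /andP[s0 s1] [t t01]] := mean_value2 x (y - x) dg.
rewrite (addrC x (y - x)) subrK => ->.
rewrite normrM ger0_norm// (@le_trans _ _ `|D2 g (x + t *: (y - x)) (y - x) (y - x)|)//.
  by rewrite ler_piMl.
rewrite (le_trans (b _ _))// ler_wpM2r ?sqr_ge0// -mulrA mulrCA ler_wpM2l//.
by rewrite -addrA weight_le ?enorm_ge0// enorm_segment.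
Qed.

(** The quantitative form in which the regularity of the drift enters all later estimates, with one
    constant and one exponent so that products of the bounds combine. *)
Definition drift_growth (C : R) q (f : 'rV[R]_d -> 'rV[R]_d) :=
  [/\ forall x, enorm (f x) <= C * (1 + enorm x) ^+ q,
      forall x y, enorm (f y - f x)
        <= C * (1 + enorm x + enorm y) ^+ q * enorm (y - x),
      forall x y, enorm (f y - f x - D1 f x (y - x))
        <= C * (1 + enorm x + enorm y) ^+ q * enorm (y - x) ^+ 2 &
      forall x h, enorm (D1 f x h) <= C * (1 + enorm x) ^+ q * enorm h].

Lemma coord_C2 (f : 'rV[R]_d -> 'rV[R]_d) i : class_C2 f ->
  [/\ class_C2 (fun x => f x 0 i),
      forall x h, D1 (fun x => f x 0 i) x h = D1 f x h 0 i &
      forall x h1 h2, D2 (fun x => f x 0 i) x h1 h2 = D2 f x h1 h2 0 i].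
Proof.
case=> df ddf cf.
have dcoord (g : 'rV[R]_d -> 'rV[R]_d) x :
    differentiable g x -> differentiable (fun x => g x 0 i) x.
  move=> dg; apply: (@differentiable_comp _ _ _ _ g (fun M : 'rV[R]_d => M 0 i)) => //.
  exact: differentiable_coord.
have Dcoord (g : 'rV[R]_d -> 'rV[R]_d) x h :
    differentiable g x -> D1 (fun x => g x 0 i) x h = D1 g x h 0 i.
  by move=> dg; rewrite /D1 derive_mx ?mxE//; exact: diff_derivable.
have E1 x h : D1 (fun x => f x 0 i) x h = D1 f x h 0 i by exact: Dcoord.
have E1f h : (fun y => D1 (fun x => f x 0 i) y h) = (fun y => D1 f y h 0 i).
  by apply/funext => y; exact: E1.
have E2 x h1 h2 : D2 (fun x => f x 0 i) x h1 h2 = D2 f x h1 h2 0 i.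
  by rewrite /D2 E1f; exact: Dcoord.
split=> //; split.
- by move=> x; exact: dcoord.
- by move=> h x; rewrite E1f; exact: dcoord.
- move=> h1 h2.
  rewrite (_ : (fun x => D2 (fun x => f x 0 i) x h1 h2) =
    (fun x => D2 f x h1 h2 0 i)); last by apply/funext => y; rewrite E2.
  move=> x; apply: (@cvg_comp _ _ _ (fun x => D2 f x h1 h2)
    (fun M : 'rV[R]_d => M 0 i)); [exact: cf|exact: coord_continuous].
Qed.

(** The mean value theorem is a scalar statement, so increments of [f] are bounded coordinate by
    coordinate and the coordinates are summed afterwards. *)
Lemma drift_growthP (f : 'rV[R]_d -> 'rV[R]_d) : class_C2 f ->
  (exists q : nat, (growth_norm (@enorm R d) q f < +oo)%E) ->
  exists C q, 1 <= C /\ drift_growth C q f.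
Proof.
move=> fC2 [q /growth_normP[|N N0 [_ b]]]; first exact: enorm_ge0.
have [df ddf cf] := fC2.
have b1 x h : enorm (D1 f x h) <= N * (1 + enorm x ^+ q) * enorm h.
  by apply: D1_growth => //; [exact: enormZ|case: (b x)].
have b2 x h : enorm (D2 f x h h) <= N * (1 + enorm x ^+ q) * enorm h ^+ 2.
  by apply: D2_growth => //; [exact: enormZ|case: (b x)].
have w (x : 'rV[R]_d) : N * (1 + enorm x ^+ q) <= 2 * N * (1 + enorm x) ^+ q.
  by rewrite -mulrA mulrCA ler_wpM2l// weight_le ?enorm_ge0.
(* [1] ensures [1 <= C], [2 * N] comes from the change of weight, and [d] from summing the
   coordinate bounds. *)
pose C := 1 + 2 * N * (1 + d%:R).
have CN : 2 * N <= C.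
  by rewrite /C mulrDr mulr1 addrCA lerDl addr_ge0// !mulr_ge0.
have CdN : d%:R * (2 * N) <= C.
  by rewrite /C mulrDr mulr1 addrA (mulrC d%:R) lerDr addr_ge0// mulr_ge0.
have wpos (x y : 'rV[R]_d) : 0 <= (1 + enorm x + enorm y) ^+ q.
  by rewrite exprn_ge0// !addr_ge0 ?enorm_ge0.
have wpos1 (x : 'rV[R]_d) : 0 <= (1 + enorm x) ^+ q.
  by rewrite exprn_ge0// !addr_ge0 ?enorm_ge0.
have vec (u : 'rV[R]_d) B : 0 <= B -> (forall i, `|u 0 i| <= 2 * N * B) ->
    enorm u <= C * B.
  move=> B0 uB; rewrite (le_trans (enorm_le_sum _))//.
  rewrite (@le_trans _ _ (\sum_(i < d) 2 * N * B))//; first exact: ler_sum.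
  by rewrite sumr_const card_ord -[leLHS]mulr_natl mulrA ler_wpM2r.
exists C, q; split; first by rewrite lerDl mulr_ge0 ?mulr_ge0.
split=> [x|x y|x y|x h].
- have [b0 _ _] := b x.
  by rewrite (le_trans b0)// (le_trans (w x))// ler_wpM2r.
- rewrite -mulrA; apply: vec; first by rewrite mulr_ge0 ?enorm_ge0.
  move=> i; rewrite !mxE mulrA; have [[di _ _] E1 _] := coord_C2 i fC2.
  apply: (lipschitz_of_growth N0 di) => {}x h; rewrite E1.
  exact: le_trans (coord_le_enorm _ _) (b1 _ _).
- rewrite -mulrA; apply: vec; first by rewrite mulr_ge0 ?sqr_ge0.
  move=> i; rewrite !mxE mulrA; have [Ci E1 E2] := coord_C2 i fC2.
  rewrite -E1; apply: (taylor_of_growth N0 Ci) => {}x h; rewrite E2.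
  exact: le_trans (coord_le_enorm _ _) (b2 _ _).
- rewrite (le_trans (b1 x h))// ler_wpM2r ?enorm_ge0// (le_trans (w x))//.
  by rewrite ler_wpM2r.
Qed.

Lemma test_growthP (phi : 'rV[R]_d -> R) r : class_C2 phi ->
  (growth_norm (fun y : R => `|y|%R) r phi < +oo)%E ->
  exists2 N, 0 <= N & [/\ growth_norm (fun y : R => `|y|%R) r phi = N%:E,
    forall x, `|phi x| <= 2 * N * (1 + enorm x) ^+ r &
    forall x y, `|phi y - phi x|
      <= 2 * N * (1 + enorm x + enorm y) ^+ r * enorm (y - x)].
Proof.
move=> pC2 /growth_normP[//|N N0 [E b]].
have [dp _ _] := pC2.
exists N => //; split=> // [x|].
  have [b0 _ _] := b x; rewrite (le_trans b0)// -mulrA mulrCA ler_wpM2l//.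
  by rewrite weight_le ?enorm_ge0.
apply: lipschitz_of_growth => // x h.
by apply: (@D1_growth _ (fun y : R => `|y|)) => //; [exact: normrM|case: (b x)].
Qed.

End growth.

(** * Pathwise moment bound for the tamed scheme *)

Section power_means.
Variable R : realType.

(** Induction on Chebyshev's sum inequality: summing (a_i - a_j)(a_i^k - a_j^k) >= 0 over all pairs
    compares the product of the sums of a_i and a_i^k with the sum of a_i^(k+1). *)
Lemma power_sum_le (I : Type) (s : seq I) (a : I -> R) m : (forall i, 0 <= a i) ->
  (\sum_(i <- s) a i) ^+ m.+1 <= (size s)%:R ^+ m * \sum_(i <- s) a i ^+ m.+1.
Proof.
move=> a0; have S0 k : 0 <= \sum_(i <- s) a i ^+ k.
  by apply: sumr_ge0 => i _; rewrite exprn_ge0.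
have chebyshev k : (\sum_(i <- s) a i) * (\sum_(i <- s) a i ^+ k)
    <= (size s)%:R * \sum_(i <- s) a i ^+ k.+1.
  have H2 : \sum_(i <- s) \sum_(j <- s) (a i * a j ^+ k + a j * a i ^+ k)
      <= \sum_(i <- s) \sum_(j <- s) (a i ^+ k.+1 + a j ^+ k.+1).
    apply: ler_sum => i _; apply: ler_sum => j _; rewrite !exprS -subr_ge0.
    rewrite (_ : _ - _ = (a i - a j) * (a i ^+ k - a j ^+ k)); last by ring.
    have [ij|ji] := leP (a i) (a j).
      by rewrite mulr_le0 ?subr_le0// lerXn2r ?nnegrE.
    by rewrite mulr_ge0 ?subr_ge0 ?(ltW ji)// lerXn2r ?nnegrE// ltW.
  have e1 : \sum_(i <- s) \sum_(j <- s) (a i * a j ^+ k + a j * a i ^+ k)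
      = 2 * ((\sum_(i <- s) a i) * (\sum_(i <- s) a i ^+ k)).
    under eq_bigr do rewrite big_split/= -mulr_sumr -mulr_suml.
    by rewrite big_split/= -mulr_suml -mulr_sumr; ring.
  have e2 : \sum_(i <- s) \sum_(j <- s) (a i ^+ k.+1 + a j ^+ k.+1)
      = 2 * ((size s)%:R * \sum_(i <- s) a i ^+ k.+1).
    under eq_bigr do rewrite big_split/= big_const_seq count_predT iter_addr_0.
    rewrite big_split/= big_const_seq count_predT iter_addr_0 sumrMnl.
    by rewrite -mulr_natl; ring.
  by move: H2; rewrite e1 e2 ler_pM2l.
elim: m => [|m IH]; first by rewrite expr0 mul1r expr1; under [leRHS]eq_bigr do rewrite expr1.
rewrite exprS; apply: le_trans (ler_wpM2l (sumr_ge0 _ (fun i _ => a0 i)) IH) _.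
rewrite mulrCA (exprSr (size s)%:R) -mulrA ler_wpM2l ?exprn_ge0//.
Qed.

Lemma size_index_enum_ord n : size (index_enum 'I_n) = n.
Proof. by rewrite /index_enum; case: index_enum_key; rewrite /= -enumT size_enum_ord. Qed.

(** Jensen's inequality for a Riemann sum: the constant depends on the horizon [n%:R * h] and not on
    the number of points by itself. *)
Lemma power_mean_le n (h : R) (a : nat -> R) m : 0 <= h -> (forall i, 0 <= a i) ->
  (h * \sum_(i < n) a i) ^+ m.+1
    <= (n%:R * h) ^+ m * (h * \sum_(i < n) a i ^+ m.+1).
Proof.
move=> h0 a0; have := @power_sum_le _ (index_enum 'I_n) a m a0.
rewrite size_index_enum_ord; set A := \sum_(i < n) a i.
set B := \sum_(i < n) a i ^+ m.+1; rewrite !exprMn => le.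
rewrite (_ : _ * (h * B) = h ^+ m.+1 * (n%:R ^+ m * B)).
  by rewrite ler_wpM2l// exprn_ge0.
by rewrite exprSr; ring.
Qed.

Lemma powerD_le (a b : R) p : 0 <= a -> 0 <= b ->
  (a + b) ^+ p <= 2 ^+ p * (a ^+ p + b ^+ p).
Proof.
move=> a0 b0; wlog ab : a b a0 b0 / a <= b.
  by move=> W; have [/W|/ltW/W] := leP a b; [exact|rewrite addrC (addrC (a ^+ p)); exact].
apply: (@le_trans _ _ ((2 * b) ^+ p)).
  by rewrite lerXn2r ?nnegrE; lra.
by rewrite exprMn ler_wpM2l ?exprn_ge0// lerDr exprn_ge0.
Qed.

End power_means.

(** * Tamed steps and their energy estimate *)

Section tamed_scheme.
Variables (R : realType) (d : nat) (f : 'rV[R]_d -> 'rV[R]_d) (alpha : R).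
Hypothesis alpha_gt0 : 0 < alpha.
Implicit Types (x : 'rV[R]_d) (h : R) (w : nat -> 'rV[R]_d).

Definition tamed h x := (1 + alpha * h * enorm (f x))^-1 *: f x.

(** The driving path is an arbitrary sequence of sampled values, of which only the increments enter,
    so bounds proved here hold path by path. *)
Fixpoint tamed_path h w x0 n : 'rV[R]_d :=
  if n is m.+1 then
    let x := tamed_path h w x0 m in x + h *: tamed h x + (w m.+1 - w m)
  else x0.

Let den_ge1 h x : 0 <= h -> 1 <= 1 + alpha * h * enorm (f x).
Proof. by move=> h0; rewrite lerDl !mulr_ge0 ?enorm_ge0// ltW. Qed.

Lemma tamed_le h x : 0 <= h -> enorm (tamed h x) <= enorm (f x).
Proof.
move=> h0; rewrite enormZ ger0_norm ?invr_ge0 ?(le_trans ler01 (den_ge1 _ _))//.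
by rewrite ler_piMl ?enorm_ge0// invf_le1 ?den_ge1// (lt_le_trans ltr01 (den_ge1 _ _)).
Qed.

Lemma tamed_bounded h x : 0 <= h -> h * enorm (tamed h x) <= alpha^-1.
Proof.
move=> h0; have d1 := den_ge1 x h0; have d0 := lt_le_trans ltr01 d1.
rewrite enormZ ger0_norm ?invr_ge0 ?(ltW d0)// mulrCA ler_pdivrMl//.
rewrite ler_pdivlMr// mulrC mulrA; lra.
Qed.

(** With F = alpha h |f x| the discarded fraction of the drift is 1 - 1/(1 + F) <= F. *)
Lemma tamed_err h x : 0 <= h ->
  enorm (tamed h x - f x) <= alpha * h * enorm (f x) ^+ 2.
Proof.
move=> h0; have d1 := den_ge1 x h0; have d0 := lt_le_trans ltr01 d1.
rewrite /tamed -[X in _ - X]scale1r -scalerBl enormZ distrC ger0_norm; last first.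
  by rewrite subr_ge0 invf_le1.
rewrite expr2 mulrA ler_wpM2r ?enorm_ge0//.
have := mulVf (lt0r_neq0 d0); have : (1 + alpha * h * enorm (f x))^-1 <= 1.
  by rewrite invf_le1.
have : 0 <= alpha * h * enorm (f x) by rewrite !mulr_ge0 ?enorm_ge0 ?(ltW alpha_gt0).
by set F := alpha * h * _; set t := (1 + F)^-1; nra.
Qed.

Variables (C gamma : R) (q : nat).
Hypotheses (C_ge1 : 1 <= C) (gamma_gt0 : 0 < gamma).
Hypothesis f_poly : forall x, enorm (f x) <= C * (1 + enorm x) ^+ q.
Hypothesis f_diss : forall x1 x2,
  inner (f x2 - f x1) (x2 - x1) <= - gamma * enorm (x2 - x1) ^+ 2.

Section moment.
Variables (h : R) (w : nat -> 'rV[R]_d) (x0 : 'rV[R]_d) (N : nat).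
Hypotheses (h_gt0 : 0 < h) (w0 : w 0 = 0).
Let X := tamed_path h w x0.
(** Removing the noise leaves a recursion moved by the tamed drift alone, to which a deterministic
    energy estimate applies. *)
Let V n := X n - w n.
Let g j := 1 + enorm (w j).
(** Budget for the square of [V]: the term in [g] is what Young's inequality leaves of f(w) against
    the dissipation, and [+ 1] pays for the quadratic term h^2 |f|^2 <= h. *)
Let E n := enorm x0 ^+ 2 +
  h * \sum_(j < n) (C ^+ 2 / (2 * gamma) * g j ^+ (2 * q) + 1).

Let g_ge1 j : 1 <= g j. Proof. by rewrite lerDl enorm_ge0. Qed.
Let g_ge0 j : 0 <= g j. Proof. exact: le_trans (g_ge1 j). Qed.

Let VS n : V n.+1 = V n + h *: tamed h (X n).
Proof.
rewrite /V [X n.+1](_ : _ = X n + h *: tamed h (X n) + (w n.+1 - w n))//.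
by apply/rowP => i; rewrite !mxE; ring.
Qed.

Let crude n : enorm (V n) <= enorm x0 + n%:R / alpha.
Proof.
elim: n => [|n IH]; first by rewrite /V w0 subr0 mul0r addr0.
rewrite VS (le_trans (enormD _ _))// -natr1 mulrDl mul1r addrA lerD//.
by rewrite enormZ ger0_norm ?(ltW h_gt0)// tamed_bounded// ltW.
Qed.

(** Since X - w = V, dissipativity between X and w gives <V, f(X)> <= -gamma |V|^2 + |V| |f(w)|, and
    completing the square bounds this by |f(w)|^2 / (4 gamma). *)
Let energy_step n : h * enorm (f (X n)) ^+ 2 <= 1 ->
  enorm (V n.+1) ^+ 2 <= enorm (V n) ^+ 2 +
    h * (C ^+ 2 / (2 * gamma) * g n ^+ (2 * q) + 1).
Proof.
move=> hf; rewrite VS enormD_sqr innerZr enormZ exprMn (ger0_norm (ltW h_gt0)).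
have hf2 : h ^+ 2 * enorm (tamed h (X n)) ^+ 2 <= h.
  rewrite expr2 -mulrA -[leRHS]mulr1 ler_wpM2l ?(ltW h_gt0)//.
  apply: le_trans hf; rewrite ler_wpM2l ?(ltW h_gt0)//.
  by rewrite lerXn2r ?nnegrE ?enorm_ge0// tamed_le// ltW.
set t := (1 + alpha * h * enorm (f (X n)))^-1.
have t0 : 0 <= t by rewrite invr_ge0 (le_trans ler01)// den_ge1// ltW.
have t1 : t <= 1.
  by rewrite invf_le1 ?(lt_le_trans ltr01)// den_ge1// ltW.
have vf : inner (V n) (f (X n)) <= enorm (f (w n)) ^+ 2 / (4 * gamma).
  have -> : f (X n) = (f (X n) - f (w n)) + f (w n) by rewrite subrK.
  rewrite innerDr.
  have := f_diss (w n) (X n); rewrite -/(V n) innerC.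
  have := inner_le (V n) (f (w n)).
  set a := enorm (V n); set b := enorm (f (w n)) => le1 le2.
  have : 0 <= (2 * gamma * a - b) ^+ 2 / (4 * gamma).
    by rewrite divr_ge0 ?sqr_ge0 ?mulr_ge0// ltW.
  rewrite (_ : _ / _ = gamma * a ^+ 2 - a * b + b ^+ 2 / (4 * gamma)); last first.
    by field; rewrite gt_eqF.
  by move=> ?; lra.
have fw : enorm (f (w n)) ^+ 2 <= C ^+ 2 * g n ^+ (2 * q).
  rewrite mulnC exprM -exprMn lerXn2r ?nnegrE ?enorm_ge0//.
  by rewrite mulr_ge0 ?exprn_ge0// (le_trans ler01).
have bd : inner (V n) (tamed h (X n)) <= C ^+ 2 / (4 * gamma) * g n ^+ (2 * q).
  rewrite /tamed -/t innerZr.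
  apply: (@le_trans _ _ (t * (enorm (f (w n)) ^+ 2 / (4 * gamma)))).
    by rewrite ler_wpM2l.
  apply: (@le_trans _ _ (enorm (f (w n)) ^+ 2 / (4 * gamma))).
    by rewrite ler_piMl// divr_ge0 ?sqr_ge0 ?mulr_ge0// ltW.
  by rewrite [leRHS]mulrAC ler_wpM2r// invr_ge0 mulr_ge0// ltW.
have := ler_wpM2l (ltW h_gt0) bd; set z := g n ^+ _.
rewrite (_ : C ^+ 2 / (2 * gamma) * z = 2 * (C ^+ 2 / (4 * gamma) * z)); last first.
  by field; rewrite gt_eqF.
by move=> ?; rewrite -addrA lerD2l; lra.
Qed.

Let E_mono n m : (n <= m)%N -> E n <= E m.
Proof.
move=> /subnK <-; elim: (m - n)%N => [|k IH]; first by rewrite add0n.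
rewrite addSn (le_trans IH)// /E lerD2l ler_wpM2l ?(ltW h_gt0)//.
rewrite big_ord_recr/= lerDl addr_ge0// mulr_ge0 ?exprn_ge0// divr_ge0 ?sqr_ge0//.
by rewrite mulr_ge0// ltW.
Qed.

Let E_ge0 n : 0 <= E n.
Proof.
apply: le_trans (E_mono (leq0n n)); by rewrite /E big_ord0 mulr0 addr0 sqr_ge0.
Qed.

Let W_ge0 n j : 0 <= 1 + E n + g j.
Proof. exact: addr_ge0 (addr_ge0 ler01 (E_ge0 n)) (g_ge0 j). Qed.

(** A bootstrap: while [V] stays below [1 + E N], the scheme stays in the ball where the smallness
    condition is assumed, so the energy step applies once more and keeps [V] within its budget. *)
Let good : (forall j, (j < N)%N -> h * (C * (1 + E N + g j) ^+ q) ^+ 2 <= 1) ->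
  forall n, (n <= N)%N -> enorm (V n) <= 1 + E N.
Proof.
move=> hg.
have sq n : (n <= N)%N -> enorm (V n) ^+ 2 <= E n -> enorm (V n) <= 1 + E N.
  move=> nN le; have := E_mono nN; have := E_ge0 N; have := enorm_ge0 (V n).
  by move: le; nra.
suff S n : (n <= N)%N -> enorm (V n) ^+ 2 <= E n by move=> n nN; exact/(sq n)/S.
elim: n => [_|n IH nN]; first by rewrite /V w0 subr0 /E big_ord0 mulr0 addr0.
have IHn := IH (ltnW nN).
have Vn := sq n (ltnW nN) IHn.
have Xn : enorm (X n) <= E N + g n.
  rewrite -(subrK (w n) (X n)) (le_trans (enormD _ _))//.
  by rewrite /g addrA (addrC (E N)) lerD2r.
have hf : h * enorm (f (X n)) ^+ 2 <= 1.
  apply: le_trans (hg n nN); rewrite ler_wpM2l ?(ltW h_gt0)//.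
  have C0 := le_trans ler01 C_ge1.
  have CW : 0 <= C * (1 + E N + g n) ^+ q.
    by rewrite mulr_ge0// exprn_ge0.
  rewrite lerXn2r ?nnegrE ?enorm_ge0//.
  rewrite (le_trans (f_poly _))// ler_wpM2l// lerXn2r ?nnegrE ?W_ge0//.
    by rewrite addr_ge0 ?enorm_ge0.
  by rewrite -addrA lerD2l.
rewrite (le_trans (energy_step hf))//.
apply: (@le_trans _ _ (E n + h * (C ^+ 2 / (2 * gamma) * g n ^+ (2 * q) + 1))).
  by rewrite lerD2r.
rewrite /E big_ord_recr/=; lra.
Qed.

(** Squaring the failed condition gives [1 <= h * (h * S)]. One factor [h] turns the number of steps
    into the horizon, the other turns [S] into a Riemann sum, so nothing blows up as [h] tends to 0;
    this is the origin of the fourth power. *)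
Let bad j : (j < N)%N -> 1 < h * (C * (1 + E N + g j) ^+ q) ^+ 2 ->
  forall n, (n <= N)%N -> enorm (V n) <= enorm x0 + N%:R * h / alpha *
    (h * \sum_(j < N) (C * (1 + E N + g j) ^+ q) ^+ 4).
Proof.
move=> jN hb n nN; rewrite (le_trans (crude n))// lerD2l.
set S := \sum_(j < N) _.
have Sj : (C * (1 + E N + g j) ^+ q) ^+ 4 <= S.
  rewrite /S (bigD1 (Ordinal jN))//= lerDl; apply: sumr_ge0 => i _.
  by rewrite exprn_even_ge0.
have hS : 1 <= h * (h * S).
  rewrite mulrA -expr2; apply: (@le_trans _ _ ((h * (C * (1 + E N + g j) ^+ q) ^+ 2) ^+ 2)).
    by rewrite exprn_ege1// ltW.
  by rewrite exprMn -exprM ler_wpM2l ?sqr_ge0.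
apply: (@le_trans _ _ (N%:R / alpha)).
  by rewrite ler_wpM2r ?invr_ge0 ?(ltW alpha_gt0)// ler_nat.
rewrite (_ : _ * (h * S) = N%:R / alpha * (h * (h * S))); last by ring.
by rewrite ler_peMr// divr_ge0// ltW.
Qed.

(** The one functional of the path in the moment bound: it dominates 1, the initial norm, the
    horizon and a Riemann sum of powers of the noise. *)
Definition path_size p := 1 + enorm x0 + N%:R * h + h * \sum_(j < N) g j ^+ p.

(** The [3] collects 1, the squared initial norm and the horizon, each at most the square of the
    path size. *)
Definition energy_const := 3 + C ^+ 2 / (2 * gamma).
Definition moment_const :=
  energy_const + 1 + (C * (2 * energy_const) ^+ q) ^+ 4 / alpha.

(* If [h |f|^2 <= 1] along the path shifted by its noise, an energy estimate
   applies; otherwise [1 / h] is bounded by the noise, and so is the total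
   displacement, each step moving by at most [1 / alpha]. *)
Lemma tamed_path_bound n : (n <= N)%N ->
  enorm (X n - w n) <= moment_const * path_size (4 * q) ^+ (8 * q + 2).
Proof.
move=> nN; set H := path_size _; set c := energy_const.
have cg0 : 0 <= C ^+ 2 / (2 * gamma) by rewrite divr_ge0 ?sqr_ge0 ?mulr_ge0// ltW.
have C0 : 0 <= C by exact: le_trans ler01 _.
have S0 p : 0 <= h * \sum_(j < N) g j ^+ p.
  by rewrite mulr_ge0 ?(ltW h_gt0)// sumr_ge0// => i _; rewrite exprn_ge0.
have T0 : 0 <= N%:R * h by rewrite mulr_ge0 ?(ltW h_gt0).
have x00 := enorm_ge0 x0.
have H1 : 1 <= H by rewrite /H /path_size -!addrA lerDl !addr_ge0 ?S0.
have H0 : 0 <= H := le_trans ler01 H1.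
have EH : 1 + E N <= c * H ^+ 2.
  have s1 : h * \sum_(j < N) (C ^+ 2 / (2 * gamma) * g j ^+ (2 * q) + 1) <=
      C ^+ 2 / (2 * gamma) * H + H.
    rewrite big_split/= -mulr_sumr mulrDr mulrCA lerD//.
      rewrite ler_wpM2l// /H /path_size -[leLHS]add0r lerD ?addr_ge0//.
      rewrite ler_wpM2l ?(ltW h_gt0)//; apply: ler_sum => i _.
      by rewrite ler_weXn2l// leq_mul2r orbT.
    rewrite sumr_const card_ord -[h * _]mulrC.
    by rewrite /H /path_size -addrA; have := S0 (4 * q)%N; lra.
  have xH : enorm x0 <= H.
    by rewrite /H /path_size; have := S0 (4 * q)%N; lra.
  have HH : H <= H ^+ 2 by rewrite expr2 ler_peMr.
  have xH2 : enorm x0 ^+ 2 <= H ^+ 2 by rewrite lerXn2r ?nnegrE.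
  have : C ^+ 2 / (2 * gamma) * H <= C ^+ 2 / (2 * gamma) * H ^+ 2.
    by rewrite ler_wpM2l.
  by rewrite /E /c /energy_const; lra.
have c1 : 1 <= c by rewrite /c /energy_const; lra.
have c0 : 0 <= c := le_trans ler01 c1.
have mc0 : 0 <= (C * (2 * c) ^+ q) ^+ 4 / alpha.
  by rewrite divr_ge0 ?(ltW alpha_gt0)// exprn_even_ge0.
have Hk : H ^+ 2 <= H ^+ (8 * q + 2) by rewrite ler_weXn2l// leq_addl.
have [/existsP[j]|] := boolP [exists j : 'I_N, 1 < h * (C * (1 + E N + g j) ^+ q) ^+ 2].
  move=> jb; rewrite (le_trans (bad (ltn_ord j) jb nN))//.
  have le4 : h * \sum_(j < N) (C * (1 + E N + g j) ^+ q) ^+ 4 <=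
      (C * (2 * c * H ^+ 2) ^+ q) ^+ 4 * H.
    apply: (@le_trans _ _ (h * \sum_(j < N) (C * (2 * c * H ^+ 2) ^+ q) ^+ 4 * g j ^+ (4 * q))).
      rewrite ler_wpM2l ?(ltW h_gt0)//; apply: ler_sum => i _.
      rewrite [g i ^+ (4 * q)](_ : _ = (g i ^+ q) ^+ 4); last by rewrite mulnC exprM.
      rewrite [leRHS](_ : _ = (C * (2 * c * H ^+ 2 * g i) ^+ q) ^+ 4); last first.
        by rewrite !exprMn; ring.
      have B0 : 0 <= 2 * c * H ^+ 2 * g i by rewrite !mulr_ge0 ?sqr_ge0.
      have := W_ge0 N i => W0.
      rewrite lerXn2r ?nnegrE//; [|by rewrite mulr_ge0 ?exprn_ge0..|].
        by rewrite mulr_ge0 ?exprn_ge0.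
      rewrite ler_wpM2l// lerXn2r ?nnegrE//.
      (* For A, B >= 1 one has A + B <= 2 A B, so the noise at index [i] separates as a factor. *)
      have H21 : 1 <= c * H ^+ 2 by apply: le_trans EH; rewrite lerDl.
      have gi := g_ge1 i; have : 0 <= (c * H ^+ 2 - 1) * (g i - 1).
        by rewrite mulr_ge0 ?subr_ge0.
      rewrite (_ : 2 * c * H ^+ 2 * g i = 2 * (c * H ^+ 2 * g i)); last by ring.
      by move: EH H21 gi; set A := c * H ^+ 2; set B := g i; set D := E N; nra.
    rewrite -mulr_sumr mulrCA ler_wpM2l ?exprn_even_ge0//.
    by rewrite /H /path_size lerDr !addr_ge0.
  have TH : N%:R * h <= H.
    by rewrite /H /path_size; have := S0 (4 * q)%N; lra.
  have xH : enorm x0 <= H ^+ (8 * q + 2).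
    apply: le_trans Hk; apply: (@le_trans _ _ H); last by rewrite expr2 ler_peMr.
    by rewrite /H /path_size; have := S0 (4 * q)%N; lra.
  (* Origin of the exponent: [H ^+ 2] to the power [4 * q], one [H] for the horizon and one for the
     Riemann sum. *)
  have main : N%:R * h / alpha * (h * \sum_(j < N) (C * (1 + E N + g j) ^+ q) ^+ 4)
      <= (C * (2 * c) ^+ q) ^+ 4 / alpha * H ^+ (8 * q + 2).
    apply: (@le_trans _ _ (H / alpha * ((C * (2 * c * H ^+ 2) ^+ q) ^+ 4 * H))).
      apply: ler_pM => //.
      - by rewrite divr_ge0// ltW.
      - by rewrite mulr_ge0 ?(ltW h_gt0)// sumr_ge0// => i _; rewrite exprn_even_ge0.
      - by rewrite ler_wpM2r// invr_ge0 ltW.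
    rewrite le_eqVlt; apply/orP; left; apply/eqP.
    rewrite exprD [(8 * q)%N](_ : _ = (2 * q * 4)%N); last by rewrite mulnAC.
    by rewrite !exprM !exprMn; ring.
  have : enorm x0 <= (c + 1) * H ^+ (8 * q + 2).
    by rewrite (le_trans xH)// ler_peMl ?exprn_ge0// lerDr.
  by rewrite /moment_const -/c => ?; rewrite mulrDl lerD.
rewrite negb_exists => /forallP nb.
have hg j : (j < N)%N -> h * (C * (1 + E N + g j) ^+ q) ^+ 2 <= 1.
  by move=> jN; have := nb (Ordinal jN); rewrite -leNgt.
rewrite (le_trans (good hg nN))// (le_trans EH)//.
rewrite ler_pM ?sqr_ge0//.
by rewrite /moment_const -/c; lra.
Qed.

End moment.
End tamed_scheme.

(** * One coarse step against a block of fine steps *)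

Section block_error.
Variables (R : realType) (d : nat) (f : 'rV[R]_d -> 'rV[R]_d) (alpha gamma C : R)
  (q : nat).
Hypotheses (alpha_gt0 : 0 < alpha) (gamma_gt0 : 0 < gamma) (C_ge1 : 1 <= C).
Hypothesis f_diff : forall x, differentiable f x.
Hypothesis f_diss : forall x1 x2 : 'rV[R]_d,
  inner (f x2 - f x1) (x2 - x1) <= - gamma * enorm (x2 - x1) ^+ 2.
Hypothesis f_growth : drift_growth C q f.

Variables (dt dt0 : R) (M : nat) (y dw : nat -> 'rV[R]_d) (x : 'rV[R]_d)
  (G : nat -> R).
Hypotheses (dt_gt0 : 0 < dt) (dt_le : dt <= dt0).
Let m := M.+1.
Let h := dt / m%:R.
Hypothesis yE : forall j, y j = y 0 + h *: \sum_(i < j) tamed f alpha h (y i) + dw j.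
Hypotheses (x_le : enorm x <= G 0) (G_min : forall j, G 0 <= G j)
  (y_le : forall j, (j < m)%N -> enorm (y j) <= G j).

(** One weight for the growth, Lipschitz, Taylor and derivative bounds of [f]; the factor 2 is there
    because the two-point bounds involve the norms of both points. *)
Let gam j := C * (1 + 2 * G j) ^+ q.
Let Sw := h *: \sum_(j < m) dw j.
(** Squared noise increments over a block are of order [dt]; dividing by [dt] leaves a quantity of
    order one. *)
Let u j := enorm (dw j) ^+ 2 / dt.
Let th j := gam j ^+ 3 * (1 + u j).
Let Th := m%:R^-1 * \sum_(j < m) th j.
Let a := m%:R^-1 * \sum_(j < m) gam j.
Let e := y 0 - x.
(** The new error splits as [D + noise + remainder]. [D] is an explicit Euler step of the error with
    the drift frozen at the start of the block, [noise] is linear in the increments with a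
    coefficient known at that start, and the remainder is of order dt^2. *)
Let D := e + dt *: (f (y 0) - f x).
Let noise := D1 f (y 0) Sw.
Let e' := y m - (x + dt *: tamed f alpha dt x + dw m).

Let m0 : 0 < m%:R :> R. Proof. by rewrite ltr0n. Qed.
Let h0 : 0 < h. Proof. exact: divr_gt0. Qed.
Let hm : h * m%:R = dt. Proof. by rewrite /h divfK// gt_eqF. Qed.
Let h_le : h <= dt.
Proof. by rewrite ler_pdivrMr// ler_peMr ?(ltW dt_gt0)// ler1n. Qed.
Let C0 : 0 <= C. Proof. exact: le_trans ler01 _. Qed.
Let G0 : 0 <= G 0. Proof. exact: le_trans (enorm_ge0 _) x_le. Qed.
Let Gge0 j : 0 <= G j. Proof. exact: le_trans G0 (G_min j). Qed.
Let gam1 j : 1 <= gam j.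
Proof.
rewrite -[1]mulr1 /gam ler_pM// exprn_ege1// lerDl mulr_ge0//; exact: Gge0.
Qed.
Let gam0 j : 0 <= gam j. Proof. exact: le_trans ler01 (gam1 j). Qed.
Let gam_min j : gam 0 <= gam j.
Proof.
rewrite /gam ler_wpM2l//; have := G_min j; have := G0; have := Gge0 j => g0 g1 g2.
by rewrite lerXn2r ?nnegrE; lra.
Qed.
Let u0 j : 0 <= u j. Proof. by rewrite divr_ge0 ?sqr_ge0// ltW. Qed.
Let g3 j : gam j <= gam j ^+ 3.
Proof. by rewrite -[leLHS]expr1 ler_weXn2l. Qed.
Let g23 j : gam j ^+ 2 <= gam j ^+ 3.
Proof. by rewrite ler_weXn2l. Qed.
Let g30 j : 0 <= gam j ^+ 3. Proof. by rewrite exprn_ge0. Qed.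
Let th_ge3 j : gam j ^+ 3 <= th j.
Proof. by rewrite /th ler_peMr// lerDl. Qed.
Let th_ge1 j : gam j <= th j. Proof. exact: le_trans (th_ge3 j). Qed.
Let th_u j : gam j * u j <= th j.
Proof.
rewrite /th mulrDr mulr1; have := ler_wpM2r (u0 j) (g3 j).
by have := g30 j; lra.
Qed.
Let th0 j : 0 <= th j. Proof. exact: le_trans (gam0 j) (th_ge1 j). Qed.
Let avg_le (F K : nat -> R) : (forall j, F j <= K j) ->
  m%:R^-1 * \sum_(j < m) F j <= m%:R^-1 * \sum_(j < m) K j.
Proof. by move=> FK; rewrite ler_wpM2l ?invr_ge0// ler_sum. Qed.
Let avg_cst (c : R) : m%:R^-1 * \sum_(j < m) c = c.
Proof. by rewrite sumr_const card_ord -[c *+ _]mulr_natl mulrA mulVf ?mul1r// gt_eqF. Qed.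
Let aTh : a <= Th. Proof. exact: avg_le. Qed.
Let gTh : gam 0 <= Th.
Proof.
rewrite -[leLHS]avg_cst; apply: (@avg_le (fun=> gam 0) th) => j.
exact: le_trans (gam_min j) (th_ge1 j).
Qed.
Let Th1 : 1 <= Th. Proof. exact: le_trans (gam1 0) gTh. Qed.
Let Th0 : 0 <= Th. Proof. exact: le_trans ler01 Th1. Qed.
Let a0 : 0 <= a.
Proof. by rewrite -[leLHS](avg_cst 0); apply: (@avg_le (fun=> 0) gam). Qed.
Let ga : h * \sum_(j < m) gam j = dt * a.
Proof. by rewrite /a /h mulrA. Qed.
Let gth : h * \sum_(j < m) th j = dt * Th.
Proof. by rewrite /Th /h mulrA. Qed.

Let fy z j : enorm z <= G j -> enorm (f z) <= gam j.
Proof.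
move=> zG; have [b _ _ _] := f_growth; rewrite (le_trans (b z))// ler_wpM2l//.
by have := enorm_ge0 z => z0; rewrite lerXn2r ?nnegrE; lra.
Qed.

Let flip z z' j : enorm z <= G j -> enorm z' <= G j ->
  enorm (f z' - f z) <= gam j * enorm (z' - z).
Proof.
move=> zG zG'; have [_ b _ _] := f_growth; rewrite (le_trans (b z z'))//.
rewrite ler_wpM2r ?enorm_ge0// ler_wpM2l//.
by have := enorm_ge0 z => z0; have := enorm_ge0 z' => z0'; rewrite lerXn2r ?nnegrE; lra.
Qed.

Let ftay z z' j : enorm z <= G j -> enorm z' <= G j ->
  enorm (f z' - f z - D1 f z (z' - z)) <= gam j * enorm (z' - z) ^+ 2.
Proof.
move=> zG zG'; have [_ _ b _] := f_growth; rewrite (le_trans (b z z'))//.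
rewrite ler_wpM2r ?sqr_ge0// ler_wpM2l//.
by have := enorm_ge0 z => z0; have := enorm_ge0 z' => z0'; rewrite lerXn2r ?nnegrE; lra.
Qed.

Let fD z v j : enorm z <= G j -> enorm (D1 f z v) <= gam j * enorm v.
Proof.
move=> zG; have [_ _ _ b] := f_growth; rewrite (le_trans (b z v))//.
rewrite ler_wpM2r ?enorm_ge0// ler_wpM2l//.
by have := enorm_ge0 z => z0; rewrite lerXn2r ?nnegrE; lra.
Qed.

Let ft z j : enorm z <= G j -> enorm (tamed f alpha h z) <= gam j.
Proof. by move=> zG; rewrite (le_trans (tamed_le f alpha_gt0 z (ltW h0)))// fy. Qed.

Let ferr k z j : 0 <= k -> enorm z <= G j ->
  enorm (tamed f alpha k z - f z) <= alpha * k * gam j ^+ 2.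
Proof.
move=> k0 zG; rewrite (le_trans (tamed_err f alpha_gt0 z k0))//.
rewrite ler_wpM2l ?mulr_ge0 ?(ltW alpha_gt0)//.
by rewrite lerXn2r ?nnegrE ?enorm_ge0// fy.
Qed.

Let y0G : enorm (y 0) <= G 0. Proof. exact: y_le. Qed.

Let drift_part j : (j <= m)%N ->
  enorm (h *: \sum_(i < j) tamed f alpha h (y i)) <= dt * a.
Proof.
move=> jm; rewrite enormZ gtr0_norm// -ga ler_wpM2l ?(ltW h0)//.
rewrite (le_trans (enorm_sum _ _ _))//.
apply: (@le_trans _ _ (\sum_(i < j) gam i)).
  by apply: ler_sum => i _; apply: ft; apply: y_le; rewrite (leq_trans (ltn_ord i)).
rewrite -(subnKC jm) big_split_ord/= lerDl.
by apply: sumr_ge0 => i _; exact: gam0.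
Qed.

Let yB j : y j - y 0 = h *: \sum_(i < j) tamed f alpha h (y i) + dw j.
Proof. by apply/eqP; rewrite subr_eq addrC addrA -yE. Qed.

Let incr_sq j : (j <= m)%N ->
  enorm (y j - y 0) ^+ 2 <= 2 * (dt * a) ^+ 2 + 2 * enorm (dw j) ^+ 2.
Proof.
move=> jm; rewrite yB.
set v := h *: _.
have := enormD v (dw j); have := drift_part jm; rewrite -/v.
have := enorm_ge0 v; have := enorm_ge0 (dw j); have := enorm_ge0 (v + dw j).
move: (enorm v) (enorm (dw j)) (enorm (v + dw j)) (dt * a) => v1 b c k.
move=> c0 b0 v0 ak cab.
have : c ^+ 2 <= (v1 + b) ^+ 2 by rewrite lerXn2r ?nnegrE ?addr_ge0.
have : v1 ^+ 2 <= k ^+ 2 by rewrite lerXn2r ?nnegrE// (le_trans v0).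
by have := sqr_ge0 (v1 - b); nra.
Qed.

(** Defect of one fine drift evaluation once [f (y 0)] and the term linear in the noise are removed:
    taming, Taylor remainder, and the derivative along the displacement due to drift. Each is of
    order [dt]. *)
Let r j := (tamed f alpha h (y j) - f (y j)) +
  (f (y j) - f (y 0) - D1 f (y 0) (y j - y 0)) + D1 f (y 0) (y j - y 0 - dw j).

Let dt00 : 0 <= dt0. Proof. exact: le_trans (ltW dt_gt0) dt_le. Qed.

Let r_le j : (j < m)%N ->
  enorm (r j) <= dt * (alpha + 2 + 2 * dt0 * Th ^+ 2 + Th) * th j.
Proof.
move=> jm; have jm' := ltnW jm; have yj := y_le jm.
have y0j := le_trans y0G (G_min j).
have e1 : enorm (tamed f alpha h (y j) - f (y j)) <= dt * alpha * th j.
  rewrite (le_trans (ferr (ltW h0) yj))// (mulrC alpha) ler_pM//.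
  - exact: mulr_ge0 (ltW h0) (ltW alpha_gt0).
  - exact: sqr_ge0.
  - by rewrite ler_wpM2r// ltW.
  - exact: le_trans (g23 j) (th_ge3 j).
have e2 : enorm (f (y j) - f (y 0) - D1 f (y 0) (y j - y 0)) <=
    dt * (2 + 2 * dt0 * Th ^+ 2) * th j.
  rewrite (le_trans (ftay y0j yj))//.
  rewrite (le_trans (ler_wpM2l (gam0 j) (incr_sq jm')))//.
  have -> : enorm (dw j) ^+ 2 = dt * u j.
    by rewrite /u mulrCA divff ?mulr1// gt_eqF.
  have s1 : a ^+ 2 <= Th ^+ 2 by rewrite lerXn2r ?nnegrE.
  have s2 : gam j * (dt * a) ^+ 2 <= dt * (dt0 * Th ^+ 2) * th j.
    have dd : dt ^+ 2 * a ^+ 2 <= dt * (dt0 * Th ^+ 2).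
      rewrite expr2 -mulrA ler_wpM2l ?(ltW dt_gt0)// ler_pM ?sqr_ge0//.
      exact: ltW.
    rewrite exprMn mulrC ler_pM//.
    exact: mulr_ge0 (sqr_ge0 dt) (sqr_ge0 a).
  have s3 := ler_wpM2l (ltW dt_gt0) (th_u j).
  by move: s2 s3; lra.
have e3 : enorm (D1 f (y 0) (y j - y 0 - dw j)) <= dt * Th * th j.
  rewrite (le_trans (fD _ y0j))// yB addrK mulrC ler_pM ?enorm_ge0//.
  by rewrite (le_trans (drift_part jm'))// ler_wpM2l// ltW.
apply: le_trans (enormD _ _) _.
by have := enormD (tamed f alpha h (y j) - f (y j))
  (f (y j) - f (y 0) - D1 f (y 0) (y j - y 0)); move: e1 e2 e3; lra.
Qed.

Let remainder := e' - D - noise.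

Let remainderE : remainder = h *: \sum_(j < m) r j - dt *: (tamed f alpha dt x - f x).
Proof.
have abel (a1 b c v1 v z y0 x1 : 'rV[R]_d) : y0 + a1 + z - (x1 + v1 + z) -
    (y0 - x1 + (b - v)) - c = a1 - b - c - (v1 - v).
  by apply/rowP => i; rewrite !mxE; ring.
have nE : noise = h *: \sum_(j < m) D1 f (y 0) (dw j).
  by rewrite /noise /Sw D1_scale// D1_sum.
have cE : dt *: f (y 0) = h *: \sum_(j < m) f (y 0).
  by rewrite sumr_const card_ord -scaler_nat scalerA hm.
have rE : \sum_(j < m) r j = \sum_(j < m) tamed f alpha h (y j) - \sum_(j < m) f (y 0) -
    \sum_(j < m) D1 f (y 0) (dw j).
  rewrite -!sumrB; apply: eq_bigr => j _; rewrite /r.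
  rewrite [D1 f (y 0) (y j - y 0 - dw j)]D1D//.
  rewrite -[- dw j]scaleN1r D1_scale// scaleN1r.
  move: (tamed _ _ _ _) (f (y j)) (f (y 0)) (D1 _ _ _) (D1 _ _ _) => a1 b c v1 v.
  by apply/rowP => i; rewrite !mxE; ring.
rewrite /remainder /e' /D /e nE rE (yE m) !scalerBr cE.
exact: abel.
Qed.

(** [2 * alpha] comes from taming the fine and the coarse step, [3] from the squared noise
    increments (2) and the linearised drift displacement (1), and [2 * dt0] from the squared drift
    displacement. *)
Let rem_const := 2 * alpha + 3 + 2 * dt0.

Let remainder_le : enorm remainder <= dt ^+ 2 * (rem_const * Th ^+ 3).
Proof.
rewrite remainderE (le_trans (enormB _ _))// !enormZ !gtr0_norm//.
set k := alpha + 2 + 2 * dt0 * Th ^+ 2 + Th.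
have s1 : h * enorm (\sum_(j < m) r j) <= dt ^+ 2 * (k * Th).
  apply: (@le_trans _ _ (h * \sum_(j < m) (dt * k * th j))).
    rewrite ler_wpM2l ?(ltW h0)// (le_trans (enorm_sum _ _ _))//.
    by apply: ler_sum => j _; exact: r_le.
  by rewrite -mulr_sumr mulrCA gth le_eqVlt; apply/orP; left; apply/eqP; ring.
have s2 : dt * enorm (tamed f alpha dt x - f x) <= dt ^+ 2 * (alpha * Th ^+ 2).
  rewrite expr2 -mulrA ler_wpM2l ?(ltW dt_gt0)//.
  rewrite (le_trans (ferr (ltW dt_gt0) x_le))// mulrA (mulrC dt) ler_wpM2l//.
    exact: mulr_ge0 (ltW alpha_gt0) (ltW dt_gt0).
  by rewrite lerXn2r ?nnegrE.
apply: le_trans (lerD s1 s2) _; rewrite -mulrDr ler_wpM2l ?sqr_ge0//.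
have T23 : Th ^+ 2 <= Th ^+ 3 by rewrite ler_weXn2l.
have T13 : Th <= Th ^+ 3 by rewrite -[leLHS]expr1 ler_weXn2l.
have al0 := ltW alpha_gt0.
have A1 := ler_wpM2l al0 T23; have A2 := ler_wpM2l al0 T13.
by rewrite /k /rem_const; move: (exprn_ge0 3 Th0); nra.
Qed.

(** [Sw] is a Riemann sum over a length [dt] of increments of size dt^(1/2), so its square is of
    order dt^3. Only the cross term with [D], too large in absolute value, requires cancellation in
    the mean. *)
Let noise_le : enorm noise ^+ 2 <= dt ^+ 3 * Th ^+ 3.
Proof.
apply: (@le_trans _ _ ((gam 0 * enorm Sw) ^+ 2)).
  have fn := fD Sw y0G.
  by rewrite lerXn2r ?nnegrE ?(mulr_ge0 (gam0 0) (enorm_ge0 _)) ?enorm_ge0.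
rewrite exprMn [leRHS](_ : _ = Th ^+ 2 * (dt ^+ 3 * Th)); last by ring.
rewrite ler_pM ?sqr_ge0//; first by rewrite lerXn2r ?nnegrE.
apply: (@le_trans _ _ ((h * \sum_(j < m) enorm (dw j)) ^+ 2)).
  have S0 : 0 <= \sum_(j < m) enorm (dw j).
    by apply: sumr_ge0 => i _; exact: enorm_ge0.
  have hS0 := mulr_ge0 (ltW h0) S0.
  rewrite lerXn2r ?nnegrE ?enorm_ge0// /Sw enormZ gtr0_norm//.
  by rewrite ler_wpM2l ?(ltW h0)// enorm_sum.
rewrite (le_trans (@power_mean_le _ m h (fun j => enorm (dw j)) 1 (ltW h0) _))//.
  by move=> i; exact: enorm_ge0.
rewrite expr1 (mulrC m%:R) hm.
apply: (@le_trans _ _ (dt ^+ 3 * (m%:R^-1 * \sum_(j < m) u j))).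
  rewrite /u -mulr_suml /h le_eqVlt; apply/orP; left; apply/eqP.
  by field; rewrite !gt_eqF// mulr_gt0.
rewrite ler_wpM2l ?exprn_ge0 ?(ltW dt_gt0)//; apply: (@avg_le u th) => j.
by apply: le_trans (th_u j); rewrite ler_peMl.
Qed.

(** Dissipativity removes the term of first order in [dt]. In the second-order term one factor is
    estimated by growth and the other by the Lipschitz bound, so that the random weight multiplies
    the error and not its square. *)
Let D_sq : enorm D ^+ 2 <= enorm e ^+ 2 + dt ^+ 2 * (2 * Th ^+ 2 * enorm e).
Proof.
rewrite /D enormD_sqr innerZr enormZ exprMn gtr0_norm//.
have d1 : inner e (f (y 0) - f x) <= 0.
  rewrite innerC (le_trans (f_diss _ _))// mulNr oppr_le0 mulr_ge0 ?sqr_ge0//.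
  exact: ltW.
have d2 : enorm (f (y 0) - f x) ^+ 2 <= 2 * Th ^+ 2 * enorm e.
  have l1 : enorm (f (y 0) - f x) <= Th * enorm e.
    by rewrite (le_trans (flip x_le y0G))// ler_wpM2r ?enorm_ge0.
  have l2 : enorm (f (y 0) - f x) <= 2 * Th.
    rewrite (le_trans (enormB _ _))//; have := fy y0G; have := fy x_le.
    by move: gTh; lra.
  rewrite [leRHS](_ : _ = (2 * Th) * (Th * enorm e)); last by ring.
  by rewrite expr2 ler_pM// enorm_ge0.
have := ler_wpM2l (sqr_ge0 dt) d2.
have : dt * inner e (f (y 0) - f x) <= 0 by rewrite mulr_ge0_le0// ltW.
by lra.
Qed.

Let D_le : enorm D <= (1 + dt0) * Th * enorm e.
Proof.
rewrite /D (le_trans (enormD _ _))// 2!mulrDl enormZ gtr0_norm//.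
have l1 : enorm (f (y 0) - f x) <= Th * enorm e.
  by rewrite (le_trans (flip x_le y0G))// ler_wpM2r ?enorm_ge0.
rewrite mul1r lerD//; first by rewrite ler_peMl ?enorm_ge0.
by rewrite -mulrA ler_pM ?enorm_ge0// ltW.
Qed.

(** The three terms come from the squares of drift difference and noise, from the cross term of [D]
    with the remainder, and from the square of the remainder. *)
Definition block_const :=
  2 + 2 * (1 + dt0) * (2 * alpha + 3 + 2 * dt0) + 2 * (2 * alpha + 3 + 2 * dt0) ^+ 2 * dt0.

(* [Th] is an average over the block, not a supremum: averages have moments
   bounded uniformly in the number [m] of fine steps. *)
Lemma block_error :
  enorm e' ^+ 2 <= enorm e ^+ 2
    + dt ^+ 2 * (block_const * Th ^+ 6 * enorm e)
    + 2 * inner D noise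
    + dt ^+ 3 * (block_const * Th ^+ 6).
Proof.
have -> : e' = D + (noise + remainder).
  by rewrite /remainder; move: D noise e' => v1 v2 v3; apply/rowP => i; rewrite !mxE; ring.
rewrite enormD_sqr innerDr.
set c := rem_const.
have c0 : 0 <= c by have := ltW alpha_gt0; have := dt00; rewrite /c /rem_const; lra.
have e0 := enorm_ge0 e; have rho := remainder_le; rewrite -/c in rho.
have T30 := exprn_ge0 3 Th0; have T60 := exprn_ge0 6 Th0.
have cT0 := mulr_ge0 c0 T30.
have d2 := sqr_ge0 dt; have d3 : 0 <= dt ^+ 3 by rewrite exprn_ge0// ltW.
have i1 : inner D remainder <= (1 + dt0) * Th * enorm e * (dt ^+ 2 * (c * Th ^+ 3)).
  by rewrite (le_trans (inner_le _ _))// ler_pM ?enorm_ge0.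
have i2 : enorm (noise + remainder) ^+ 2 <= 2 * (dt ^+ 3 * Th ^+ 3) +
    2 * (dt ^+ 2 * (c * Th ^+ 3)) ^+ 2.
  have r2 : enorm remainder ^+ 2 <= (dt ^+ 2 * (c * Th ^+ 3)) ^+ 2.
    by rewrite lerXn2r ?nnegrE ?enorm_ge0// mulr_ge0.
  rewrite enormD_sqr; have := noise_le; have := inner_le noise remainder.
  have := sqr_ge0 (enorm noise - enorm remainder); lra.
have T26 : Th ^+ 2 <= Th ^+ 6 by rewrite ler_weXn2l.
have T46 : Th ^+ 4 <= Th ^+ 6 by rewrite ler_weXn2l.
have T36 : Th ^+ 3 <= Th ^+ 6 by rewrite ler_weXn2l.
have cc : 0 <= 2 * (1 + dt0) * c by rewrite mulr_ge0// mulr_ge0// addr_ge0.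
have cc2 : 0 <= 2 * c ^+ 2 * dt0 by rewrite mulr_ge0// mulr_ge0// sqr_ge0.
have bE : block_const = 2 + 2 * (1 + dt0) * c + 2 * c ^+ 2 * dt0 by [].
have b1 : 2 * Th ^+ 2 * enorm e + 2 * ((1 + dt0) * Th * enorm e * (c * Th ^+ 3))
    <= block_const * Th ^+ 6 * enorm e.
  rewrite [leLHS](_ : _ = (2 * Th ^+ 2 + 2 * (1 + dt0) * c * Th ^+ 4) * enorm e); last by ring.
  rewrite ler_wpM2r// bE; have := ler_wpM2l cc T46; have := mulr_ge0 cc2 T60.
  by move: T26; lra.
have b2 : 2 * (dt ^+ 3 * Th ^+ 3) + 2 * (dt ^+ 2 * (c * Th ^+ 3)) ^+ 2
    <= dt ^+ 3 * (block_const * Th ^+ 6).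
  rewrite [leLHS](_ : _ = dt ^+ 3 * (2 * Th ^+ 3 + 2 * c ^+ 2 * Th ^+ 6 * dt)); last by ring.
  rewrite ler_wpM2l// bE.
  have := ler_wpM2l (mulr_ge0 (mulr_ge0 (ler0n R 2) (sqr_ge0 c)) T60) dt_le.
  by have := mulr_ge0 cc T60; move: T36; lra.
have b1' := ler_wpM2l d2 b1.
by have := D_sq; move: i1 i2 b1' b2; lra.
Qed.

End block_error.

(** * Convergence to the solution and contraction, path by path *)

(** Heine's theorem through the near-covering form of compactness, with the modulus [del] as the
    parameter tending to 0 from the right. *)
Lemma unif_continuous_segment (R : realType) (V : normedModType R) (g : R -> V)
    (a b : R) : {within `[a, b], continuous g} ->
  forall eps : R, 0 < eps -> exists2 del : R, 0 < del &
    forall s t, s \in `[a, b] -> t \in `[a, b] -> `|t - s| < del ->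
      `|g t - g s| <= eps.
Proof.
move=> /subspace_continuousP cg eps eps0.
have /compact_near_coveringP cov : compact `[a, b]%classic by exact: segment_compact.
pose P (del : R) (s : R) := forall t, t \in `[a, b] ->
  `|t - s| < del -> s \in `[a, b] -> `|g t - g s| <= eps.
have : \forall del \near 0^'+, `[a, b]%classic `<=` P del.
  apply: cov => x xab.
  have /cvgrPdist_lt/(_ (eps / 2)) := cg x xab.
  rewrite divr_gt0// => /(_ isT); rewrite near_withinE => /nbhs_ballP[eta /= eta0 He].
  exists (ball x (eta / 2), [set del : R | del < eta / 2]).
    split => /=; first by apply: nbhsx_ballx; rewrite divr_gt0.
    by apply: nbhs_right_lt; rewrite divr_gt0.
  move=> [s del] /= [xs deleta] t tab ts sab.
  have xs2 : `|x - s| < eta / 2 by exact: xs.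
  have bs : ball x eta s by rewrite /ball/=; lra.
  have bt : ball x eta t.
    rewrite /ball/= (_ : x - t = (x - s) - (t - s)); last by ring.
    by rewrite (le_lt_trans (ler_normB _ _))//; lra.
  have := He s bs sab; have := He t bt tab => h1 h2.
  rewrite (_ : g t - g s = (g x - g s) - (g x - g t)); last first.
    by rewrite opprB [RHS]addrC addrA subrK.
  by rewrite (le_trans (ler_normB _ _))//; lra.
move=> H.
have [del [del0 Hd]] : exists del : R, 0 < del /\ `[a, b]%classic `<=` P del.
  near (0 : R)^'+ => del; exists del; split; near: del.
    exact: nbhs_right_gt.
  exact: H.
by exists del => // s t sab tab ts; apply: Hd.
Unshelve. all: by end_near. Qed.

Lemma within_continuous_comp (S T U : topologicalType) (A : set S) (g : S -> T)
    (k : T -> U) : {within A, continuous g} -> continuous k ->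
  {within A, continuous (k \o g)}.
Proof.
move=> /subspace_continuousP cg ck; apply/subspace_continuousP => x Ax.
exact: cvg_comp (cg x Ax) (ck _).
Qed.

Lemma coord_le_mx_norm (R : realType) d (u : 'rV[R]_d) i : `|u 0 i| <= `|u|.
Proof.
rewrite [leRHS]mx_normrE.
exact: (le_bigmax _ (fun ij => `|u ij.1 ij.2|) (0, i)).
Qed.

(** * Contraction of perturbed Euler recursions *)

Section discrete_stability.
Variables (R : realType) (d : nat).

(** One explicit step multiplies the squared norm by at most 1 - 2 gamma h + L^2 h^2 <= exp(2k). The
    excess over the exact contraction accumulates to exp(L^2 T h / 2), which tends to 1 with [h];
    hence a local Lipschitz constant of any size is harmless in the limit. *)
Lemma perturbed_contraction (gamma L h eps : R) (e del eta : nat -> 'rV[R]_d) n :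
  0 <= h -> 0 <= eps ->
  (forall j, (j < n)%N -> e j.+1 = e j + h *: del j + h *: eta j) ->
  (forall j, (j < n)%N -> inner (e j) (del j) <= - gamma * enorm (e j) ^+ 2) ->
  (forall j, (j < n)%N -> enorm (del j) <= L * enorm (e j)) ->
  (forall j, (j < n)%N -> enorm (eta j) <= eps) -> 0 <= gamma ->
  enorm (e n) <= expR (- gamma * (n%:R * h) + L ^+ 2 * (n%:R * h) * h / 2) * enorm (e 0)
    + n%:R * h * eps * expR (L ^+ 2 * (n%:R * h) * h / 2).
Proof.
move=> h0 eps0 eS diss lip err g0.
pose k := - gamma * h + L ^+ 2 * h ^+ 2 / 2; pose b := L ^+ 2 * h ^+ 2 / 2.
have b0 : 0 <= b by rewrite divr_ge0// mulr_ge0 ?sqr_ge0.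
have step j : (j < n)%N -> enorm (e j.+1) <= expR k * enorm (e j) + h * eps.
  move=> jn; rewrite eS// (le_trans (enormD _ _))// lerD//; last first.
    by rewrite enormZ ger0_norm// ler_wpM2l// err.
  have : enorm (e j + h *: del j) ^+ 2 <= (expR k * enorm (e j)) ^+ 2.
    rewrite enormD_sqr innerZr enormZ exprMn ger0_norm// exprMn -expRM_natl.
    have l2 : enorm (del j) ^+ 2 <= L ^+ 2 * enorm (e j) ^+ 2.
      by rewrite -exprMn lerXn2r ?nnegrE ?enorm_ge0// ?lip// (le_trans _ (lip _ jn))// enorm_ge0.
    have d1 := ler_wpM2l h0 (diss _ jn); have d2 := ler_wpM2l (sqr_ge0 h) l2.
    have ek := expR_ge1Dx (2%:R * k); have en := sqr_ge0 (enorm (e j)).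
    have := ler_wpM2r en ek.
    rewrite /k; move: d1 d2; lra.
  by rewrite ler_pXn2r// ?nnegrE ?enorm_ge0// mulr_ge0 ?expR_ge0 ?enorm_ge0.
have main j : (j <= n)%N -> enorm (e j) <= expR (j%:R * k) * enorm (e 0)
    + j%:R * (h * eps * expR (j%:R * b)).
  elim: j => [_|j IH jn]; first by rewrite !mul0r expR0 mul1r addr0.
  rewrite (le_trans (step _ jn))//.
  have IHj := ler_wpM2l (expR_ge0 k) (IH (ltnW jn)).
  have eS1 : expR (j.+1%:R * k) = expR (j%:R * k) * expR k.
    by rewrite -natr1 mulrDl mul1r (expRD (j%:R * k) k).
  have eS2 : expR (j.+1%:R * b) = expR (j%:R * b) * expR b.
    by rewrite -natr1 mulrDl mul1r (expRD (j%:R * b) b).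
  rewrite eS1 eS2 -natr1 mulrDl mul1r.
  have kb : expR k <= expR b.
    by rewrite ler_expR /k -/b mulNr gerDr oppr_le0 mulr_ge0.
  have eb1 : 1 <= expR b by rewrite -[leLHS]expR0 ler_expR.
  have ejb1 : 1 <= expR (j%:R * b) by rewrite -[leLHS]expR0 ler_expR; exact: mulr_ge0.
  have t1 : expR k * (j%:R * (h * eps * expR (j%:R * b)))
     <= j%:R * (h * eps * (expR (j%:R * b) * expR b)).
    rewrite [leLHS](_ : _ = j%:R * (h * eps * (expR (j%:R * b) * expR k))); last by ring.
    by rewrite !ler_wpM2l ?mulr_ge0 ?expR_ge0.
  have t2 : h * eps <= h * eps * (expR (j%:R * b) * expR b).
    by rewrite ler_peMr ?mulr_ge0// mulr_ege1.
  by move: IHj; rewrite mulrDr; lra.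
apply: le_trans (main n (leqnn n)) _.
rewrite le_eqVlt; apply/orP; left; apply/eqP; rewrite /k /b.
rewrite [n%:R * (L ^+ 2 * h ^+ 2 / 2)](_ : _ = L ^+ 2 * (n%:R * h) * h / 2); last by field.
rewrite [n%:R * (- gamma * h + _)](_ : _ = - gamma * (n%:R * h) + L ^+ 2 * (n%:R * h) * h / 2); last by field.
by ring.
Qed.

End discrete_stability.

Lemma bounded_on_segment (R : realType) d (X : R -> 'rV[R]_d) T : 0 <= T ->
  {within `[0, +oo[, continuous X} ->
  exists2 G, 0 <= G & forall t, 0 <= t -> t <= T -> enorm (X t) <= G.
Proof.
move=> T0 cX.
have cXT : {within `[0, T], continuous X}.
  by apply: continuous_subspaceW cX => u /=; rewrite !in_itv/= andbT => /andP[].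
have [c _ Hc] := EVT_max T0 (within_continuous_comp cXT (@continuous_enorm R d)).
exists (enorm (X c)); first exact: enorm_ge0.
by move=> t t0 tT; apply: Hc; rewrite in_itv/= t0.
Qed.

Lemma near_step_lt (R : realType) (a c : R) : 0 <= a -> 0 < c ->
  \forall m \near \oo, a / m.+1%:R < c.
Proof.
move=> a0 c0; have : (a * harmonic m @[m --> \oo] --> a * 0)%R.
  by apply: cvgM; [exact: cvg_cst|exact: cvg_harmonic].
rewrite mulr0 => /cvgr0Pnorm_lt/(_ c c0); apply: filterS => m.
by rewrite ger0_norm// mulr_ge0// invr_ge0.
Qed.

(** * Solutions as Euler schemes with vanishing defect *)

Section sde_path.
Variables (R : realType) (d : nat) (f : 'rV[R]_d -> 'rV[R]_d) (alpha gamma C : R)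
  (q : nat).
Hypotheses (alpha_gt0 : 0 < alpha) (gamma_gt0 : 0 < gamma) (C_ge1 : 1 <= C).
Hypothesis f_cont : continuous f.
Hypothesis f_diss : forall x1 x2 : 'rV[R]_d,
  inner (f x2 - f x1) (x2 - x1) <= - gamma * enorm (x2 - x1) ^+ 2.
Hypothesis f_growth : drift_growth C q f.

Lemma integral_increment (g : R -> R) (s t eps : R) : 0 <= s -> s <= t ->
  {within `[0, t], continuous g} ->
  (forall u, u \in `[s, t] -> `|g u - g s| <= eps) ->
  `|\int[lebesgue_measure]_(u in `[0, t]) g u
    - \int[lebesgue_measure]_(u in `[0, s]) g u - (t - s) * g s| <= (t - s) * eps.
Proof.
move=> s0 st cg gle.
have ig : lebesgue_measure.-integrable `[0, t] (EFin \o g).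
  by apply: continuous_compact_integrable => //; exact: segment_compact.
have sub : `]s, t] `<=` `[0, t].
  by move=> u /=; rewrite !in_itv/= => /andP[su ->]; rewrite (le_trans s0 (ltW su)).
have igs : lebesgue_measure.-integrable `]s, t] (EFin \o g).
  by apply: integrableS ig.
have mst : fine (lebesgue_measure `]s, t]) = t - s.
  rewrite lebesgue_measure_itv/= lte_fin; case: ltP => // ts.
  by rewrite (_ : t = s) ?subrr//; apply/eqP; rewrite eq_le st ts.
have icst (c : R) : lebesgue_measure.-integrable `]s, t] (EFin \o cst c).
  have ic : lebesgue_measure.-integrable `[0, t] (EFin \o cst c).
    apply: continuous_compact_integrable; first exact: segment_compact.
    by apply: continuous_subspaceT => u; exact: cvg_cst.
  by apply: integrableS ic.
have cstE (c : R) : \int[lebesgue_measure]_(u in `]s, t]) c = (t - s) * c.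
  by rewrite Rintegral_cst// mst mulrC.
rewrite Rintegral_itvB ?bnd_simp// -(cstE (g s)) -RintegralB//.
have igB : lebesgue_measure.-integrable `]s, t] (EFin \o (fun u => g u - g s)).
  rewrite (_ : EFin \o _ = ((EFin \o g) \- (EFin \o cst (g s)))%E).
    by apply: integrableB.
  by apply/funext => u /=; rewrite EFinB.
apply: le_trans (le_normr_Rintegral _ _) _ => //.
rewrite -(cstE eps); apply: le_Rintegral => //.
- exact: integrable_norm.
- exact: (icst eps).
- move=> u /=; rewrite in_itv/= => /andP[su ut]; apply: gle.
  by rewrite in_itv/= (ltW su).
- exact: (icst (g s)).
Qed.

Section one_solution.
Variables (X W : R -> 'rV[R]_d) (x0 : 'rV[R]_d).
Hypothesis X_cont : {within `[0, +oo[, continuous X}.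
Hypothesis X_eq : forall t, 0 <= t ->
  X t = x0 + \row_i (\int[lebesgue_measure]_(s in `[0, t]) f (X s) 0 i) + W t.

Let X_contT T : {within `[0, T], continuous X}.
Proof.
apply: continuous_subspaceW X_cont => u /=; rewrite !in_itv/= andbT.
by case/andP.
Qed.

(** Uniform continuity of f along the path makes the solution an Euler scheme whose defect is
    uniformly small on the segment. No rate is extracted: the order of convergence is obtained
    separately, between schemes. *)
Lemma drift_increment T eps : 0 < eps -> exists2 del : R, 0 < del &
  forall s t, 0 <= s -> s <= t -> t <= T -> t - s < del ->
    exists2 eta, enorm eta <= eps &
      X t - X s = (t - s) *: f (X s) + (t - s) *: eta + (W t - W s).
Proof.
move=> eps0.
have cfX : {within `[0, T], continuous (f \o X)}.
  by apply: within_continuous_comp f_cont; exact: X_contT.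
(* The [d] coordinate errors are summed; [d.+1] also covers [d = 0]. *)
have e1 : 0 < eps / d.+1%:R by rewrite divr_gt0.
have [del del0 Hd] := unif_continuous_segment cfX e1.
exists del => // s t s0 st tT tsd.
pose rho := X t - X s - (W t - W s) - (t - s) *: f (X s).
have rho_le : enorm rho <= (t - s) * eps.
  rewrite (le_trans (enorm_le_sum _))//.
  have ci i : `|rho 0 i| <= (t - s) * (eps / d.+1%:R).
    have Xi u : 0 <= u -> X u 0 i = x0 0 i +
        \int[lebesgue_measure]_(s in `[0, u]) f (X s) 0 i + W u 0 i.
      by move=> u0; rewrite X_eq// !mxE.
    rewrite /rho !mxE (Xi t (le_trans s0 st)) (Xi s s0).
    rewrite [Z in `|Z|](_ : _ = \int[lebesgue_measure]_(u in `[0, t]) f (X u) 0 i -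
      \int[lebesgue_measure]_(u in `[0, s]) f (X u) 0 i - (t - s) * f (X s) 0 i);
      last by ring.
    apply: (@integral_increment (fun u => f (X u) 0 i)) => //.
      have cfXt : {within `[0, t], continuous (f \o X)}.
        by apply: within_continuous_comp f_cont; exact: X_contT.
      exact: (within_continuous_comp cfXt (@coord_continuous _ _ _ 0 i)).
    move=> u; rewrite in_itv/= => /andP[su ut].
    have := @Hd s u; rewrite !in_itv/= s0 (le_trans st tT) (le_trans s0 su) (le_trans ut tT).
    rewrite ger0_norm ?subr_ge0// => /(_ isT isT) H.
    have := coord_le_mx_norm (f (X u) - f (X s)) i; rewrite !mxE => /le_trans; apply.
    by apply: H; rewrite (le_lt_trans _ tsd)// lerD2r.
  apply: (@le_trans _ _ (\sum_(i < d) (t - s) * (eps / d.+1%:R))).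
    by apply: ler_sum.
  rewrite sumr_const card_ord -[leLHS]mulr_natl mulrCA ler_wpM2l ?subr_ge0//.
  by rewrite mulrCA ler_piMr ?(ltW eps0)// ler_pdivrMr// mul1r ler_nat.
have [ts|ts] := eqVneq t s.
  exists 0; first by rewrite enorm0 ltW.
  by rewrite ts !subrr !scale0r !addr0.
have ts0 : 0 < t - s by rewrite subr_gt0 lt_neqAle eq_sym ts.
exists ((t - s)^-1 *: rho).
  by rewrite enormZ gtr0_norm ?invr_gt0// ler_pdivrMl.
rewrite scalerA divff ?gt_eqF// scale1r /rho.
move: (X t) (X s) (W t) (W s) (_ *: _) => a b c e1' v.
by apply/rowP => i; rewrite !mxE; ring.
Qed.

Lemma solution_start : X 0 = x0 + W 0.
Proof.
rewrite X_eq// (_ : \row_i _ = 0) ?addr0//.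
by apply/rowP => i; rewrite !mxE set_itv1 Rintegral_set1.
Qed.

Hypothesis W0 : W 0 = 0.
Hypothesis W_cont : {within `[0, +oo[, continuous W}.

(** The pathwise bound keeps all schemes, and continuity keeps the solution, in one ball independent
    of [m]. There [f] has a fixed Lipschitz constant, and the defects come from the solution and
    from taming. *)
Lemma scheme_cvg N dt : 0 < dt ->
  (fun m : nat => enorm (tamed_path f alpha (dt / m.+1%:R)
     (fun n => W (n%:R * (dt / m.+1%:R)) - W 0) x0 (N * m.+1) - X (N%:R * dt)))
  @ \oo --> (0 : R).
Proof.
move=> dt0; set T := N%:R * dt; have T0 : 0 <= T by rewrite mulr_ge0// ltW.
have [GX GX0 HX] := bounded_on_segment T0 X_cont.
have [GW GW0 HW] := bounded_on_segment T0 W_cont.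
have [f_poly f_lip _ _] := f_growth.
have C0 : 0 <= C := le_trans ler01 C_ge1.
(* Bounds the path size uniformly in [m]: a Riemann sum is at most the horizon times the
   supremum. *)
pose Hb := 1 + enorm x0 + T + T * (1 + GW) ^+ (4 * q).
have x00 := enorm_ge0 x0.
have HTW : 0 <= T * (1 + GW) ^+ (4 * q) by rewrite mulr_ge0// exprn_ge0// addr_ge0.
have Hb0 : 0 <= Hb by rewrite /Hb; lra.
pose mc := moment_const alpha C gamma q.
have cg0 : 0 <= C ^+ 2 / (2 * gamma).
  by rewrite divr_ge0 ?sqr_ge0// mulr_ge0// ltW.
have mc0 : 0 <= mc.
  rewrite /mc /moment_const /energy_const !addr_ge0//.
  by rewrite divr_ge0 ?(ltW alpha_gt0)// exprn_even_ge0.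
pose PB := mc * Hb ^+ (8 * q + 2) + GW.
have PB0 : 0 <= PB by rewrite addr_ge0// mulr_ge0// exprn_ge0.
pose G := GX + PB; have G0 : 0 <= G by rewrite addr_ge0.
pose L := C * (1 + 2 * G) ^+ q.
have L1 : 1 <= L.
  by rewrite -[1]mulr1 /L ler_pM// exprn_ege1// lerDl mulr_ge0.
have L0 : 0 < L := lt_le_trans ltr01 L1.
pose B := expR (L ^+ 2 * T * dt / 2).
have B0 : 0 < B := expR_gt0 _.
apply/cvgr0Pnorm_le => eps eps0.
(* Two defects of size [eps1] act over time [T] with amplification at most [B]; [T + 1] covers
   [T = 0]. *)
pose eps1 := eps / (2 * (T + 1) * B).
have T10 : 0 < T + 1 by lra.
have den0 : 0 < 2 * (T + 1) * B by rewrite !mulr_gt0.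
have eps10 : 0 < eps1 by rewrite divr_gt0.
have [del del0 Hdel] := drift_increment T eps10.
have aL0 : 0 < alpha * L ^+ 2 by rewrite mulr_gt0// exprn_gt0.
near=> m; set h := dt / m.+1%:R; set w := fun n : nat => W (n%:R * h) - W 0.
set n := (N * m.+1)%N.
have h0 : 0 < h by rewrite divr_gt0.
have nh : n%:R * h = T by rewrite /n /h natrM -mulrA (mulrC m.+1%:R) divfK ?pnatr_eq0.
have hdt : h <= dt by rewrite ler_pdivrMr// ler_peMr ?(ltW dt0)// ler1n.
have hdel : h < del by rewrite /h; near: m; apply: near_step_lt => //; exact: ltW.
have heps : alpha * h * L ^+ 2 <= eps1.
  rewrite mulrAC -ler_pdivlMl// mulrC ltW// /h; near: m.
  by apply: near_step_lt => //; [exact: ltW|rewrite divr_gt0].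
have tj j : (j <= n)%N -> 0 <= j%:R * h /\ j%:R * h <= T.
  move=> jn; split; first by rewrite mulr_ge0// ltW.
  by rewrite -nh ler_wpM2r ?(ltW h0)// ler_nat.
have wle j : (j <= n)%N -> enorm (w j) <= GW.
  by move=> /tj[t0 tT]; rewrite /w W0 subr0 HW.
have w0 : w 0%N = 0 by rewrite /w mul0r subrr.
set Pth := tamed_path f alpha h w x0.
have Ple j : (j <= n)%N -> enorm (Pth j) <= PB.
  move=> jn; rewrite -(subrK (w j) (Pth j)) (le_trans (enormD _ _))// lerD ?wle//.
  rewrite (le_trans (tamed_path_bound alpha_gt0 C_ge1 gamma_gt0 f_poly f_diss x0 h0 w0 jn))//.
  have ps0 : 0 <= path_size h w x0 n (4 * q).
    rewrite /path_size nh !addr_ge0// mulr_ge0 ?(ltW h0)//.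
    by apply: sumr_ge0 => i _; rewrite exprn_ge0// addr_ge0// enorm_ge0.
  rewrite ler_wpM2l// lerXn2r ?nnegrE// /path_size /Hb nh lerD2l.
  apply: (@le_trans _ _ (h * \sum_(j < n) (1 + GW) ^+ (4 * q))).
    rewrite ler_wpM2l ?(ltW h0)//; apply: ler_sum => i _.
    by rewrite lerXn2r ?nnegrE ?addr_ge0 ?enorm_ge0// lerD2l wle// ltnW.
  by rewrite sumr_const card_ord -[X in h * X]mulr_natl mulrA (mulrC h) nh.
have lipG x y : enorm x <= G -> enorm y <= G -> enorm (f y - f x) <= L * enorm (y - x).
  move=> xG yG; rewrite (le_trans (f_lip x y))// ler_wpM2r ?enorm_ge0// ler_wpM2l//.
  by have := enorm_ge0 x; have := enorm_ge0 y => ? ?; rewrite lerXn2r ?nnegrE; lra.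
have fG x : enorm x <= G -> enorm (f x) <= L.
  move=> xG; rewrite (le_trans (f_poly x))// ler_wpM2l//.
  by have := enorm_ge0 x => ?; rewrite lerXn2r ?nnegrE; lra.
have PG j : (j <= n)%N -> enorm (Pth j) <= G.
  by move=> jn; rewrite (le_trans (Ple j jn))// lerDr.
have XG j : (j <= n)%N -> enorm (X (j%:R * h)) <= G.
  by move=> /tj[t0 tT]; rewrite (le_trans (HX _ t0 tT))// lerDl.
pose e j := X (j%:R * h) - Pth j.
pose dl j := f (X (j%:R * h)) - f (Pth j).
pose eta j := h^-1 *: (e j.+1 - e j - h *: dl j).
have e0 : e 0%N = 0 by rewrite /e mul0r solution_start W0 addr0 /Pth subrr.
have eS j : (j < n)%N -> e j.+1 = e j + h *: dl j + h *: eta j.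
  move=> _; rewrite /eta scalerA divff ?gt_eqF// scale1r.
  by move: (e _) (e _) (_ *: _) => a b c; apply/rowP => i; rewrite !mxE; ring.
have etaE j : (j < n)%N -> enorm (eta j) <= eps1 + eps1.
  move=> jn; have [t0 tT] := tj j (ltnW jn); have [t10 t1T] := tj j.+1 jn.
  have th : j.+1%:R * h - j%:R * h = h by rewrite -natr1; ring.
  have tt : j%:R * h <= j.+1%:R * h by rewrite ler_wpM2r ?(ltW h0)// ler_nat.
  have := Hdel _ _ t0 tt t1T; rewrite th => /(_ hdel)[et etl etE].
  have -> : eta j = et + (f (Pth j) - tamed f alpha h (Pth j)).
    rewrite /eta -[RHS](scalerK (lt0r_neq0 h0)); congr (_ *: _).
    rewrite /e /dl [Pth j.+1](_ : _ = Pth j + h *: tamed f alpha h (Pth j) + (w j.+1 - w j))//.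
    rewrite -(subrK (X (j%:R * h)) (X (j.+1%:R * h))) etE /w.
    move: (X _) (W _) (W _) (W _) (Pth j) (tamed _ _ _ _) (f _) (f _) => b c u v p t z a.
    by apply/rowP => i; rewrite !mxE; ring.
  rewrite (le_trans (enormD _ _))// lerD// enorm_distC.
  rewrite (le_trans (tamed_err f alpha_gt0 _ (ltW h0)))// (le_trans _ heps)//.
  rewrite ler_wpM2l ?(mulr_ge0 (ltW alpha_gt0) (ltW h0))//.
  by rewrite lerXn2r ?nnegrE ?enorm_ge0 ?(ltW L0)// fG// PG// ltnW.
have := @perturbed_contraction R d gamma L h (eps1 + eps1) e dl eta n (ltW h0) _ eS _ _ etaE (ltW gamma_gt0).
rewrite e0 enorm0 mulr0 add0r nh.
have -> : e n = X (N%:R * dt) - Pth n by rewrite /e nh.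
rewrite ger0_norm ?enorm_ge0// enorm_distC => H.
apply: le_trans (H _ _ _) _.
- by rewrite addr_ge0// ltW.
- move=> j jn; rewrite innerC; exact: f_diss.
- by move=> j jn; rewrite lipG// ?PG ?XG// ltnW.
have hB : expR (L ^+ 2 * T * h / 2) <= B.
  by rewrite ler_expR ler_wpM2r// ler_wpM2l// mulr_ge0// sqr_ge0.
apply: (@le_trans _ _ (T * (eps1 + eps1) * B)).
  by rewrite ler_wpM2l// mulr_ge0// addr_ge0// ltW.
rewrite (_ : T * (eps1 + eps1) * B = eps * (T / (T + 1))); last first.
  by rewrite /eps1; field; rewrite !gt_eqF//; lra.
by rewrite ler_piMr ?(ltW eps0)// ler_pdivrMr; lra.
Unshelve. all: by end_near. Qed.

End one_solution.

(** The common noise cancels in the difference of the two increments, so on the grid T/(m+1) the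
    difference of the solutions is a contracting recursion with small defect. The refinement m -> oo
    replaces differentiation of the squared distance. *)
Lemma solution_contraction (X Y W : R -> 'rV[R]_d) x0 y0 T : 0 <= T ->
  {within `[0, +oo[, continuous X} -> {within `[0, +oo[, continuous Y} ->
  (forall t, 0 <= t ->
    X t = x0 + \row_i (\int[lebesgue_measure]_(s in `[0, t]) f (X s) 0 i) + W t) ->
  (forall t, 0 <= t ->
    Y t = y0 + \row_i (\int[lebesgue_measure]_(s in `[0, t]) f (Y s) 0 i) + W t) ->
  enorm (X T - Y T) <= expR (- gamma * T) * enorm (x0 - y0).
Proof.
move=> T0 cX cY eX eY.
have X0 := solution_start eX; have Y0 := solution_start eY.
have E0 : X 0 - Y 0 = x0 - y0 by rewrite X0 Y0; apply/rowP => i; rewrite !mxE; ring.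
have [->|Tn0] := eqVneq T 0; first by rewrite E0 mulr0 expR0 mul1r.
have Tgt0 : 0 < T by rewrite lt_neqAle eq_sym Tn0.
have [GX GX0 HX] := bounded_on_segment T0 cX.
have [GY GY0 HY] := bounded_on_segment T0 cY.
have [_ f_lip _ _] := f_growth.
have C0 : 0 <= C := le_trans ler01 C_ge1.
pose L := C * (1 + GX + GY) ^+ q.
apply/ler_addgt0Pr => eps eps0.
(* Each solution contributes one defect of size [eps1], accumulated over time [T]. *)
pose eps1 := eps / (2 * T); have eps10 : 0 < eps1 by rewrite divr_gt0 ?mulr_gt0.
have [d1 d10 H1] := drift_increment cX eX T eps10.
have [d2 d20 H2] := drift_increment cY eY T eps10.
pose F h := expR (- gamma * T + L ^+ 2 * T / 2 * h) * enorm (x0 - y0) +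
  T * (eps1 + eps1) * expR (L ^+ 2 * T / 2 * h).
have cF : F (T * harmonic m) @[m --> \oo] --> F 0.
  have hm : (T * harmonic m @[m --> \oo] --> T * 0)%R.
    by apply: cvgM; [exact: cvg_cst|exact: cvg_harmonic].
  rewrite mulr0 in hm.
  have lin c k : expR (c + k * (T * harmonic m)) @[m --> \oo] --> expR (c + k * 0).
    apply: (cvg_comp _ expR); last exact: continuous_expR.
    by apply: cvgD; [exact: cvg_cst|apply: cvgM => //; exact: cvg_cst].
  apply: cvgD; apply: cvgM; rewrite ?mulr0; try exact: cvg_cst.
    by have := lin (- gamma * T) (L ^+ 2 * T / 2); rewrite mulr0.
  have := lin 0 (L ^+ 2 * T / 2); rewrite mulr0 addr0.
  by under eq_fun do rewrite add0r.
have F0 : F 0 = expR (- gamma * T) * enorm (x0 - y0) + eps.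
  rewrite /F mulr0 addr0 expR0 mulr1; congr (_ + _).
  by rewrite /eps1; field; rewrite gt_eqF.
rewrite -F0; apply: (ler_cvg_to (cvg_cst _) cF); near=> m.
set h := T * harmonic m; have hE : h = T / m.+1%:R by [].
have h0 : 0 < h by rewrite hE divr_gt0.
have nh : m.+1%:R * h = T by rewrite hE mulrC divfK// pnatr_eq0.
have hd1 : h < d1 by rewrite hE; near: m; exact: near_step_lt.
have hd2 : h < d2 by rewrite hE; near: m; exact: near_step_lt.
pose e (j : nat) := X (j%:R * h) - Y (j%:R * h).
pose dl (j : nat) := f (X (j%:R * h)) - f (Y (j%:R * h)).
pose eta j := h^-1 *: (e j.+1 - e j - h *: dl j).
have eS j : (j < m.+1)%N -> e j.+1 = e j + h *: dl j + h *: eta j.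
  move=> _; rewrite /eta scalerA divff ?gt_eqF// scale1r.
  by move: (e _) (e _) (_ *: _) => a b c; apply/rowP => i; rewrite !mxE; ring.
have tj j : (j <= m.+1)%N -> 0 <= j%:R * h /\ j%:R * h <= T.
  move=> jn; split; first by rewrite mulr_ge0// ltW.
  by rewrite -nh ler_wpM2r ?(ltW h0)// ler_nat.
have etaE j : (j < m.+1)%N -> enorm (eta j) <= eps1 + eps1.
  move=> jn; have [t0 tT] := tj j (ltnW jn); have [t10 t1T] := tj j.+1 jn.
  have th : j.+1%:R * h - j%:R * h = h by rewrite -natr1; ring.
  have tt : j%:R * h <= j.+1%:R * h by rewrite ler_wpM2r ?(ltW h0)// ler_nat.
  have := H1 _ _ t0 tt t1T; rewrite th => /(_ hd1)[et1 etl1 etE1].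
  have := H2 _ _ t0 tt t1T; rewrite th => /(_ hd2)[et2 etl2 etE2].
  have -> : eta j = et1 - et2.
    rewrite /eta -[RHS](scalerK (lt0r_neq0 h0)); congr (_ *: _).
    rewrite /e /dl -(subrK (X (j%:R * h)) (X (j.+1%:R * h))) etE1.
    rewrite -(subrK (Y (j%:R * h)) (Y (j.+1%:R * h))) etE2.
    move: (W _) (W _) (X _) (Y _) (f _) (f _) => u v x y a b.
    by apply/rowP => i; rewrite !mxE; ring.
  by rewrite (le_trans (enormB _ _))// lerD.
have := @perturbed_contraction R d gamma L h (eps1 + eps1) e dl eta m.+1 (ltW h0) _ eS _ _ etaE (ltW gamma_gt0).
have -> : e 0%N = x0 - y0 by rewrite /e !mul0r.
have -> : e m.+1 = X T - Y T by rewrite /e nh.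
rewrite nh => H; apply: le_trans (H _ _ _) _.
- by rewrite addr_ge0// ltW.
- move=> j jn; rewrite innerC; exact: f_diss.
- move=> j /ltnW/tj[t0 tT]; rewrite (le_trans (f_lip _ _))// ler_wpM2r ?enorm_ge0//.
  rewrite ler_wpM2l// lerXn2r ?nnegrE ?addr_ge0 ?enorm_ge0//.
  by have := HX _ t0 tT; have := HY _ t0 tT; rewrite /e; lra.
by rewrite /F (_ : L ^+ 2 * T * h / 2 = L ^+ 2 * T / 2 * h)//; ring.
Unshelve. all: by end_near. Qed.

End sde_path.

(** * Measurability and Gaussian moments *)

Section borel_rV.
Variables (R : realType) (d : nat).

Lemma continuous_measurable_rV (g : 'rV[R]_d -> R) : continuous g ->
  measurable_fun setT (g : borelRd R d -> R).
Proof.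
move=> /continuousP cg.
apply: (measurability _ (RGenOpens.measurableE R)) => _ [_ [a [b ->] <-]].
by rewrite setTI; apply: sub_sigma_algebra; apply: cg; exact: interval_open.
Qed.

Lemma measurable_coord d' (T : measurableType d') (g : T -> borelRd R d) i :
  measurable_fun setT g -> measurable_fun setT (fun t => g t 0 i).
Proof.
move=> mg; apply: (@measurableT_comp _ _ _ _ _ _ (fun x : borelRd R d => x 0 i)) => //.
by apply: continuous_measurable_rV; exact: coord_continuous.
Qed.

(** The sigma-algebra is generated by open sets, not by coordinates; the two agree because an open
    set is a countable union of boxes with rational centres and radii 1/(k+1). *)
Lemma measurable_rV d' (T : measurableType d') (g : T -> borelRd R d) :
  (forall i, measurable_fun setT (fun t => g t 0 i)) -> measurable_fun setT g.
Proof.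
move=> mg.
pose box (c : 'rV[rat]_d) (k : nat) : set 'rV[R]_d :=
  [set x | forall i, `|x 0 i - ratr (c 0 i)| < k.+1%:R^-1].
have mbox c k : measurable (g @^-1` box c k).
  have -> : g @^-1` box c k = \bigcap_(i in [set: 'I_d])
      ((fun t => g t 0 i) @^-1` `]ratr (c 0 i) - k.+1%:R^-1, ratr (c 0 i) + k.+1%:R^-1[).
    apply/seteqP; split => [t /= H i _|t /= H i].
      by have := H i; rewrite ltr_distl => ?; rewrite /= in_itv.
    by have := H i I; rewrite /= in_itv/= -ltr_distl.
  apply: fin_bigcap_measurable => // i _; rewrite -[X in measurable X]setTI.
  by apply: mg.
apply: (@measurability _ _ _ _ setT g (@open 'rV[R]_d)) => // _ [U oU <-].
rewrite setTI.
have -> : g @^-1` U = \bigcup_(p : 'rV[rat]_d * nat)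
    (g @^-1` (if `[< box p.1 p.2 `<=` U >] then box p.1 p.2 else set0)).
  apply/seteqP; split => [t /= Ut|t [[c k] _] /=]; last first.
    by case: asboolP => // bU bt; exact: bU.
  have /nbhs_ballP[eps /= eps0 beps] := open_nbhs_nbhs (conj oU Ut).
  have [k ke] : exists k : nat, k.+1%:R^-1 < eps / 2.
    have := near_step_lt ler01 (divr_gt0 eps0 (ltr0n R 2)).
    by move=> [k _ /(_ k (leqnn k))]; rewrite mul1r => ?; exists k.
  have kp : 0 < k.+1%:R^-1 :> R by rewrite invr_gt0.
  have rt i : exists c : rat, `|g t 0 i - ratr c| < k.+1%:R^-1.
    have /rat_in_itvoo[c] : g t 0 i - k.+1%:R^-1 < g t 0 i + k.+1%:R^-1.
      by rewrite ltrBlDr -addrA ltrDl addr_gt0.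
    by rewrite in_itv/= => ?; exists c; rewrite distrC ltr_distl.
  pose c : 'rV[rat]_d := \row_i projT1 (cid (rt i)).
  have bt : box c k (g t) by move=> i; rewrite mxE; exact: (projT2 (cid (rt i))).
  exists (c, k) => //=; case: asboolP => // -[] x bx; apply: beps.
  rewrite /ball/= /mx_ball; split=> // i j; rewrite (ord1 i) /ball/=.
  rewrite (_ : g t 0 j - x 0 j = (g t 0 j - ratr (c 0 j)) - (x 0 j - ratr (c 0 j))); last by ring.
  rewrite (le_lt_trans (ler_normB _ _))//.
  by apply: (lt_trans (ltrD (bt j) (bx j))); rewrite [ltRHS]splitr ltrD.
apply: countable_bigcupT_measurable => [|[c k]]; first exact: countableP.
by case: asboolP => _; [exact: mbox|rewrite preimage_set0].
Qed.

Lemma measurable_enorm d' (T : measurableType d') (g : T -> borelRd R d) :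
  measurable_fun setT g -> measurable_fun setT (fun t => enorm (g t)).
Proof.
move=> mg; apply: (@measurableT_comp _ _ _ _ _ _ (@enorm R d : borelRd R d -> R)) => //.
by apply: continuous_measurable_rV; exact: continuous_enorm.
Qed.

Lemma measurable_inner d' (T : measurableType d') (g k : T -> borelRd R d) :
  measurable_fun setT g -> measurable_fun setT k ->
  measurable_fun setT (fun t => inner (g t) (k t)).
Proof.
move=> mg mk; apply: measurable_sum => i; apply: measurable_funM.
  exact: measurable_coord.
exact: measurable_coord.
Qed.

Lemma measurable_rVB d' (T : measurableType d') (g k : T -> borelRd R d) :
  measurable_fun setT g -> measurable_fun setT k ->
  measurable_fun setT (fun t => g t - k t : borelRd R d).
Proof.
move=> mg mk; apply: measurable_rV => i; under eq_fun do rewrite !mxE.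
by apply: measurable_funB; exact: measurable_coord.
Qed.

Lemma measurable_rVD d' (T : measurableType d') (g k : T -> borelRd R d) :
  measurable_fun setT g -> measurable_fun setT k ->
  measurable_fun setT (fun t => g t + k t : borelRd R d).
Proof.
move=> mg mk; apply: measurable_rV => i; under eq_fun do rewrite !mxE.
by apply: measurable_funD; exact: measurable_coord.
Qed.

Lemma measurable_rVZ d' (T : measurableType d') (a : R) (g : T -> borelRd R d) :
  measurable_fun setT g ->
  measurable_fun setT (fun t => a *: (g t : 'rV[R]_d) : borelRd R d).
Proof.
move=> mg; apply: measurable_rV => i; under eq_fun do rewrite !mxE.
by apply: measurable_funM => //; exact: measurable_coord.
Qed.

Lemma continuous_measurable_rV_comp d' (T : measurableType d')
    (k : 'rV[R]_d -> 'rV[R]_d) (g : T -> borelRd R d) :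
  (forall i, continuous (fun x => k x 0 i)) -> measurable_fun setT g ->
  measurable_fun setT (fun t => k (g t) : borelRd R d).
Proof.
move=> ck mg; apply: measurable_rV => i.
apply: (@measurableT_comp _ _ _ _ _ _ (fun x : borelRd R d => k x 0 i)) => //.
by apply: continuous_measurable_rV => x; exact: ck.
Qed.

Lemma continuous_quotient (T : topologicalType) (a b : T -> R) :
  continuous a -> continuous b -> (forall x, a x != 0) ->
  continuous (fun x => (a x)^-1 * b x).
Proof.
by move=> ca cb a0 x; apply: cvgM; [apply: cvgV => //; exact: ca|exact: cb].
Qed.

Lemma continuous_affine (T : topologicalType) (a b : R) (k : T -> R) :
  continuous k -> continuous (fun x => a + b * k x).
Proof.
move=> ck x; apply: cvgD; first exact: cvg_cst.
by apply: cvgM; [exact: cvg_cst|exact: ck].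
Qed.

Lemma continuous_coord_comp (T : topologicalType) (k : T -> 'rV[R]_d) i :
  continuous k -> continuous (fun x => k x 0 i).
Proof. by move=> ck x; exact: cvg_comp (ck x) (@coord_continuous _ _ _ 0 i _). Qed.

(** Source space and initial state are general so that one statement serves the full sigma-algebra,
    the filtration at a fixed time, and the product of initial states with paths. *)
Lemma measurable_tamed_path (f : 'rV[R]_d -> 'rV[R]_d) alpha h d'
    (T : measurableType d') (w : nat -> T -> borelRd R d) (x0 : T -> borelRd R d) n :
  0 <= alpha -> 0 <= h -> continuous f ->
  (forall j, (j <= n)%N -> measurable_fun setT (w j)) -> measurable_fun setT x0 ->
  measurable_fun setT
    (fun t => tamed_path f alpha h (fun j => w j t) (x0 t) n : borelRd R d).
Proof.
move=> a0 h0 cf; elim: n => [//|n IH] mw mx0 /=.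
have mX := IH (fun j jn => mw j (leqW jn)) mx0.
apply: measurable_rVD; last first.
  by apply: measurable_rVB; apply: mw.
apply: measurable_rVD => //; apply: measurable_rVZ.
apply: continuous_measurable_rV_comp mX.
move=> i; rewrite (_ : (fun x => _) =
    (fun x => (1 + alpha * h * enorm (f x))^-1 * f x 0 i)); last first.
  by apply/funext => x; rewrite mxE.
apply: continuous_quotient; last by move=> x; rewrite gt_eqF// ltr_pwDl// !mulr_ge0 ?enorm_ge0.
  apply: continuous_affine => x.
  exact: cvg_comp (cf x) (@continuous_enorm R d _).
exact: continuous_coord_comp.
Qed.

End borel_rV.

(** * Integration against densities and Gaussian moments *)

Section density.
Import HBNNSimple.

(** The standard route: indicators, then simple functions, then monotone limits. *)
Lemma ge0_integral_density dd (T : measurableType dd) (R : realType)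
    (mu nu : {measure set T -> \bar R}) (p : T -> R) (f : T -> \bar R) :
  measurable_fun setT p -> (forall x, 0 <= p x) ->
  (forall A, measurable A -> nu A = \int[mu]_(x in A) (p x)%:E)%E ->
  measurable_fun setT f -> (forall x, 0 <= f x)%E ->
  (\int[nu]_x f x = \int[mu]_x (f x * (p x)%:E))%E.
Proof.
move=> mp p0 nuE mf f0.
have mpE : measurable_fun setT (EFin \o p) by exact/measurable_EFinP.
pose f_ := nnsfun_approx measurableT mf.
have fcvg x : (f_ n x)%:E @[n --> \oo] --> f x by exact: cvg_nnsfun_approx.
have -> : (\int[nu]_x f x = limn (fun n => \int[nu]_x (f_ n x)%:E))%E.
  rewrite -monotone_convergence//=.
  - by apply: eq_integral => x _; apply/esym/cvg_lim.
  - by move=> n; exact/measurable_EFinP.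
  - by move=> n x _; rewrite lee_fin.
  - by move=> x _ m n mn; rewrite lee_fin; exact/lefP/nd_nnsfun_approx.
have -> : (\int[mu]_x (f x * (p x)%:E) = limn (fun n => \int[mu]_x ((f_ n x)%:E * (p x)%:E)))%E.
  rewrite -monotone_convergence//=.
  - apply: eq_integral => x _; apply/esym/cvg_lim => //.
    by apply: cvgeZr => //; exact: fcvg.
  - by move=> n; apply: emeasurable_funM => //; exact/measurable_EFinP.
  - by move=> n x _; rewrite mule_ge0// lee_fin.
  - move=> x _ m n mn; rewrite lee_wpmul2r// lee_fin//; exact/lefP/nd_nnsfun_approx.
congr (limn _); apply/funext => n.
rewrite integralT_nnsfun sintegralE.
have -> : (\int[mu]_x ((f_ n x)%:E * (p x)%:E) = \int[mu]_x \sum_(y \in range (f_ n))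
    (y%:E * ((\1_(f_ n @^-1` [set y]) x)%:E * (p x)%:E)))%E.
  apply: eq_integral => x _; rewrite fimfunE -fsumEFin// ge0_mule_fsuml.
    by apply: eq_fsbigr => y _; rewrite EFinM muleA.
  by move=> y; rewrite EFinM; exact: nnfun_muleindic_ge0.
rewrite ge0_integral_fsum//; last 2 first.
  - move=> y; apply: measurable_funeM; apply: emeasurable_funM => //.
    exact/measurable_EFinP.
  - move=> y x _; have := nnfun_muleindic_ge0 (f_ n) y x.
    by rewrite muleA => H; rewrite mule_ge0// lee_fin.
apply: eq_fsbigr => y /[!inE] -[x0 _ <-].
rewrite ge0_integralZl//; last 3 first.
  - by apply: emeasurable_funM => //; exact/measurable_EFinP.
  - by move=> x _; rewrite mule_ge0// lee_fin.
  - by rewrite lee_fin.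
congr (_ * _)%E; rewrite nuE// integral_mkcond; apply: eq_integral => x _.
by rewrite patchE indicE; case: ifP => _; rewrite ?mul1e ?mul0e.
Qed.

End density.

(** Completing the square: [expR (l * x)] times the centred density is a constant times the density
    with mean [l * s ^+ 2]. *)
Lemma normal_exp_moment_le (R : realType) (s l : R) : 0 < s ->
  (\int[normal_prob 0 s]_x (expR (l * x))%:E <= (expR (l ^+ 2 * s ^+ 2 / 2))%:E)%E.
Proof.
move=> s0.
have mexp : measurable_fun [set: measurableTypeR R] (fun x : R => (expR (l * x))%:E).
  by apply/measurable_EFinP; apply: (@measurableT_comp _ _ _ _ _ _ (@expR R)).
rewrite (@ge0_integral_density _ _ _ lebesgue_measure _ (normal_pdf 0 s))//; last 2 first.
- exact: measurable_normal_pdf.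
- by move=> x; exact: normal_pdf_ge0.
rewrite (_ : (fun x => _) = (fun x => (expR (l ^+ 2 * s ^+ 2 / 2))%:E *
    (normal_pdf (l * s ^+ 2) s x)%:E)%E); last first.
  apply/funext => x; rewrite -!EFinM !normal_pdfE ?gt_eqF// /normal_fun.
  congr EFin; rewrite mulrCA [RHS]mulrCA -!expRD; congr (_ * expR _).
  by field; rewrite gt_eqF.
rewrite ge0_integralZl//=; last 2 first.
- by apply/measurable_EFinP; exact: measurable_normal_pdf.
- by move=> x _; rewrite lee_fin normal_pdf_ge0.
by rewrite integral_normal_pdf mule1.
Qed.

(* From [y^m <= m^m exp y] and the exponential moments at [1] and [-1]. *)
Definition normal_moment (R : realType) m : R := 2 * m%:R ^+ m * expR (2^-1).

Lemma power_le_exp (R : realType) (y : R) m : 0 <= y -> y ^+ m <= m%:R ^+ m * expR y.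
Proof.
move=> y0; case: m => [|m]; first by rewrite !expr0 mul1r -expR0 ler_expR.
have m0 : 0 < m.+1%:R :> R by rewrite ltr0n.
have -> : y ^+ m.+1 = m.+1%:R ^+ m.+1 * (y / m.+1%:R) ^+ m.+1.
  by rewrite -exprMn mulrCA divff ?mulr1// gt_eqF.
rewrite ler_wpM2l ?exprn_ge0//.
have -> : expR y = expR (y / m.+1%:R) ^+ m.+1.
  by rewrite -expRM_natl mulrC divfK// gt_eqF.
rewrite lerXn2r ?nnegrE ?expR_ge0 ?divr_ge0//.
by move: (y / _) => z; have := expR_ge1Dx z; lra.
Qed.

(** After scaling by [s] the exponential moments are taken at 1/s and -1/s, where their bound
    exp(1/2) no longer depends on [s]. *)
Lemma normal_moment_le (R : realType) (s : R) m : 0 < s ->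
  (\int[normal_prob 0 s]_x (`|x| ^+ m)%:E <= (normal_moment R m * s ^+ m)%:E)%E.
Proof.
move=> s0.
have mE l : measurable_fun [set: measurableTypeR R] (fun x : R => (expR (l * x))%:E).
  by apply/measurable_EFinP; apply: (@measurableT_comp _ _ _ _ _ _ (@expR R)).
pose c := m%:R ^+ m * s ^+ m.
have c0 : 0 <= c by rewrite mulr_ge0// exprn_ge0// ltW.
have e0 l (x : measurableTypeR R) : (0 <= (expR (l * x))%:E)%E by rewrite lee_fin expR_ge0.
apply: (@le_trans _ _ (\int[normal_prob 0 s]_x
    (c%:E * ((expR (s^-1 * x))%:E + (expR (- s^-1 * x))%:E)))%E).
  apply: ge0_le_integral => //.
  - apply/measurable_EFinP; apply: measurable_funX.
    exact: normr_measurable.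
  - by apply: measurable_funeM; apply: emeasurable_funD.
  - move=> x _; rewrite -EFinD -EFinM lee_fin.
    have sx : `|x| = s * (`|x| / s) by rewrite mulrCA divff ?mulr1// gt_eqF.
    have y0 : 0 <= `|x| / s by rewrite divr_ge0// ltW.
    rewrite sx exprMn /c -mulrA mulrCA ler_wpM2l ?exprn_ge0 ?(ltW s0)//.
    rewrite (le_trans (power_le_exp m y0))// ler_wpM2l ?exprn_ge0//.
    have := expR_ge0 (s^-1 * x); have := expR_ge0 (- s^-1 * x).
    have [x0|x0] := ler0P x.
      by rewrite mulrC mulrN mulNr; lra.
    by rewrite (mulrC x); lra.
rewrite ge0_integralZl//; last 2 first.
- by apply: emeasurable_funD.
- by move=> x _; rewrite adde_ge0.
rewrite ge0_integralD//.
have h1 := normal_exp_moment_le s^-1 s0.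
have h2 := normal_exp_moment_le (- s^-1) s0.
have E l : l ^+ 2 = s ^- 2 -> l ^+ 2 * s ^+ 2 / 2 = 2^-1.
  by move=> ->; rewrite mulVf ?mul1r// expf_neq0// gt_eqF.
rewrite E ?exprVn// in h1; rewrite E ?sqrrN ?exprVn// in h2.
apply: (@le_trans _ _ (c%:E * ((expR 2^-1)%:E + (expR 2^-1)%:E))%E).
  by rewrite lee_wpmul2l ?lee_fin// leeD.
rewrite -EFinD -EFinM lee_fin le_eqVlt; apply/orP; left; apply/eqP.
by rewrite /c /normal_moment; ring.
Qed.

Lemma normal_integrable (R : realType) (s : R) : 0 < s ->
  (normal_prob 0 s).-integrable setT (EFin \o (id : measurableTypeR R -> R)).
Proof.
move=> s0; apply/integrableP; split; first exact/measurable_EFinP.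
have := normal_moment_le 1 s0.
under eq_integral do rewrite expr1.
by move=> /le_lt_trans; apply; rewrite ltry.
Qed.

(* [1 + l x <= exp (l x)] forces [l E[x] <= exp (l^2 s^2 / 2) - 1] for every real l; let l -> 0. *)
Lemma normal_mean0 (R : realType) (s : R) : 0 < s ->
  (\int[normal_prob 0 s]_x (x%:E) = 0)%E.
Proof.
move=> s0; have ix := normal_integrable s0.
have ifin : (\int[normal_prob 0 s]_x (x%:E) \is a fin_num)%E by exact: integrable_fin_num.
set I := (\int[normal_prob 0 s]_x (x%:E))%E in ifin *.
have IE : I = (fine I)%:E by rewrite fineK.
have key l : 1 + l * fine I <= expR (l ^+ 2 * s ^+ 2 / 2).
  rewrite -lee_fin; apply: le_trans (normal_exp_moment_le l s0).
  have mE : measurable_fun [set: measurableTypeR R] (fun x : R => (expR (l * x))%:E).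
    by apply/measurable_EFinP; apply: (@measurableT_comp _ _ _ _ _ _ (@expR R)).
  have i1 : (normal_prob 0 s).-integrable setT (cst 1%:E : measurableTypeR R -> \bar R).
    exact: (finite_measure_integrable_cst _ 1 measurableT).
  have i2 : (normal_prob 0 s).-integrable setT
      (fun x : measurableTypeR R => (l%:E * x%:E)%E) by exact: integrableZl.
  have -> : ((1 + l * fine I)%:E = \int[normal_prob 0 s]_x (1 + l%:E * x%:E))%E.
    rewrite (integralD measurableT i1 i2) integral_cst//= probability_setT mule1.
    by rewrite integralZl// -/I IE.
  apply: le_integral => //.
  - exact: integrableD.
  - apply/integrableP; split => //.
    under eq_integral do rewrite gee0_abs ?lee_fin ?expR_ge0//.
    by apply: le_lt_trans (normal_exp_moment_le l s0) _; rewrite ltry.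
  - by move=> x _; rewrite -EFinM -EFinD lee_fin expR_ge1Dx.
rewrite IE; congr EFin; set a := fine I in key *.
have half (y : R) : 0 <= y -> y <= 1 / 2 -> expR y <= 1 + 2 * y.
  move=> y0 y1; have e0 := expR_gt0 y.
  have : (1 - y) * expR y <= 1.
    by rewrite -ler_pdivlMr// mul1r -expRN expR_ge1Dx.
  by nra.
apply/eqP; apply: contraT => a0.
pose k := s ^+ 2 + 1; have k0 : 0 < k by rewrite ltr_pwDr// sqr_ge0.
have bnd l : 0 < `|l| -> l ^+ 2 * s ^+ 2 / 2 <= 1 / 2 -> l * a <= l ^+ 2 * k.
  move=> l0 l1; have := half _ _ l1; have := key l.
  have ls : 0 <= l ^+ 2 * s ^+ 2 / 2 by rewrite divr_ge0// mulr_ge0 ?sqr_ge0.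
  by move=> h /(_ ls) h2; rewrite /k; have := sqr_ge0 l; nra.
(* The sign makes [l * a] positive. The first bound yields the contradiction |a| <= |a| / 2; the
   second keeps the exponent below 1/2, where exp y <= 1 + 2 y. *)
pose l := Num.sg a * Num.min (`|a| / (2 * k)) (1 / k).
have na : 0 < `|a| by rewrite normr_gt0.
have mn0 : 0 < Num.min (`|a| / (2 * k)) (1 / k) by rewrite lt_min !divr_gt0// mulr_gt0.
set n := Num.min _ _ in l mn0.
have ln : `|l| = n by rewrite normrM normr_sg a0 mulr1n mul1r gtr0_norm.
have n1 : n <= `|a| / (2 * k) by rewrite ge_min lexx.
have n2 : n <= 1 / k by rewrite ge_min lexx orbT.
have sa : Num.sg a ^+ 2 = 1 by rewrite sqr_sg a0.
have l2 : l ^+ 2 = n ^+ 2 by rewrite exprMn sa mul1r.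
have nk : n * k <= 1 by rewrite -ler_pdivlMr.
have nk2 : n * (2 * k) <= `|a| by rewrite -ler_pdivlMr// mulr_gt0.
have ns : n ^+ 2 * s ^+ 2 / 2 <= 1 / 2.
  rewrite ler_pM2r ?invr_gt0// -exprMn expr_le1// ?mulr_ge0 ?(ltW n0) ?(ltW s0) ?(ltW mn0)//.
  rewrite (le_trans _ nk)// ler_wpM2l ?(ltW mn0)// /k.
  by have := sqr_ge0 (s - 1); have := sqr_ge0 s; nra.
have := @bnd l; rewrite ln l2 => /(_ mn0 ns).
rewrite /l mulrAC -normrEsg expr2 => h.
suff : `|a| <= n * k by nra.
by rewrite -(ler_pM2r mn0) mulrAC.
Qed.

(** * Products of independent variables *)

Section independence.
Context dO (Omega : measurableType dO) (R : realType) (P : probability Omega R).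

(** Factorisation on rectangles identifies the joint law with the product law; by Fubini the inner
    integral is then a multiple of the mean of [D]. *)
Lemma independent_mean0 (G D : Omega -> R) :
  measurable_fun setT G -> measurable_fun setT D ->
  (forall A B : set R, measurable A -> measurable B ->
    P (G @^-1` A `&` D @^-1` B) = P (G @^-1` A) * P (D @^-1` B))%E ->
  P.-integrable setT (EFin \o D) -> (\int[P]_w (D w)%:E = 0)%E ->
  P.-integrable setT (EFin \o (fun w => G w * D w)) ->
  (\int[P]_w (G w * D w)%:E = 0)%E.
Proof.
move=> mG mD ind iD D0 iGD.
pose G' : {mfun Omega >-> R} := mfun_Sub (mem_set mG).
pose D' : {mfun Omega >-> R} := mfun_Sub (mem_set mD).
have mGD : measurable_fun setT (fun w => (G w, D w) : R * R).
  exact: measurable_fun_pair.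
pose GD : {mfun Omega >-> (R * R)%type} :=
  mfun_Sub (mem_set mGD).
pose pr (z : R * R) : \bar R := (z.1 * z.2 : R)%:E.
have mpr : measurable_fun setT pr.
  by apply/measurable_EFinP; apply: measurable_funM.
have eqm A : measurable A -> (distribution P G' \x distribution P D')%E A = distribution P GD A.
  by move=> mA; apply: product_measure_unique => // B C mB mC; exact: ind.
have -> : (\int[P]_w (G w * D w)%:E = \int[distribution P GD]_z pr z)%E.
  by rewrite integral_distribution.
have -> : (\int[distribution P GD]_z pr z =
    \int[distribution P G' \x distribution P D']_z pr z)%E.
  by apply: eq_measure_integral => A mA _; exact: (esym (eqm _ mA)).
have ipr : (distribution P G' \x distribution P D')%E.-integrable setT pr.
  apply/integrableP; split => //.
  rewrite (_ : integral _ _ _ = \int[distribution P GD]_z `|pr z|)%E; last first.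
    by apply: eq_measure_integral => A mA _; exact: eqm.
  rewrite ge0_integral_distribution//; last exact: measurableT_comp.
  by case/integrableP: iGD.
rewrite -integral12_prod_meas1//.
under eq_integral => x _.
  rewrite /fubini_F /=.
  under eq_integral do rewrite /pr/= EFinM.
  rewrite integralZl//; last first.
    apply/integrableP; split; first exact/measurable_EFinP.
    rewrite ge0_integral_distribution//; last exact: measurableT_comp.
    by case/integrableP: iD.
  rewrite integral_distribution// D0 mule0.
  over.
by rewrite integral0.
Qed.

End independence.

(** * Moments and Wiener increments *)

Section finite_moments.
Context dO (Omega : measurableType dO) (R : realType) (P : probability Omega R).
Implicit Types Z Y : Omega -> R.

(** Asking for all powers at once gives a class closed under products as well as sums, so
    integrability follows from the shape of an expression. *)
Definition finite_moments Z := measurable_fun setT Z /\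
  forall p : nat, (\int[P]_w (`|Z w| ^+ p)%:E < +oo)%E.

Lemma measurable_absX Z p : measurable_fun setT Z ->
  measurable_fun setT (fun w => (`|Z w| ^+ p)%:E).
Proof.
by move=> mZ; apply/measurable_EFinP; apply: measurable_funX; exact: measurableT_comp.
Qed.

Lemma finite_moments_le Z Y : finite_moments Y -> measurable_fun setT Z ->
  (forall w, `|Z w| <= `|Y w|) -> finite_moments Z.
Proof.
move=> [mY fY] mZ ZY; split => // p; apply: le_lt_trans (fY p).
apply: ge0_le_integral => //.
- exact: measurable_absX.
- exact: measurable_absX.
- by move=> w _; rewrite lee_fin lerXn2r ?nnegrE.
Qed.

Lemma finite_moments_cst (c : R) : finite_moments (fun=> c).
Proof. by split=> // p; rewrite integral_cst//= probability_setT mule1 ltry. Qed.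

Lemma finite_momentsD Z Y : finite_moments Z -> finite_moments Y ->
  finite_moments (fun w => Z w + Y w).
Proof.
move=> [mZ fZ] [mY fY]; split => [|p]; first exact: measurable_funD.
apply: (@le_lt_trans _ _ (\int[P]_w ((2 ^+ p)%:E * ((`|Z w| ^+ p)%:E + (`|Y w| ^+ p)%:E)))%E).
  apply: ge0_le_integral => //.
  - by apply: measurable_absX; exact: measurable_funD.
  - by apply: measurable_funeM; apply: emeasurable_funD; exact: measurable_absX.
  - move=> w _; rewrite -EFinD -EFinM lee_fin (le_trans _ (powerD_le _ _ _))//.
    by rewrite lerXn2r ?nnegrE ?addr_ge0// ler_normD.
rewrite ge0_integralZl//; last 2 first.
- by apply: emeasurable_funD; exact: measurable_absX.
- by move=> w _; rewrite adde_ge0// lee_fin exprn_ge0.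
rewrite ge0_integralD//; last 2 first.
- exact: measurable_absX.
- exact: measurable_absX.
by rewrite lte_mul_pinfty ?lee_fin ?exprn_ge0// lte_add_pinfty.
Qed.

Lemma finite_momentsM Z Y : finite_moments Z -> finite_moments Y ->
  finite_moments (fun w => Z w * Y w).
Proof.
move=> [mZ fZ] [mY fY]; split => [|p]; first exact: measurable_funM.
apply: (@le_lt_trans _ _ (\int[P]_w ((`|Z w| ^+ (2 * p))%:E + (`|Y w| ^+ (2 * p))%:E))%E).
  apply: ge0_le_integral => //.
  - by apply: measurable_absX; exact: measurable_funM.
  - by apply: emeasurable_funD; exact: measurable_absX.
  - move=> w _; rewrite -EFinD lee_fin normrM exprMn !(mulnC 2) !exprM.
    have := exprn_ge0 p (normr_ge0 (Z w)); have := exprn_ge0 p (normr_ge0 (Y w)).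
    by nra.
rewrite ge0_integralD//; last 2 first.
- exact: measurable_absX.
- exact: measurable_absX.
by rewrite lte_add_pinfty.
Qed.

Lemma finite_momentsZ (c : R) Z : finite_moments Z -> finite_moments (fun w => c * Z w).
Proof. by move=> fZ; apply: finite_momentsM => //; exact: finite_moments_cst. Qed.

Lemma finite_momentsB Z Y : finite_moments Z -> finite_moments Y ->
  finite_moments (fun w => Z w - Y w).
Proof.
move=> fZ fY; apply: finite_momentsD => //.
by under eq_fun do rewrite -mulN1r; exact: finite_momentsZ.
Qed.

Lemma finite_momentsX Z n : finite_moments Z -> finite_moments (fun w => Z w ^+ n).
Proof.
move=> fZ; elim: n => [|n IH].
  by under eq_fun do rewrite expr0; exact: finite_moments_cst.
by under eq_fun do rewrite exprS; exact: finite_momentsM.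
Qed.

Lemma finite_moments_sum (I : Type) (s : seq I) (Z : I -> Omega -> R) :
  (forall i, finite_moments (Z i)) -> finite_moments (fun w => \sum_(i <- s) Z i w).
Proof.
move=> fZ; elim: s => [|i s IH].
  by under eq_fun do rewrite big_nil; exact: finite_moments_cst.
by under eq_fun do rewrite big_cons; exact: finite_momentsD.
Qed.

Lemma finite_moments_abs Z : finite_moments Z -> finite_moments (fun w => `|Z w|).
Proof.
move=> fZ; apply: (finite_moments_le fZ); last by move=> w; rewrite normr_id.
by apply: measurableT_comp => //; case: fZ.
Qed.

Lemma finite_moments_integrable Z : finite_moments Z -> P.-integrable setT (EFin \o Z).
Proof.
move=> [mZ fZ]; apply/integrableP; split; first exact/measurable_EFinP.
by have := fZ 1%N; under eq_integral do rewrite expr1.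
Qed.

Local Notation "''E' Z" := (\int[P]_w Z w)%R (at level 10, Z at level 9).

Lemma mean_EFin Z : finite_moments Z -> (\int[P]_w (Z w)%:E = ('E Z)%:E)%E.
Proof.
move=> fZ; rewrite /Rintegral fineK//.
by apply: integrable_fin_num => //; exact: finite_moments_integrable.
Qed.

Lemma mean_le Z Y : finite_moments Z -> finite_moments Y ->
  (forall w, Z w <= Y w) -> 'E Z <= 'E Y.
Proof.
move=> fZ fY ZY; apply: le_Rintegral => //; exact: finite_moments_integrable.
Qed.

Lemma mean_ge0 Z : (forall w, 0 <= Z w) -> 0 <= 'E Z.
Proof. by move=> Z0; apply: Rintegral_ge0. Qed.

Lemma meanD Z Y : finite_moments Z -> finite_moments Y ->
  'E (fun w => Z w + Y w) = 'E Z + 'E Y.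
Proof.
by move=> fZ fY; apply: RintegralD => //; exact: finite_moments_integrable.
Qed.

Lemma meanZ (c : R) Z : finite_moments Z -> 'E (fun w => c * Z w) = c * 'E Z.
Proof.
by move=> fZ; apply: RintegralZl => //; exact: finite_moments_integrable.
Qed.

Lemma meanB Z Y : finite_moments Z -> finite_moments Y ->
  'E (fun w => Z w - Y w) = 'E Z - 'E Y.
Proof.
by move=> fZ fY; apply: RintegralB => //; exact: finite_moments_integrable.
Qed.

Lemma mean_cst (c : R) : 'E (fun=> c) = c.
Proof. by rewrite Rintegral_cst//= probability_setT/= mulr1. Qed.

Lemma mean_sum (I : Type) (s : seq I) (Z : I -> Omega -> R) :
  (forall i, finite_moments (Z i)) ->
  'E (fun w => \sum_(i <- s) Z i w) = \sum_(i <- s) 'E (Z i).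
Proof.
move=> fZ; elim: s => [|i s IH].
  by rewrite big_nil; under eq_Rintegral do rewrite big_nil; exact: mean_cst.
rewrite big_cons -IH -meanD//; last exact: finite_moments_sum.
by apply: eq_Rintegral => w _; rewrite big_cons.
Qed.

Lemma mean_cauchy_schwarz Z Y : finite_moments Z -> finite_moments Y ->
  'E (fun w => Z w * Y w) ^+ 2 <= 'E (fun w => Z w ^+ 2) * 'E (fun w => Y w ^+ 2).
Proof.
move=> fZ fY; set A := 'E (fun w => Z w ^+ 2); set B := 'E (fun w => Y w ^+ 2).
set S := 'E (fun w => Z w * Y w).
have fZ2 := finite_momentsX 2 fZ; have fY2 := finite_momentsX 2 fY.
have fZY := finite_momentsM fZ fY.
have q t : 0 <= t ^+ 2 * A + 2 * t * S + B.
  rewrite /A /B /S -!meanZ// -meanD; [|exact: finite_momentsZ..].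
  rewrite -meanD//; last by apply: finite_momentsD; exact: finite_momentsZ.
  apply: mean_ge0 => w; rewrite (_ : _ + _ = (t * Z w + Y w) ^+ 2) ?sqr_ge0//.
  by ring.
have A0 : 0 <= A by apply: mean_ge0 => w; rewrite sqr_ge0.
have [A00|A00] := eqVneq A 0.
  have [->|S0] := eqVneq S 0; first by rewrite A00 mul0r expr0n.
  (* When the quadratic part vanishes, this argument gives the affine function of [t] the value
     -1. *)
  have := q (- (B + 1) / (2 * S)); rewrite A00 mulr0 add0r mul0r.
  rewrite (_ : 2 * _ * S = - (B + 1)); last by field.
  by lra.
have A1 : 0 < A by rewrite lt_neqAle eq_sym A00.
have := q (- S / A).
rewrite (_ : _ + B = (A * B - S ^+ 2) / A); last by field.
by rewrite pmulr_lge0 ?invr_gt0// subr_ge0.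
Qed.

End finite_moments.

(* Bundling the probability space lets a bound be uniform over all of them, as
   the polynomials of the theorem are chosen before the space. *)
Record noise (R : realType) (K : nat) := Noise {
  ndisp : measure_display;
  nspace : measurableType ndisp;
  nprob : probability nspace R;
  nfilt : R -> set (set nspace);
  nbeta : 'I_K -> R -> nspace -> R;
  nusual : usual_conditions nprob nfilt;
  nwiener : forall k, wiener nprob nfilt (nbeta k) }.

(** * Moments and orthogonality of Wiener increments *)

Section increments.
Variables (R : realType) (d K : nat) (sigma : 'I_K -> 'rV[R]_d) (B : noise R K).
Let P := nprob B.
Let F := @nfilt R K B.
Let b := @nbeta R K B.
Local Notation "''E' Z" := (\int[P]_w Z w)%R (at level 10, Z at level 9).

Lemma filtration_sigma t : 0 <= t ->
  sigma_algebra setT (F t) /\ F t `<=` measurable.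
Proof. by move=> t0; have [H _ _ _] := nusual B; exact: H. Qed.

Lemma beta_adapted k s t (A : set R) : 0 <= s -> s <= t -> measurable A ->
  F t (b k s @^-1` A).
Proof.
move=> s0 st mA; have [_ mono _ _] := nusual B.
have [ad _ _ _ _] := nwiener B k.
by apply: (mono s t s0 st); exact: ad.
Qed.

Lemma beta_measurable_filt k s t : 0 <= s -> s <= t ->
  measurable_fun setT (b k s : g_sigma_algebraType (F t) -> R).
Proof.
move=> s0 st _ A mA; rewrite setTI; apply: sub_sigma_algebra.
exact: beta_adapted.
Qed.

Lemma filt_measurable t dT (T : measurableType dT) (g : nspace B -> T) : 0 <= t ->
  measurable_fun setT (g : g_sigma_algebraType (F t) -> T) ->
  forall A, measurable A -> F t (g @^-1` A).
Proof.
move=> t0 mg A mA; have := mg measurableT A mA; rewrite setTI.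
by rewrite /measurable/= sigma_algebra_id//; have [] := filtration_sigma t0.
Qed.

Lemma beta_measurable k t : 0 <= t -> measurable_fun setT (b k t).
Proof.
move=> t0 _ A mA; rewrite setTI; have [_] := filtration_sigma t0; apply.
exact: (@beta_adapted k t t).
Qed.

Lemma increment_law k s t (f : measurableTypeR R -> \bar R) : 0 <= s -> s < t ->
  measurable_fun setT f -> (forall x, 0 <= f x)%E ->
  (\int[P]_w f (b k t w - b k s w)%R = \int[normal_prob 0 (Num.sqrt (t - s))]_x f x)%E.
Proof.
move=> s0 st mf f0; have t0 := le_trans s0 (ltW st).
have mD : measurable_fun setT (b k t \- b k s).
  by apply: measurable_funB; exact: beta_measurable.
have [_ _ _ law _] := nwiener B k.
pose D : nspace B -> measurableTypeR R := b k t \- b k s.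
have mD' : measurable_fun setT D by exact: mD.
rewrite -(@ge0_integral_pushforward _ _ _ _ _ _ mD' P setT f)//.
by apply: eq_measure_integral => A mA _; exact: law.
Qed.

Lemma increment_moment_lt k s t m : 0 <= s -> s < t ->
  (\int[P]_w (`|b k t w - b k s w| ^+ m)%:E <=
    (normal_moment R m * Num.sqrt (t - s) ^+ m)%:E)%E.
Proof.
move=> s0 st.
rewrite (@increment_law k s t (fun x => (`|x| ^+ m)%:E))//.
- by apply: normal_moment_le; rewrite sqrtr_gt0 subr_gt0.
- by apply: measurable_absX; exact: measurable_id.
Qed.

Lemma increment_finite k s t : 0 <= s -> s <= t ->
  finite_moments P (fun w => b k t w - b k s w).
Proof.
move=> s0; rewrite le_eqVlt => /predU1P[<-|st].
  by under eq_fun do rewrite subrr; exact: finite_moments_cst.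
split => [|m]; last by rewrite (le_lt_trans (increment_moment_lt _ _ _ _))// ltry.
by apply: measurable_funB; apply: beta_measurable => //; exact: le_trans (ltW st).
Qed.

Lemma increment_moment k s t m : 0 <= s -> s <= t ->
  'E (fun w => `|b k t w - b k s w| ^+ m) <= normal_moment R m * Num.sqrt (t - s) ^+ m.
Proof.
move=> s0 st; rewrite -lee_fin -mean_EFin; last first.
  by apply: finite_momentsX; apply: finite_moments_abs; exact: increment_finite.
move: st; rewrite le_eqVlt => /predU1P[<-|st]; last exact: increment_moment_lt.
under eq_integral do rewrite subrr normr0.
rewrite integral_cst//= probability_setT mule1 subrr sqrtr0 lee_fin.
case: m => [|m]; last by rewrite !expr0n/= mulr0.
rewrite !expr0 mulr1 /normal_moment expr0 mulr1.
by have := expR_ge1Dx (2^-1 : R); lra.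
Qed.

Lemma increment_mean0 k s t : 0 <= s -> s < t ->
  (\int[P]_w (b k t w - b k s w)%:E = 0)%E.
Proof.
move=> s0 st; have [_ _ _ law _] := nwiener B k.
have fD := increment_finite k s0 (ltW st).
pose D : nspace B -> measurableTypeR R := b k t \- b k s.
have mD : measurable_fun setT D by case: fD.
have iD : P.-integrable setT ((fun x : measurableTypeR R => x%:E) \o D).
  exact: finite_moments_integrable fD.
transitivity (\int[pushforward P D]_x (x%:E))%E.
  by rewrite (integral_pushforward mD)//; exact/measurable_EFinP.
rewrite -(normal_mean0 (s := Num.sqrt (t - s))) ?sqrtr_gt0 ?subr_gt0//.
by apply: eq_measure_integral => A mA _; exact: law.
Qed.

(** The increment is centred and independent of the past, and [G] is known at time [s]; this is the
    source of the cancellation in the noise term. *)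
Lemma increment_orthogonal k s t (G : nspace B -> R) : 0 <= s -> s <= t ->
  measurable_fun setT (G : g_sigma_algebraType (F s) -> R) -> finite_moments P G ->
  'E (fun w => G w * (b k t w - b k s w)) = 0.
Proof.
move=> s0; rewrite le_eqVlt => /predU1P[<-|st] mG fG.
  by under eq_Rintegral do rewrite subrr mulr0; exact: mean_cst.
have [_ _ _ law ind] := nwiener B k.
have fD := increment_finite k s0 (ltW st).
have fGD := finite_momentsM fG fD.
have iD := finite_moments_integrable fD.
rewrite /Rintegral independent_mean0//.
- by case: fG.
- by case: fD.
- move=> A C mA mC; apply: (ind s t s0 st) => //.
  exact: (filt_measurable s0 mG).
- exact: increment_mean0.
- exact: finite_moments_integrable.
Qed.

(* Subtracting [b k 0] makes the path start at 0 surely, not only almost surely. *)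
Definition noise_path t w : 'rV[R]_d := \sum_(k < K) (b k t w - b k 0 w) *: sigma k.

Lemma noise_path_increment s t w : noise_path t w - noise_path s w =
  \sum_(k < K) (b k t w - b k s w) *: sigma k.
Proof.
rewrite /noise_path -sumrB; apply: eq_bigr => k _; rewrite -scalerBl.
by congr (_ *: _); ring.
Qed.

(** Power mean inequality over the [K] driving processes; the added 1 makes the constant at least 1
    and settles [m = 0]. *)
Definition noise_path_moment (m : nat) : R :=
  1 + K%:R ^+ m.-1 * \sum_(k < K) (enorm (sigma k) ^+ m * normal_moment R m).

Lemma noise_path_moment_ge1 m : 1 <= noise_path_moment m.
Proof.
rewrite lerDl mulr_ge0 ?exprn_ge0//; apply: sumr_ge0 => k _.
by rewrite !mulr_ge0 ?exprn_ge0 ?enorm_ge0 ?expR_ge0.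
Qed.

Lemma measurable_noise_path t : 0 <= t ->
  measurable_fun setT (noise_path t : nspace B -> borelRd R d).
Proof.
move=> t0; apply: measurable_rV => i.
rewrite (_ : (fun w => _) = (fun w => \sum_(k < K) (b k t w - b k 0 w) * sigma k 0 i)).
  apply: measurable_sum => k; apply: measurable_funM => //.
  by apply: measurable_funB; exact: beta_measurable.
by apply/funext => w; rewrite summxE; apply: eq_bigr => k _; rewrite !mxE.
Qed.

Lemma measurable_noise_path_filt s t : 0 <= s -> s <= t ->
  measurable_fun setT (noise_path s : g_sigma_algebraType (F t) -> borelRd R d).
Proof.
move=> s0 st; apply: measurable_rV => i.
rewrite (_ : (fun w => _) = (fun w => \sum_(k < K) (b k s w - b k 0 w) * sigma k 0 i)).
  apply: measurable_sum => k; apply: measurable_funM => //.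
  by apply: measurable_funB; apply: beta_measurable_filt => //; exact: le_trans st.
by apply/funext => w; rewrite summxE; apply: eq_bigr => k _; rewrite !mxE.
Qed.

Lemma noise_path_finite s t : 0 <= s -> s <= t ->
  finite_moments P (fun w => enorm (noise_path t w - noise_path s w)).
Proof.
move=> s0 st.
apply: (@finite_moments_le _ _ _ _ _ (fun w => \sum_(k < K) enorm (sigma k) * `|b k t w - b k s w|)).
- apply: finite_moments_sum => k; apply: finite_momentsZ; apply: finite_moments_abs.
  exact: increment_finite.
- apply: measurable_enorm; apply: measurable_rVB; apply: measurable_noise_path => //.
  exact: le_trans st.
- move=> w; rewrite !ger0_norm ?enorm_ge0//; last first.
    by apply: sumr_ge0 => k _; rewrite mulr_ge0 ?enorm_ge0.
  rewrite noise_path_increment (le_trans (enorm_sum _ _ _))//.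
  by apply: ler_sum => k _; rewrite enormZ mulrC.
Qed.

Lemma noise_path_moment_le s t m : 0 <= s -> s <= t ->
  'E (fun w => enorm (noise_path t w - noise_path s w) ^+ m) <= noise_path_moment m * Num.sqrt (t - s) ^+ m.
Proof.
move=> s0 st; case: m => [|m].
  by rewrite expr0 mulr1; under eq_Rintegral do rewrite expr0; rewrite mean_cst noise_path_moment_ge1.
have fi k : finite_moments P (fun w => (enorm (sigma k) * `|b k t w - b k s w|) ^+ m.+1).
  apply: finite_momentsX; apply: finite_momentsZ; apply: finite_moments_abs.
  exact: increment_finite.
apply: (@le_trans _ _ ('E (fun w => K%:R ^+ m * \sum_(k < K)
    (enorm (sigma k) * `|b k t w - b k s w|) ^+ m.+1))).
  apply: mean_le.
  - by apply: finite_momentsX; exact: noise_path_finite.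
  - by apply: finite_momentsZ; exact: finite_moments_sum.
  - move=> w; have := @power_sum_le R _ (index_enum 'I_K)
      (fun k => enorm (sigma k) * `|b k t w - b k s w|) m.
    rewrite size_index_enum_ord => ps; apply: le_trans (ps _); last first.
      by move=> k; rewrite mulr_ge0 ?enorm_ge0.
    rewrite lerXn2r ?nnegrE ?enorm_ge0 ?sumr_ge0//.
      by move=> k _; rewrite mulr_ge0 ?enorm_ge0.
    rewrite noise_path_increment (le_trans (enorm_sum _ _ _))//.
    by apply: ler_sum => k _; rewrite enormZ mulrC.
rewrite meanZ; last exact: finite_moments_sum.
rewrite mean_sum// /noise_path_moment mulrDl mul1r.
apply: (@le_trans _ _ (K%:R ^+ m * (\sum_(k < K) (enorm (sigma k) ^+ m.+1 *
    normal_moment R m.+1)) * Num.sqrt (t - s) ^+ m.+1)); last first.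
  by rewrite lerDr exprn_ge0// sqrtr_ge0.
rewrite -mulrA mulr_suml ler_wpM2l ?exprn_ge0//; apply: ler_sum => k _.
under eq_Rintegral do rewrite exprMn.
rewrite meanZ; last first.
  by apply: finite_momentsX; apply: finite_moments_abs; exact: increment_finite.
by rewrite -mulrA ler_wpM2l ?exprn_ge0 ?enorm_ge0//; exact: increment_moment.
Qed.

End increments.
Arguments noise_path {R d K} sigma B t w.

(** * Bounds uniform in the noise and the step sizes *)

(* A parameter packs the initial condition, the coarse step and number of coarse
   steps, the index of a coarse step, the number of fine steps per coarse step
   minus one, and the index of a fine step. *)
Record params (R : realType) (d : nat) := Params {
  pstart : 'rV[R]_d; pstep : R; pcoarse : nat; pcell : nat; pfine : nat; pidx : nat }.

Definition psize (R : realType) d (p : params R d) : R :=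
  1 + enorm (pstart p) + (pcoarse p)%:R * pstep p.

Definition set_idx (R : realType) d (p : params R d) i :=
  Params (pstart p) (pstep p) (pcoarse p) (pcell p) (pfine p) i.

Section tempered.
Variables (R : realType) (d K : nat).
Implicit Types (ok : params R d -> Prop).
Implicit Types (Z Y : forall (B : noise R K), params R d -> nspace B -> R).

(** The order of quantifiers is the point: constant and degree are fixed before the noise and before
    the parameter, hence serve every probability space, step size and refinement. *)
Definition tempered ok Z :=
  (forall B p, ok p -> measurable_fun setT (Z B p)) /\
  forall a : nat, exists c k, 0 <= c /\ forall B p, ok p ->
    (\int[nprob B]_w (`|Z B p w| ^+ a)%:E <= (c * psize p ^+ k)%:E)%E.

Definition sized ok := forall p, ok p -> 1 <= psize p.

Lemma tempered_finite ok Z : tempered ok Z -> forall B p, ok p ->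
  finite_moments (nprob B) (Z B p).
Proof.
move=> [mZ tZ] B p okp; split; first exact: mZ.
by move=> a; have [c [k [_ H]]] := tZ a; apply: le_lt_trans (H B p okp) _; rewrite ltry.
Qed.

Lemma tempered_mean ok Z a : tempered ok Z -> exists c k, 0 <= c /\
  forall B p, ok p -> (\int[nprob B]_w (`|Z B p w| ^+ a))%R <= c * psize p ^+ k.
Proof.
move=> tZ; have [_ /(_ a)[c [k [c0 H]]]] := tZ; exists c, k; split => // B p okp.
rewrite -lee_fin -mean_EFin; first exact: H.
by apply: finite_momentsX; apply: finite_moments_abs; exact: tempered_finite okp.
Qed.

Lemma tempered_le ok Z Y : tempered ok Y ->
  (forall B p, ok p -> measurable_fun setT (Z B p)) ->
  (forall B p, ok p -> forall w, `|Z B p w| <= `|Y B p w|) -> tempered ok Z.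
Proof.
move=> [mY tY] mZ ZY; split => // a; have [c [k [c0 H]]] := tY a.
exists c, k; split => // B p okp; apply: le_trans (H B p okp).
apply: ge0_le_integral => //.
- by apply: measurable_absX; exact: mZ.
- by apply: measurable_absX; exact: mY.
- by move=> w _; rewrite lee_fin lerXn2r ?nnegrE// ZY.
Qed.

Lemma tempered_ext ok Z Y : tempered ok Y ->
  (forall B p, ok p -> forall w, Z B p w = Y B p w) -> tempered ok Z.
Proof.
move=> [mY tY] ZY.
have E B p : ok p -> Z B p = Y B p by move=> okp; apply/funext => w; exact: ZY.
split => [B p okp|a]; first by rewrite E//; exact: mY.
have [c [k [c0 H]]] := tY a; exists c, k; split => // B p okp.
by rewrite E//; exact: H.
Qed.

Lemma tempered_det ok (g : params R d -> R) c k : sized ok -> 0 <= c ->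
  (forall p, ok p -> `|g p| <= c * psize p ^+ k) -> tempered ok (fun B p _ => g p).
Proof.
move=> sz c0 H; split => // a; exists (c ^+ a), (k * a)%N; split; first exact: exprn_ge0.
move=> B p okp; rewrite integral_cst//= probability_setT mule1 lee_fin exprM -exprMn.
rewrite lerXn2r ?nnegrE// ?H// mulr_ge0// exprn_ge0//.
by rewrite (le_trans ler01)// sz.
Qed.

Lemma tempered_cst ok c : sized ok -> tempered ok (fun B p _ => c).
Proof.
by move=> sz; apply: (@tempered_det ok (fun=> c) `|c| 0) => // p _; rewrite expr0 mulr1.
Qed.

Let poly_add ok c1 c2 k1 k2 p : sized ok -> ok p -> 0 <= c1 -> 0 <= c2 ->
  c1 * psize p ^+ k1 + c2 * psize p ^+ k2 <= (c1 + c2) * psize p ^+ (k1 + k2).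
Proof.
move=> sz okp c10 c20; rewrite mulrDl lerD// ler_wpM2l// ler_weXn2l ?sz//.
  exact: leq_addr.
exact: leq_addl.
Qed.

Lemma temperedD ok Z Y : sized ok -> tempered ok Z -> tempered ok Y ->
  tempered ok (fun B p w => Z B p w + Y B p w).
Proof.
move=> sz tZ tY; have [mZ hZ] := tZ; have [mY hY] := tY.
split => [B p okp|a]; first by apply: measurable_funD; [exact: mZ|exact: mY].
have [c1 [k1 [c10 H1]]] := hZ a; have [c2 [k2 [c20 H2]]] := hY a.
exists (2 ^+ a * (c1 + c2)), (k1 + k2)%N; split; first by rewrite mulr_ge0 ?exprn_ge0 ?addr_ge0.
move=> B p okp.
have m1 := measurable_absX a (mZ B p okp); have m2 := measurable_absX a (mY B p okp).
apply: (@le_trans _ _ (\int[nprob B]_w ((2 ^+ a)%:E *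
    ((`|Z B p w| ^+ a)%:E + (`|Y B p w| ^+ a)%:E)))%E).
  apply: ge0_le_integral => //.
  - by apply: measurable_absX; apply: measurable_funD; [exact: mZ|exact: mY].
  - by apply: measurable_funeM; exact: emeasurable_funD.
  - move=> w _; rewrite -EFinD -EFinM lee_fin (le_trans _ (powerD_le _ _ _))//.
    by rewrite lerXn2r ?nnegrE ?addr_ge0// ler_normD.
rewrite ge0_integralZl//; last 2 first.
- exact: emeasurable_funD.
- by move=> w _; rewrite adde_ge0// lee_fin exprn_ge0.
rewrite ge0_integralD// -mulrA EFinM lee_wpmul2l ?lee_fin ?exprn_ge0//.
apply: le_trans (leeD (H1 B p okp) (H2 B p okp)) _.
by rewrite -EFinD lee_fin; exact: poly_add okp _ _.
Qed.

Lemma temperedM ok Z Y : sized ok -> tempered ok Z -> tempered ok Y ->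
  tempered ok (fun B p w => Z B p w * Y B p w).
Proof.
move=> sz tZ tY; have [mZ hZ] := tZ; have [mY hY] := tY.
split => [B p okp|a]; first by apply: measurable_funM; [exact: mZ|exact: mY].
have [c1 [k1 [c10 H1]]] := hZ (2 * a)%N; have [c2 [k2 [c20 H2]]] := hY (2 * a)%N.
exists (c1 + c2), (k1 + k2)%N; split; first exact: addr_ge0.
move=> B p okp.
have m1 := measurable_absX (2 * a) (mZ B p okp); have m2 := measurable_absX (2 * a) (mY B p okp).
apply: (@le_trans _ _ (\int[nprob B]_w
    ((`|Z B p w| ^+ (2 * a))%:E + (`|Y B p w| ^+ (2 * a))%:E))%E).
  apply: ge0_le_integral => //.
  - by apply: measurable_absX; apply: measurable_funM; [exact: mZ|exact: mY].
  - exact: emeasurable_funD.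
  - move=> w _; rewrite -EFinD lee_fin normrM exprMn !(mulnC 2) !exprM.
    have := exprn_ge0 a (normr_ge0 (Z B p w)); have := exprn_ge0 a (normr_ge0 (Y B p w)).
    by nra.
rewrite ge0_integralD//.
apply: le_trans (leeD (H1 B p okp) (H2 B p okp)) _.
by rewrite -EFinD lee_fin; exact: poly_add okp _ _.
Qed.

Lemma temperedX ok Z n : sized ok -> tempered ok Z ->
  tempered ok (fun B p w => Z B p w ^+ n).
Proof.
move=> sz tZ; elim: n => [|n IH].
  by apply: tempered_ext (tempered_cst 1 sz) _ => B p _ w; rewrite expr0.
by apply: tempered_ext (temperedM sz tZ IH) _ => B p _ w; rewrite exprS.
Qed.

(** Parameters whose fine index runs below [cnt]: a bound on this set is uniform over the terms of
    an average. *)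
Definition indexed ok (cnt : params R d -> nat) p :=
  exists q i, [/\ ok q, (i < cnt q)%N & p = set_idx q i].

Lemma sized_indexed ok cnt : sized ok -> sized (indexed ok cnt).
Proof. by move=> sz _ [p [i [okp _ ->]]]; exact: sz okp. Qed.

Lemma tempered_indexed ok Z cnt : tempered ok Z ->
  (forall B p i w, Z B (set_idx p i) w = Z B p w) -> tempered (indexed ok cnt) Z.
Proof.
move=> [mZ tZ] ZE.
have E B p i : Z B (set_idx p i) = Z B p by apply/funext => w; exact: ZE.
split => [B _ [p [i [okp _ ->]]]|a]; first by rewrite E; exact: mZ.
have [c [k [c0 H]]] := tZ a; exists c, k; split => // B _ [p [i [okp _ ->]]].
by rewrite E; exact: H.
Qed.

(** By Jensen a moment of an average is at most the average of the moments, so the number of terms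
    leaves no trace. *)
Lemma tempered_avg ok' Z (cnt : params R d -> nat) : sized ok' ->
  tempered (indexed ok' cnt) Z ->
  tempered ok' (fun B p w => (cnt p)%:R^-1 * \sum_(i < cnt p) Z B (set_idx p i) w).
Proof.
move=> sz [mZ hZ].
have okk p i : ok' p -> (i < cnt p)%N -> indexed ok' cnt (set_idx p i).
  by move=> okp ic; exists p, i.
split => [B p okp|a].
  apply: measurable_funM => //; apply: measurable_sum => i.
  by apply: mZ; apply: okk.
case: a => [|a].
  exists 1, 0%N; split => // B p okp; under eq_integral do rewrite expr0.
  by rewrite integral_cst//= probability_setT mule1 expr0 mulr1.
have [c [k [c0 H]]] := hZ a.+1; exists c, k; split => // B p okp.
have p0 : 0 <= psize p by rewrite (le_trans ler01)// sz.
set n := cnt p; have n0 : 0 <= n%:R^-1 :> R by rewrite invr_ge0.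
have mi (i : 'I_n) := measurable_absX a.+1 (mZ B _ (okk p i okp (ltn_ord i))).
apply: (@le_trans _ _ (\int[nprob B]_w (n%:R^-1%:E *
    (\sum_(i < n) (`|Z B (set_idx p i) w| ^+ a.+1)%:E)))%E).
  apply: ge0_le_integral => //.
  - apply: measurable_absX; apply: measurable_funM => //; apply: measurable_sum => i.
    by apply: mZ; apply: okk.
  - by apply: measurable_funeM; apply: emeasurable_sum => i _; exact: mi.
  - move=> w _; rewrite sumEFin -EFinM lee_fin.
    have := @power_mean_le R n n%:R^-1 (fun i => `|Z B (set_idx p i) w|) a n0 (fun i => normr_ge0 _).
    (* At [n = 0] the inverse is 0 and the product is 0, hence an inequality. *)
    have nn : (n%:R * n%:R^-1) ^+ a <= 1 :> R.
      rewrite exprn_ile1 ?mulr_ge0//; have [->|n1] := eqVneq n 0%N; first by rewrite mul0r.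
      by rewrite divff// pnatr_eq0.
    move=> pm; apply: (@le_trans _ _ ((n%:R^-1 * \sum_(i < n) `|Z B (set_idx p i) w|) ^+ a.+1)).
      rewrite lerXn2r ?nnegrE// ?mulr_ge0 ?sumr_ge0//.
      by rewrite normrM ger0_norm// ler_wpM2l// ler_norm_sum.
    by apply: le_trans pm _; rewrite ler_piMl// mulr_ge0// sumr_ge0.
rewrite ge0_integralZl//; last 2 first.
- by apply: emeasurable_sum => i _; exact: mi.
- by move=> w _; apply: sume_ge0 => i _; rewrite lee_fin exprn_ge0.
rewrite ge0_integral_sum//.
apply: (@le_trans _ _ (n%:R^-1%:E * \sum_(i < n) (c * psize p ^+ k)%:E)%E).
  rewrite lee_wpmul2l ?lee_fin//; apply: lee_sum => i _.
  exact: (H B (set_idx p i) (okk p i okp (ltn_ord i))).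
rewrite sumEFin -EFinM lee_fin sumr_const card_ord -[(c * _) *+ n]mulr_natl [leLHS]mulrA.
have [->|n1] := eqVneq n 0%N; first by rewrite mulr0 mul0r mulr_ge0 ?exprn_ge0.
by rewrite mulVf ?mul1r// pnatr_eq0.
Qed.

Variable sigma : 'I_K -> 'rV[R]_d.

Lemma tempered_path ok (tm : params R d -> R) : sized ok ->
  (forall p, ok p -> 0 <= tm p /\ tm p <= psize p) ->
  tempered ok (fun B p w => enorm (noise_path sigma B (tm p) w)).
Proof.
move=> sz H.
have path0 (B : noise R K) w : noise_path sigma B 0 w = 0.
  by rewrite /noise_path big1// => k _; rewrite subrr scale0r.
split => [B p /H[t0 _]|a]; first by apply: measurable_enorm; exact: measurable_noise_path.
exists (noise_path_moment sigma a), a; split; first by rewrite (le_trans ler01)// noise_path_moment_ge1.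
move=> B p okp; have [t0 tp] := H p okp; have p1 := sz p okp.
have := noise_path_moment_le sigma B a (lexx 0) t0; rewrite subr0.
rewrite -lee_fin -mean_EFin; last by apply: finite_momentsX; exact: noise_path_finite.
under eq_integral do rewrite path0 subr0 -[enorm _]ger0_norm ?enorm_ge0//.
move=> /le_trans; apply; rewrite lee_fin ler_wpM2l//.
  by rewrite (le_trans ler01)// noise_path_moment_ge1.
have p0 := le_trans ler01 p1.
rewrite lerXn2r ?nnegrE ?sqrtr_ge0// (le_trans (ler_wsqrtr tp))//.
by rewrite -[leRHS](ger0_norm p0) -sqrtr_sqr ler_wsqrtr// expr2 ler_peMr.
Qed.

(** The 2a-th moment of the increment is of order [pstep p ^+ a], which the normalisation cancels
    exactly; the degree is therefore 0. *)
Lemma tempered_increment ok (s t : params R d -> R) : sized ok ->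
  (forall p, ok p -> [/\ 0 <= s p, s p <= t p, t p - s p <= pstep p & 0 < pstep p]) ->
  tempered ok (fun B p w =>
    enorm (noise_path sigma B (t p) w - noise_path sigma B (s p) w) ^+ 2 / pstep p).
Proof.
move=> sz H; split => [B p /H[s0 st _ _]|a].
  apply: measurable_funM => //; apply: measurable_funX; apply: measurable_enorm.
  by apply: measurable_rVB; apply: measurable_noise_path => //; exact: le_trans st.
exists (noise_path_moment sigma (2 * a)), 0%N.
split; first by rewrite (le_trans ler01)// noise_path_moment_ge1.
move=> B p okp; have [s0 st tsd d0] := H p okp; rewrite expr0 mulr1.
have fin := noise_path_finite sigma B s0 st.
have e w : (`|enorm (noise_path sigma B (t p) w - noise_path sigma B (s p) w) ^+ 2 / pstep p| ^+ a)
    = (pstep p ^+ a)^-1 * enorm (noise_path sigma B (t p) w - noise_path sigma B (s p) w) ^+ (2 * a).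
  by rewrite ger0_norm ?divr_ge0 ?sqr_ge0 ?(ltW d0)// exprMn exprM exprVn mulrC.
under eq_integral do rewrite e.
rewrite mean_EFin; last by apply: finite_momentsZ; exact: finite_momentsX.
rewrite lee_fin meanZ; last exact: finite_momentsX.
rewrite ler_pdivrMl ?exprn_gt0// mulrC.
apply: le_trans (noise_path_moment_le sigma B (2 * a) s0 st) _.
rewrite ler_wpM2l//; first by rewrite (le_trans ler01)// noise_path_moment_ge1.
rewrite exprM sqr_sqrtr ?subr_ge0// lerXn2r ?nnegrE ?subr_ge0//.
exact: ltW.
Qed.

End tempered.

(** * Strong error between two step sizes *)

Section strong_error.
Variables (R : realType) (d K : nat) (f : 'rV[R]_d -> 'rV[R]_d)
  (sigma : 'I_K -> 'rV[R]_d) (alpha gamma C dt0 : R) (q : nat).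
Hypotheses (alpha_gt0 : 0 < alpha) (gamma_gt0 : 0 < gamma) (C_ge1 : 1 <= C).
Hypothesis f_C2 : class_C2 f.
Hypothesis f_diss : forall x1 x2 : 'rV[R]_d,
  inner (f x2 - f x1) (x2 - x1) <= - gamma * enorm (x2 - x1) ^+ 2.
Hypothesis f_growth : drift_growth C q f.


(** The Riemann sum is the horizon, controlled by [psize], times an average over the grid. *)
Lemma tempered_path_size ok (h : params R d -> R) (cnt : params R d -> nat) a :
  sized ok -> (forall p, ok p -> 0 <= h p) ->
  (forall p, ok p -> (cnt p)%:R * h p <= psize p) ->
  (forall p i, h (set_idx p i) = h p) -> (forall p, ok p -> 0 <= pstep p) ->
  tempered ok (fun (B : noise R K) p w =>
    path_size (h p) (fun i => noise_path sigma B (i%:R * h p) w) (pstart p) (cnt p) a).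
Proof.
move=> sz h0 ch hi st0.
pose Z (B : noise R K) p w := (1 + enorm (noise_path sigma B ((pidx p)%:R * h p) w)) ^+ a.
have szi : sized (indexed ok cnt) by exact: sized_indexed.
have tZ : tempered (indexed ok cnt) Z.
  apply: temperedX => //; apply: temperedD => //; first exact: tempered_cst.
  apply: tempered_path => // _ [p [i [okp ic ->]]]; rewrite hi /=.
  split; first by rewrite mulr_ge0// h0.
  by rewrite (le_trans _ (ch p okp))// ler_wpM2r ?h0// ler_nat ltnW.
have tH : tempered ok (fun (B : noise R K) p w => 1 + enorm (pstart p) + (cnt p)%:R * h p).
  apply: (@tempered_det _ _ _ _ _ 2 1) => //; move=> p okp; rewrite expr1.
  have c0 := mulr_ge0 (ler0n R (cnt p)) (h0 p okp); have x0 := enorm_ge0 (pstart p).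
  have sp := sz p okp; rewrite ger0_norm; last by rewrite !addr_ge0.
  have := ch p okp; have := mulr_ge0 (ler0n R (pcoarse p)) (st0 p okp).
  by rewrite /psize; lra.
have tC : tempered ok (fun (B : noise R K) p w => (cnt p)%:R * h p).
  apply: (@tempered_det _ _ _ _ _ 1 1) => // p okp; rewrite expr1 mul1r.
  by rewrite ger0_norm ?ch// mulr_ge0// h0.
have tS := temperedD sz tH (temperedM sz tC (tempered_avg sz tZ)).
apply: tempered_ext tS _ => B p okp w; rewrite /path_size; congr (_ + _).
have -> : \sum_(j < cnt p) (1 + enorm (noise_path sigma B (j%:R * h p) w)) ^+ a
    = \sum_(i < cnt p) Z B (set_idx p i) w.
  by apply: eq_bigr => i _; rewrite /Z hi.
have [->|n0] := eqVneq (cnt p) 0%N; first by rewrite big_ord0 !mulr0.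
by rewrite mulrA [_ * h p]mulrC mulfK// pnatr_eq0.
Qed.

(** Equality of cell and number of cells is allowed so that the envelope also covers the final
    time. *)
Definition admissible (p : params R d) :=
  [/\ 0 < pstep p, pstep p <= dt0 & (pcell p <= pcoarse p)%N].

Lemma sized_admissible : sized admissible.
Proof.
move=> p [h0 _ _]; rewrite /psize -addrA lerDl addr_ge0 ?enorm_ge0//.
by rewrite mulr_ge0// ltW.
Qed.

Definition fine_step (p : params R d) := pstep p / (pfine p).+1%:R.
Definition coarse_time (p : params R d) := (pcell p)%:R * pstep p.
Definition fine_index (p : params R d) := (pcell p * (pfine p).+1 + pidx p)%N.
Definition fine_time (p : params R d) := (fine_index p)%:R * fine_step p.

Lemma fine_step_coarse p n : (n * (pfine p).+1)%:R * fine_step p = n%:R * pstep p.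
Proof.
by rewrite /fine_step natrM mulrACA -[X in _ * X = _]mulrC -mulrA; field.
Qed.

Definition scheme_path (B : noise R K) h w (i : nat) := noise_path sigma B (i%:R * h) w.
Arguments scheme_path B h w i : clear implicits.

Definition scheme (B : noise R K) h x0 n w :=
  tamed_path f alpha h (scheme_path B h w) x0 n.
Arguments scheme B h x0 n w : clear implicits.

Definition scheme_size (B : noise R K) h x0 N w :=
  moment_const alpha C gamma q *
    path_size h (scheme_path B h w) x0 N (4 * q) ^+ (8 * q + 2).
Arguments scheme_size B h x0 N w : clear implicits.

Lemma scheme_le (B : noise R K) h x0 N n w : 0 < h -> (n <= N)%N ->
  enorm (scheme B h x0 n w - noise_path sigma B (n%:R * h) w)
    <= scheme_size B h x0 N w.
Proof.
move=> h0 nN; have [f_poly _ _ _] := f_growth.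
apply: (tamed_path_bound alpha_gt0 C_ge1 gamma_gt0 f_poly f_diss x0 h0 _ nN).
by rewrite /scheme_path mul0r /noise_path big1// => k _; rewrite subrr scale0r.
Qed.

(** Dominates the coarse and the fine scheme at the start of a cell; inside the cell the noise
    increment since that start is added. *)
Definition envelope (B : noise R K) p w :=
  scheme_size B (pstep p) (pstart p) (pcoarse p) w
  + scheme_size B (fine_step p) (pstart p) (pcoarse p * (pfine p).+1) w
  + enorm (noise_path sigma B (coarse_time p) w).
Arguments envelope B p w : clear implicits.

Lemma tempered_envelope : tempered admissible envelope.
Proof.
have sz := sized_admissible.
have szc (p : params R d) : (pcoarse p)%:R * pstep p <= psize p.
  by rewrite /psize lerDr addr_ge0 ?enorm_ge0.
apply: temperedD => //; last first.
  apply: tempered_path => // p [h0 _ nN]; rewrite /coarse_time; split.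
    by rewrite mulr_ge0// ltW.
  by rewrite (le_trans _ (szc p))// ler_wpM2r ?(ltW h0)// ler_nat.
apply: temperedD => //; apply: temperedM => //; try exact: tempered_cst.
  apply: temperedX => //; apply: tempered_path_size => // p [h0 _ _]; exact: ltW.
apply: temperedX => //.
apply: (@tempered_path_size _ fine_step (fun p => pcoarse p * (pfine p).+1)%N) => // p [h0 _ _].
- by rewrite divr_ge0// ltW.
- by rewrite fine_step_coarse.
- exact: ltW.
Qed.

Definition block_noise (B : noise R K) p w :=
  noise_path sigma B (fine_time p) w - noise_path sigma B (coarse_time p) w.
Arguments block_noise B p w : clear implicits.

(** This is [th] of the block estimate, with [G] taken as the envelope plus the noise increment. *)
Definition block_weight (B : noise R K) p w :=
  (C * (1 + 2 * (envelope B p w + enorm (block_noise B p w))) ^+ q) ^+ 3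
  * (1 + enorm (block_noise B p w) ^+ 2 / pstep p).
Arguments block_weight B p w : clear implicits.

Definition block_factor (B : noise R K) p w :=
  block_const alpha dt0 * ((pfine p).+1%:R^-1 *
    \sum_(i < (pfine p).+1) block_weight B (set_idx p i) w) ^+ 6.
Arguments block_factor B p w : clear implicits.

Lemma fine_time_ge p : 0 < pstep p -> 0 <= coarse_time p /\ coarse_time p <= fine_time p.
Proof.
move=> h0; split; first by rewrite mulr_ge0// ltW.
rewrite /coarse_time -fine_step_coarse /fine_time ler_wpM2r//.
  by rewrite divr_ge0// ltW.
by rewrite ler_nat leq_addr.
Qed.

Lemma tempered_block_factor : tempered admissible block_factor.
Proof.
have sz := sized_admissible.
apply: temperedM => //; first exact: tempered_cst.
apply: temperedX => //; apply: (@tempered_avg _ _ _ _ block_weight (fun p => (pfine p).+1)) => //.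
set ok := indexed _ _; have szi : sized ok by exact: sized_indexed.
have okT p : ok p -> [/\ 0 < pstep p, pstep p <= dt0,
    0 <= coarse_time p /\ coarse_time p <= fine_time p & fine_time p - coarse_time p <= pstep p].
  move=> [{}p [i [[h0 hd nN] im ->]]] /=; split => //; first exact: fine_time_ge.
  rewrite /coarse_time -(fine_step_coarse (set_idx p i)) /fine_time -mulrBl /fine_index/=.
  rewrite natrD addrC addKr /fine_step/= mulrA ler_pdivrMr// mulrC ler_wpM2l ?(ltW h0)//.
  by rewrite ler_nat ltnW.
have tE : tempered ok envelope by apply: tempered_indexed => //; exact: tempered_envelope.
have tU : tempered ok (fun B p w => enorm (block_noise B p w) ^+ 2 / pstep p).
  by apply: tempered_increment => // p /okT[? _ [? ?] ?].
(* From e <= 1 + e^2 and [pstep p <= dt0], the normalised square controls the increment itself. *)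
have tN : tempered ok (fun B p w => enorm (block_noise B p w)).
  have tY := temperedD szi (tempered_cst K 1 szi) (temperedM szi (tempered_cst K dt0 szi) tU).
  apply: (tempered_le tY) => [B p /okT[_ _ [c0 cf] _]|B p okp w].
    apply: measurable_enorm; apply: measurable_rVB; apply: measurable_noise_path => //.
    exact: le_trans cf.
  have [h0 hd _ _] := okT p okp; set e := enorm _.
  have e2 : e ^+ 2 <= dt0 * (e ^+ 2 / pstep p).
    by rewrite mulrA ler_pdivlMr// mulrC ler_wpM2r ?sqr_ge0.
  have := sqr_ge0 (e - 1); have := sqr_ge0 e; rewrite !ger0_norm ?enorm_ge0//.
    by nra.
  by rewrite addr_ge0// (le_trans _ e2)// sqr_ge0.
apply: temperedM => //; last by apply: temperedD => //; exact: tempered_cst.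
apply: temperedX => //; apply: temperedM => //; first exact: tempered_cst.
apply: temperedX => //; apply: temperedD => //; first exact: tempered_cst.
by apply: temperedM => //; [exact: tempered_cst|exact: temperedD].
Qed.


(** * Mean square recursion over the coarse steps *)

Section one_step.
Variables (B : noise R K) (x0 : 'rV[R]_d) (dt : R) (N M : nat).
Hypotheses (dt_gt0 : 0 < dt) (dt_le : dt <= dt0).

Let p n := Params x0 dt N n M 0.
Let h := dt / M.+1%:R.

Definition scheme_error n w :=
  scheme B h x0 (n * M.+1) w - scheme B dt x0 n w.

Definition drift_error n w := scheme_error n w
  + dt *: (f (scheme B h x0 (n * M.+1) w) - f (scheme B dt x0 n w)).

Definition noise_error n w := D1 f (scheme B h x0 (n * M.+1) w)
  (h *: \sum_(j < M.+1) block_noise B (set_idx (p n) j) w).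

Lemma step_gt0 : 0 < h. Proof. exact: divr_gt0. Qed.

Lemma block_time k : (k * M.+1)%:R * h = k%:R * dt.
Proof. exact: (fine_step_coarse (p 0) k). Qed.

Lemma scheme_envelope n j w : (n <= N)%N -> (n * M.+1 + j <= N * M.+1)%N ->
  enorm (scheme B dt x0 n w) <= envelope B (p n) w /\
  enorm (scheme B h x0 (n * M.+1 + j) w)
    <= envelope B (p n) w + enorm (block_noise B (set_idx (p n) j) w).
Proof.
move=> nN jN; have Hc := scheme_le x0 w dt_gt0 nN; have Hf := scheme_le x0 w step_gt0 jN.
have s0 h' N' w' : 0 < h' -> 0 <= scheme_size B h' x0 N' w'.
  by move=> ?; exact: le_trans (enorm_ge0 _) (scheme_le x0 w' _ (leqnn N')).
have c0 := s0 _ N w dt_gt0; have f0 := s0 _ (N * M.+1)%N w step_gt0.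
have tri (u v : 'rV[R]_d) : enorm u <= enorm (u - v) + enorm v.
  by rewrite -[X in enorm X <= _](subrK v); exact: enormD.
have := tri (scheme B dt x0 n w) (noise_path sigma B (n%:R * dt) w).
have := tri (scheme B h x0 (n * M.+1 + j) w)
  (noise_path sigma B ((n * M.+1 + j)%:R * h) w).
have := tri (noise_path sigma B ((n * M.+1 + j)%:R * h) w)
  (noise_path sigma B (n%:R * dt) w).
rewrite /envelope /block_noise /coarse_time /fine_time /fine_index /fine_step/= -/h.
by move: Hc Hf c0 f0; lra.
Qed.

Lemma scheme_block n w : (n < N)%N ->
  enorm (scheme_error n.+1 w) ^+ 2 <= enorm (scheme_error n w) ^+ 2
    + dt ^+ 2 * (block_factor B (p n) w * enorm (scheme_error n w))
    + 2 * inner (drift_error n w) (noise_error n w)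
    + dt ^+ 3 * block_factor B (p n) w.
Proof.
move=> nN; have [f_diff _ _] := f_C2.
pose y j := scheme B h x0 (n * M.+1 + j) w.
pose dw j := block_noise B (set_idx (p n) j) w.
pose G j := envelope B (p n) w + enorm (dw j).
have dw0 : dw 0%N = 0.
  by rewrite /dw /block_noise /fine_time /fine_index/= addn0 block_time subrr.
have yE j : y j = y 0%N + h *: \sum_(i < j) tamed f alpha h (y i) + dw j.
  elim: j => [|j IH]; first by rewrite big_ord0 scaler0 dw0 !addr0.
  rewrite big_ord_recr/= /y addnS /scheme /= -/(scheme B h x0 _ w) -/(y j).
  rewrite {1}IH scalerDr.
  have -> : dw j.+1 = dw j + (scheme_path B h w (n * M.+1 + j).+1 - scheme_path B h w (n * M.+1 + j)).
    rewrite /dw /block_noise /fine_time /fine_index/= addnS /scheme_path /coarse_time/=.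
    rewrite /fine_step/= -/h.
    move: (noise_path sigma B ((n * M.+1 + j).+1%:R * h) w)
      (noise_path sigma B ((n * M.+1 + j)%:R * h) w) => u v.
    by apply/rowP => i; rewrite !mxE; ring.
  rewrite -/(scheme B h x0 (n * M.+1 + 0) w) -/(y 0%N).
  move: (y 0%N) (\sum_(i < j) _) (tamed f alpha h (y j)) (dw j)
    (scheme_path B h w (n * M.+1 + j).+1) (scheme_path B h w (n * M.+1 + j)) => *.
  by apply/rowP => i; rewrite !mxE; ring.
have x_le : enorm (scheme B dt x0 n w) <= G 0%N.
  rewrite /G dw0 enorm0 addr0; have [] // := @scheme_envelope n 0 w (ltnW nN).
  by rewrite addn0 leq_mul2r ltnW ?orbT.
have y_le j : (j < M.+1)%N -> enorm (y j) <= G j.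
  move=> jM; have [|_ ->] // := @scheme_envelope n j w (ltnW nN).
  by rewrite (leq_trans (_ : _ <= n.+1 * M.+1)%N) ?leq_mul2r ?nN ?orbT// mulSnr leq_add2l ltnW.
have G_min j : G 0%N <= G j by rewrite /G dw0 enorm0 lerD2l enorm_ge0.
have := block_error alpha_gt0 gamma_gt0 C_ge1 f_diff f_diss f_growth dt_gt0 dt_le
  yE x_le G_min y_le.
rewrite /y addn0 -/(scheme_error n w); congr (_ ^+ 2 <= _).
rewrite /scheme_error mulSnr; congr (enorm (_ - _)).
rewrite {2}/scheme/= -/(scheme B dt x0 n w); congr (_ + _).
rewrite /dw /block_noise /fine_time /fine_index/= -mulSnr block_time.
by [].
Qed.


Local Notation "''E' Z" := (\int[nprob B]_w Z w)%R (at level 10, Z at level 9).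

Let f_cont : continuous f.
Proof. by move=> x; have [df _ _] := f_C2; exact/differentiable_continuous/df. Qed.

Lemma measurable_drift_weight d' (T : measurableType d') (u v : T -> borelRd R d) s :
  measurable_fun setT u -> measurable_fun setT v ->
  measurable_fun setT (fun t => inner (u t - v t + dt *: (f (u t) - f (v t))) (D1 f (u t) s)).
Proof.
move=> mu mv; have mf (g : T -> borelRd R d) : measurable_fun setT g ->
    measurable_fun setT (fun t => f (g t) : borelRd R d).
  move=> mg; apply: (@continuous_measurable_rV_comp R d _ T f g) => // i.
  exact: continuous_coord_comp.
apply: measurable_inner.
  apply: measurable_rVD; first exact: measurable_rVB.
  by apply: measurable_rVZ; apply: measurable_rVB; exact: mf.
apply: (@continuous_measurable_rV_comp R d _ T (fun x => D1 f x s) u) => // i.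
apply: continuous_coord_comp => x; have [_ ddf _] := f_C2.
exact: differentiable_continuous (ddf s x).
Qed.

Lemma measurable_scheme h' n : 0 <= h' ->
  measurable_fun setT (scheme B h' x0 n : nspace B -> borelRd R d).
Proof.
move=> h0; apply: (@measurable_tamed_path R d f alpha h' _ (nspace B)
    (fun j w => scheme_path B h' w j) (fun=> x0) n) => //; first exact: ltW.
by move=> j _; apply: measurable_noise_path; rewrite mulr_ge0.
Qed.

Lemma measurable_scheme_filt h' n t : 0 <= h' -> n%:R * h' <= t ->
  measurable_fun setT (scheme B h' x0 n : g_sigma_algebraType (@nfilt R K B t) -> borelRd R d).
Proof.
move=> h0 nt; apply: (@measurable_tamed_path R d f alpha h' _
    (g_sigma_algebraType (@nfilt R K B t))
    (fun j w => scheme_path B h' w j) (fun=> x0) n) => //; first exact: ltW.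
move=> j jn; apply: measurable_noise_path_filt; first by rewrite mulr_ge0.
by rewrite (le_trans _ nt)// ler_wpM2r// ler_nat.
Qed.

(** Coefficient of the [k]-th Wiener increments in the cross term: a function of the two schemes at
    time [n%:R * dt], hence known at the start of the block. *)
Let weight n k w := inner (drift_error n w) (D1 f (scheme B h x0 (n * M.+1) w) (sigma k)).

Lemma scheme_envelope0 n w : (n <= N)%N ->
  enorm (scheme B dt x0 n w) <= envelope B (p n) w /\
  enorm (scheme B h x0 (n * M.+1) w) <= envelope B (p n) w.
Proof.
move=> nN; have [|] := @scheme_envelope n 0 w nN; first by rewrite addn0 leq_mul2r nN orbT.
by rewrite /block_noise /fine_time /fine_index/= addn0 block_time subrr enorm0 addr0.
Qed.

Let E_finite n : (n <= N)%N -> finite_moments (nprob B) (envelope B (p n)).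
Proof. by move=> nN; apply: tempered_finite tempered_envelope B (p n) _. Qed.

Lemma scheme_error_finite n : (n <= N)%N ->
  finite_moments (nprob B) (fun w => enorm (scheme_error n w)).
Proof.
move=> nN; apply: (finite_moments_le (finite_momentsZ 2 (E_finite nN))).
  apply: measurable_enorm; apply: measurable_rVB; apply: measurable_scheme.
    exact: ltW step_gt0.
  exact: ltW.
move=> w; have [c f'] := scheme_envelope0 w nN.
rewrite ger0_norm ?enorm_ge0// (le_trans _ (ler_norm _))//.
by rewrite (le_trans (enormB _ _))//; lra.
Qed.

Lemma weight_finite n k : (n <= N)%N -> finite_moments (nprob B) (weight n k).
Proof.
move=> nN; have fE := E_finite nN; have fC := finite_moments_cst (nprob B).
have fP := finite_momentsZ C (finite_momentsX q (finite_momentsD (fC 1) fE)).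
apply: (finite_moments_le (finite_momentsM
  (finite_momentsD (finite_momentsZ 2 fE) (finite_momentsZ (2 * dt) fP))
  (finite_momentsM fP (fC (enorm (sigma k)))))).
  apply: measurable_drift_weight; apply: measurable_scheme.
    exact: ltW step_gt0.
  exact: ltW.
move=> w; have [f_poly _ _ f_D] := f_growth; have [c f'] := scheme_envelope0 w nN.
apply: le_trans (inner_norm_le _ _) (le_trans _ (ler_norm _)).
have C0 : 0 <= C by exact: le_trans ler01 _.
set A := C * (1 + envelope B (p n) w) ^+ q.
have up (u : 'rV[R]_d) : enorm u <= envelope B (p n) w -> C * (1 + enorm u) ^+ q <= A.
  move=> uE; have u0 := enorm_ge0 u; have E0 := le_trans u0 uE.
  by rewrite ler_wpM2l// lerXn2r ?nnegrE ?lerD2l// (addr_ge0 ler01).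
apply: ler_pM; rewrite ?enorm_ge0//.
  apply: le_trans (enormD _ _) _; apply: lerD.
    by rewrite (le_trans (enormB _ _))//; lra.
  rewrite enormZ gtr0_norm// -mulrA mulrCA ler_pM2l//.
  apply: le_trans (enormB _ _) _.
  have := le_trans (f_poly _) (up _ c); have := le_trans (f_poly _) (up _ f').
  by lra.
by apply: le_trans (f_D _ _) _; rewrite ler_wpM2r ?enorm_ge0// up.
Qed.

Let incr n j k w :=
  @nbeta R K B k (fine_time (set_idx (p n) j)) w - @nbeta R K B k (n%:R * dt) w.

Let times n j : 0 <= n%:R * dt /\ n%:R * dt <= fine_time (set_idx (p n) j).
Proof. exact: (@fine_time_ge (set_idx (p n) j)). Qed.

Lemma noise_error_expand n w : inner (drift_error n w) (noise_error n w) =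
  h * \sum_(j < M.+1) \sum_(k < K) weight n k w * incr n j k w.
Proof.
have [df _ _] := f_C2; rewrite /noise_error D1_scale// innerZr; congr (_ * _).
rewrite D1_sum// inner_sumr; apply: eq_bigr => j _.
rewrite /block_noise noise_path_increment D1_sum// inner_sumr; apply: eq_bigr => k _.
by rewrite D1_scale// innerZr mulrC.
Qed.

Let incr_finite n j k : (n <= N)%N ->
  finite_moments (nprob B) (fun w => weight n k w * incr n j k w).
Proof.
move=> nN; have [t0 tt] := times n j.
by apply: finite_momentsM; [exact: weight_finite|exact: increment_finite].
Qed.

Lemma noise_error_finite n : (n <= N)%N ->
  finite_moments (nprob B) (fun w => inner (drift_error n w) (noise_error n w)).
Proof.
move=> nN; under eq_fun do rewrite noise_error_expand.
apply: finite_momentsZ; apply: finite_moments_sum => j.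
by apply: finite_moments_sum => k; exact: incr_finite.
Qed.

(** Linearity of the derivative in its direction reduces the cross term to scalar increments, each
    starting at the time when its weight is known. *)
Lemma noise_error_mean0 n : (n <= N)%N ->
  'E (fun w => inner (drift_error n w) (noise_error n w)) = 0.
Proof.
move=> nN; under eq_Rintegral do rewrite noise_error_expand.
rewrite meanZ; last first.
  by apply: finite_moments_sum => j; apply: finite_moments_sum => k; exact: incr_finite.
rewrite mean_sum; last by move=> j; apply: finite_moments_sum => k; exact: incr_finite.
rewrite big1 ?mulr0// => j _; rewrite mean_sum; last by move=> k; exact: incr_finite.
rewrite big1// => k _; have [t0 tt] := times n j.
apply: increment_orthogonal => //; last exact: weight_finite.
apply: (@measurable_drift_weight _ (g_sigma_algebraType (@nfilt R K B (n%:R * dt)))).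
  apply: measurable_scheme_filt; first exact: ltW step_gt0.
  by rewrite block_time.
by apply: measurable_scheme_filt => //; exact: ltW.
Qed.

Let e2 n := 'E (fun w => enorm (scheme_error n w) ^+ 2).

(** The error enters linearly, so Cauchy-Schwarz separates it from the random factor. As [1 <= L], a
    second moment below [L] puts both the mean and the root mean square of the factor below [L]. *)
Lemma scheme_error_step (L : R) n : (n < N)%N -> 1 <= L ->
  'E (fun w => block_factor B (p n) w ^+ 2) <= L ->
  e2 n.+1 <= e2 n + dt ^+ 2 * (L * Num.sqrt (e2 n)) + dt ^+ 3 * L.
Proof.
move=> nN L1 fL; have L0 : 0 <= L by exact: le_trans ler01 L1.
have fe := scheme_error_finite (ltnW nN); have fe' := scheme_error_finite nN.
have fF : finite_moments (nprob B) (block_factor B (p n)).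
  by apply: tempered_finite tempered_block_factor B (p n) _; rewrite /admissible/= ltnW.
have fN := noise_error_finite (ltnW nN).
have fe2 := finite_momentsX 2 fe.
have fFe := finite_momentsM fF fe.
have mF : 'E (block_factor B (p n)) <= L.
  have := mean_cauchy_schwarz fF (finite_moments_cst (nprob B) 1).
  rewrite expr1n mean_cst mulr1 (_ : 'E (fun w => _) = 'E (block_factor B (p n))); last first.
    by apply: eq_Rintegral => w _; exact: mulr1.
  move=> /le_trans/(_ fL) sq; apply: le_trans (ler_norm _) _.
  rewrite -(@ler_pXn2r _ 2)// ?nnegrE// real_normK ?num_real// (le_trans sq)//.
  by rewrite expr2 ler_peMl.
have mFe : 'E (fun w => block_factor B (p n) w * enorm (scheme_error n w)) <= L * Num.sqrt (e2 n).
  have := mean_cauchy_schwarz fF fe; have e20 : 0 <= e2 n by apply: mean_ge0 => w; exact: sqr_ge0.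
  move=> cs; apply: le_trans (ler_norm _) _.
  rewrite -(@ler_pXn2r _ 2)// ?nnegrE ?mulr_ge0 ?sqrtr_ge0//.
  rewrite real_normK ?num_real// (le_trans cs)// exprMn sqr_sqrtr// ler_wpM2r//.
  by rewrite (le_trans fL)// expr2 ler_peMl.
have := @mean_le _ _ _ _ _ _ (finite_momentsX 2 fe') _ (fun w => scheme_block w nN).
have f1 := finite_momentsZ (dt ^+ 2) fFe.
have f2 := finite_momentsZ 2 fN; have f3 := finite_momentsZ (dt ^+ 3) fF.
move=> /(_ (finite_momentsD (finite_momentsD (finite_momentsD fe2 f1) f2) f3)).
rewrite meanD//; last by do ?apply: finite_momentsD.
rewrite meanD//; last by do ?apply: finite_momentsD.
rewrite meanD// (_ : 'E (fun w => 2 * _) = 0); last first.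
  by rewrite meanZ// [X in _ * X](noise_error_mean0 (ltnW nN)) mulr0.
rewrite (meanZ _ fFe) (meanZ _ fF) addr0.
move=> /le_trans; apply; rewrite lerD ?lerD2l// ler_wpM2l// ?exprn_ge0 ?(ltW dt_gt0)//.
Qed.

(** With s the bound at step [n], both new terms are at most dt^2 L s because dt <= s, and s^2 + 2
    dt^2 L s is below the square of s + dt^2 L, the bound at the next step. *)
Lemma scheme_error_le (L : R) n : (n <= N)%N -> 1 <= L ->
  (forall i, (i < N)%N -> 'E (fun w => block_factor B (p i) w ^+ 2) <= L) ->
  e2 n <= (dt * (1 + n%:R * dt * L)) ^+ 2.
Proof.
move=> + L1 FL; have L0 : 0 <= L by exact: le_trans ler01 L1.
have d0 := ltW dt_gt0; elim: n => [_|n IH nN].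
  rewrite /e2 /scheme_error; under eq_Rintegral do rewrite mul0n /scheme/= subrr enorm0 expr0n.
  by rewrite mean_cst sqr_ge0.
have s0 : 0 <= dt * (1 + n%:R * dt * L) by rewrite !mulr_ge0// addr_ge0// !mulr_ge0.
have e2n := IH (ltnW nN).
apply: le_trans (scheme_error_step nN L1 (FL n nN)) _.
have rt : Num.sqrt (e2 n) <= dt * (1 + n%:R * dt * L).
  by rewrite (le_trans (ler_wsqrtr e2n))// sqrtr_sqr ger0_norm.
have b1 : dt ^+ 2 * (L * Num.sqrt (e2 n)) <= dt ^+ 2 * (L * (dt * (1 + n%:R * dt * L))).
  by rewrite ler_wpM2l ?sqr_ge0// ler_wpM2l.
have sd : dt <= dt * (1 + n%:R * dt * L) by rewrite ler_peMr// lerDl !mulr_ge0.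
have b2 : dt ^+ 3 * L <= dt ^+ 2 * L * (dt * (1 + n%:R * dt * L)).
  rewrite [leLHS](_ : _ = dt ^+ 2 * L * dt); last by ring.
  by rewrite ler_wpM2l// mulr_ge0// sqr_ge0.
move: rt s0 e2n b1 b2; set s := dt * (1 + n%:R * dt * L) => rt s0 e2n b1 b2.
rewrite (_ : dt * (1 + _) = s + dt ^+ 2 * L); last by rewrite /s -[n.+1]addn1 natrD; ring.
have : 0 <= (dt ^+ 2 * L) ^+ 2 by exact: sqr_ge0.
by move: b1 b2 e2n; nra.
Qed.

End one_step.

Theorem strong_error : exists c k, 0 <= c /\
  forall (B : noise R K) x0 dt N M, 0 < dt -> dt <= dt0 ->
    (\int[nprob B]_w (enorm (scheme B (dt / M.+1%:R) x0 (N * M.+1) w - scheme B dt x0 N w) ^+ 2))%R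
      <= (dt * (1 + N%:R * dt * (1 + c * (1 + enorm x0 + N%:R * dt) ^+ k))) ^+ 2.
Proof.
have [c [k [c0 H]]] := tempered_mean 2 tempered_block_factor.
exists c, k; split => // B x0 dt N M dt_gt0 dt_le.
apply: (scheme_error_le dt_gt0 dt_le (leqnn N)).
  by rewrite lerDl mulr_ge0// exprn_ge0// !addr_ge0 ?enorm_ge0// mulr_ge0// ltW.
move=> i iN; have ad : admissible (Params x0 dt N i M 0) by rewrite /admissible/= ltnW.
have := H B _ ad; rewrite /psize/= => HH.
apply: (@le_trans _ _ (c * (1 + enorm x0 + N%:R * dt) ^+ k)); last by rewrite lerDr.
apply: le_trans HH; rewrite le_eqVlt; apply/orP; left; apply/eqP.
by apply: eq_Rintegral => w _; rewrite real_normK ?num_real.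
Qed.

End strong_error.
Arguments scheme {R d K} f sigma alpha B h x0 n w.

(** * The solution as a jointly measurable limit of schemes *)

Lemma fatou_bound dT (T : measurableType dT) (R : realType)
    (mu : {measure set T -> \bar R}) (g_ : nat -> T -> R) (g : T -> R) (c : \bar R) :
  (forall n, measurable_fun setT (g_ n)) -> measurable_fun setT g ->
  (forall n x, 0 <= g_ n x) -> (forall x, 0 <= g x) ->
  {ae mu, forall x, g_ ^~ x @ \oo --> g x} ->
  (forall n, \int[mu]_x (g_ n x)%:E <= c)%E -> (\int[mu]_x (g x)%:E <= c)%E.
Proof.
move=> mg_ mg g_0 g0 gg bd.
have mE n : measurable_fun setT (fun x => (g_ n x)%:E) by exact/measurable_EFinP.
have inf0 x : (0 <= limn_einf (fun n => (g_ n x)%:E))%E.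
  rewrite limn_einf_lim; apply: lime_ge; first exact: is_cvg_einfs.
  by near=> n; apply: le_ereal_inf_tmp => _ [m _ <-]; rewrite lee_fin.
apply: (@le_trans _ _ (\int[mu]_x (limn_einf (fun n => (g_ n x)%:E)))%E).
  apply: ae_ge0_le_integral => //.
  - by move=> x _; rewrite lee_fin.
  - exact/measurable_EFinP.
  - apply: measurableT_comp => //.
    by apply: measurable_fun_limn_esup => n; apply: measurableT_comp.
  - apply: filterS gg => x gx _.
    have /cvg_limn_einf_sup[-> _] // : (fun n => (g_ n x)%:E) @ \oo --> (g x)%:E.
    by apply: cvg_EFin => //; exact: nearW.
apply: le_trans (fatou _ _ _ _) _ => //.
  by move=> n x _; rewrite lee_fin.
rewrite limn_einf_lim; apply: lime_le; first exact: is_cvg_einfs.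
near=> n; apply: le_trans (bd n); apply: ereal_inf_lbound.
by exists n => /=.
Unshelve. all: by end_near. Qed.

Lemma ae_mean_le dT (T : measurableType dT) (R : realType) (P : probability T R)
    (Z Y : T -> R) : finite_moments P Z -> finite_moments P Y -> (forall x, 0 <= Z x) ->
  (forall x, 0 <= Y x) -> {ae P, forall x, Z x <= Y x} ->
  (\int[P]_x Z x)%R <= (\int[P]_x Y x)%R.
Proof.
move=> fZ fY Z0 Y0 ZY; rewrite -lee_fin -!mean_EFin//.
apply: ae_ge0_le_integral => //.
- by move=> x _; rewrite lee_fin.
- by apply/measurable_EFinP; case: fZ.
- by move=> x _; rewrite lee_fin.
- by apply/measurable_EFinP; case: fY.
- by apply: filterS ZY => x ? _; rewrite lee_fin.
Qed.

Section limit.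
Variables (R : realType) (d K : nat) (f : 'rV[R]_d -> 'rV[R]_d)
  (sigma : 'I_K -> 'rV[R]_d) (alpha gamma C dt0 : R) (q : nat).
Hypotheses (alpha_gt0 : 0 < alpha) (gamma_gt0 : 0 < gamma) (C_ge1 : 1 <= C).
Hypothesis f_C2 : class_C2 f.
Hypothesis f_diss : forall x1 x2 : 'rV[R]_d,
  inner (f x2 - f x1) (x2 - x1) <= - gamma * enorm (x2 - x1) ^+ 2.
Hypothesis f_growth : drift_growth C q f.

Let f_cont : continuous f.
Proof. by move=> x; have [df _ _] := f_C2; exact/differentiable_continuous/df. Qed.

(* The limit superior exists at every [(x, w)] and is jointly measurable, whereas
   the solutions are given separately for each initial condition. *)
Definition scheme_limit (B : noise R K) dt N (x : 'rV[R]_d) (w : nspace B) : 'rV[R]_d :=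
  \row_i fine (limn_esup (fun m =>
    (scheme f sigma alpha B (dt / m.+1%:R) x (N * m.+1) w 0 i)%:E)).
Arguments scheme_limit B dt N x w : clear implicits.

Lemma measurable_scheme_limit (B : noise R K) dt N : 0 < dt ->
  measurable_fun setT
    (fun z : borelRd R d * nspace B => scheme_limit B dt N z.1 z.2 : borelRd R d).
Proof.
move=> dt_gt0; apply: measurable_rV => i; under eq_fun do rewrite mxE.
apply: (measurableT_comp (fine_measurable _)) => //.
apply: measurable_fun_limn_esup => m; apply/measurable_EFinP; apply: measurable_coord.
apply: (@measurable_tamed_path R d f alpha (dt / m.+1%:R) _
  (borelRd R d * nspace B)%type
  (fun j (z : borelRd R d * nspace B) => scheme_path sigma (dt / m.+1%:R) z.2 j) fst (N * m.+1)) => //.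
- exact: ltW.
- by rewrite divr_ge0// ltW.
- move=> j _; apply: (measurableT_comp (measurable_noise_path _ _) measurable_snd).
  by rewrite mulr_ge0// divr_ge0// ltW.
Qed.

Lemma enorm_cvg (a : nat -> 'rV[R]_d) (y s : 'rV[R]_d) p :
  (fun m => enorm (a m - y)) @ \oo --> 0 ->
  (fun m => enorm (a m - s) ^+ p) @ \oo --> enorm (y - s) ^+ p.
Proof.
move=> ay; apply: (cvg_comp (fun m => enorm (a m - s)) (fun z => z ^+ p)); last exact: exprn_continuous.
apply/cvgrPdist_le => eps eps0; move/cvgrPdist_le : ay => /(_ eps eps0).
apply: filterS => m; rewrite sub0r normrN ger0_norm ?enorm_ge0// => le.
apply: le_trans le; rewrite ler_norml.
have t1 := enormD (a m - y) (y - s); have t2 := enormB (a m - s) (a m - y).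
rewrite subrKA in t1; rewrite (_ : a m - s - (a m - y) = y - s) in t2; last first.
  by rewrite opprB addrC addrA subrK.
by apply/andP; split; lra.
Qed.

Section paths.
Variable B : noise R K.
Let P := nprob B.
Let W t w : 'rV[R]_d := \sum_(k < K) @nbeta R K B k t w *: sigma k.

Definition solution x X := sde_solution P (@nfilt R K B) f sigma (@nbeta R K B) x X.

Lemma solution_paths x X : solution x X ->
  {ae P, forall w, [/\ {within `[0, +oo[, continuous (X ^~ w)},
    forall t, 0 <= t ->
      X t w = x + \row_i (\int[lebesgue_measure]_(s in `[0, t]) f (X s w) 0 i) + W t w,
    W 0 w = 0 & {within `[0, +oo[, continuous (W ^~ w)}]}.
Proof.
move=> [_ cX eX].
have b0 : {ae P, forall w, forall k, @nbeta R K B k 0 w = 0}.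
  by apply: filter_forall => k; have [] := nwiener B k.
have bc : {ae P, forall w, forall k, {within `[0, +oo[, continuous (@nbeta R K B k ^~ w)}}.
  by apply: filter_forall => k; have [] := nwiener B k.
apply: filterS3 cX eX (filterI b0 bc) => w cXw eXw [b0w bcw]; split => //.
  by rewrite /W big1// => k _; rewrite b0w scale0r.
apply/subspace_continuousP => t t0; apply: cvg_big => //; first exact: add_continuous.
move=> k _; apply: cvgZl.
by have /subspace_continuousP := bcw k; exact.
Qed.

(** The exceptional set depends on [x]; statements over all initial states are recovered through
    sections of product sets. *)
Lemma scheme_limit_cvg x X dt N : 0 < dt -> solution x X ->
  {ae P, forall w, scheme_limit B dt N x w = X (N%:R * dt) w /\
    (fun m => enorm (scheme f sigma alpha B (dt / m.+1%:R) x (N * m.+1) w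
      - scheme_limit B dt N x w)) @ \oo --> 0}.
Proof.
move=> dt_gt0 /solution_paths; apply: filterS => w [cX eX W0 cW].
have := scheme_cvg alpha_gt0 gamma_gt0 C_ge1 f_cont f_diss f_growth cX eX W0 cW N dt_gt0.
have E m : tamed_path f alpha (dt / m.+1%:R)
    (fun n => W (n%:R * (dt / m.+1%:R)) w - W 0 w) x (N * m.+1)
    = scheme f sigma alpha B (dt / m.+1%:R) x (N * m.+1) w.
  rewrite /scheme; congr (tamed_path _ _ _ _ _ _); apply/funext => n.
  rewrite /scheme_path /noise_path /W -sumrB; apply: eq_bigr => k _.
  by rewrite scalerBl.
under eq_fun do rewrite E; move=> cvX.
suff Y : scheme_limit B dt N x w = X (N%:R * dt) w by rewrite Y.
apply/rowP => i; rewrite mxE.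
have ci : (fun m => scheme f sigma alpha B (dt / m.+1%:R) x (N * m.+1) w 0 i) @ \oo
    --> X (N%:R * dt) w 0 i.
  apply/cvgrPdist_le => eps eps0; move/cvgrPdist_le : cvX => /(_ eps eps0).
  apply: filterS => m; rewrite sub0r normrN ger0_norm ?enorm_ge0// => le.
  rewrite distrC; apply: le_trans le.
  by have := coord_le_enorm (scheme f sigma alpha B (dt / m.+1%:R) x (N * m.+1) w - X (N%:R * dt) w) i;
    rewrite !mxE.
have /cvg_limn_einf_sup[_ ->] // : (fun m =>
    (scheme f sigma alpha B (dt / m.+1%:R) x (N * m.+1) w 0 i)%:E) @ \oo --> (X (N%:R * dt) w 0 i)%:E.
by apply: cvg_EFin => //; exact: nearW.
Qed.

Lemma measurable_scheme_limit_from x dt N : 0 < dt ->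
  measurable_fun setT (scheme_limit B dt N x : nspace B -> borelRd R d).
Proof.
move=> dt_gt0; have mx := @pair1_measurable _ _ (borelRd R d) (nspace B) x.
have ml := @measurable_scheme_limit B dt N dt_gt0.
have := measurableT_comp ml mx.
exact.
Qed.

Lemma scheme_limit_law x X dt N (A : set (borelRd R d)) : 0 < dt -> solution x X ->
  measurable A -> P (X (N%:R * dt) @^-1` A) = P (scheme_limit B dt N x @^-1` A).
Proof.
move=> dt_gt0 sX mA; have [ad _ _] := sX.
have T0 : 0 <= N%:R * dt by rewrite mulr_ge0// ltW.
have mX : measurable (X (N%:R * dt) @^-1` A).
  by have [_] := filtration_sigma B T0; apply; exact: ad.
have mY : measurable (scheme_limit B dt N x @^-1` A).
  by rewrite -[X in measurable X]setTI; exact: measurable_scheme_limit_from.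
rewrite -[X in P X = _]setIT -[X in _ = P X]setIT -!integral_indic//.
apply: ge0_ae_eq_integral => //; try by move=> w _; rewrite lee_fin.
- by apply/measurable_EFinP; exact: measurable_indic.
- by apply/measurable_EFinP; exact: measurable_indic.
- apply: filterS (scheme_limit_cvg N dt_gt0 sX) => w [e _] _.
  rewrite !indicE; congr (_%:R%:E); congr nat_of_bool.
  by apply/idP/idP; rewrite !inE /preimage/= e.
Qed.

Lemma scheme_limit_contraction x y X Y dt N : 0 < dt -> solution x X -> solution y Y ->
  {ae P, forall w, enorm (scheme_limit B dt N x w - scheme_limit B dt N y w)
    <= expR (- gamma * (N%:R * dt)) * enorm (x - y)}.
Proof.
move=> dt_gt0 sX sY; have T0 : 0 <= N%:R * dt by rewrite mulr_ge0// ltW.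
apply: filterS3 (filterI (solution_paths sX) (solution_paths sY))
  (scheme_limit_cvg N dt_gt0 sX) (scheme_limit_cvg N dt_gt0 sY) => w.
move=> [[cX eX _ _] [cY eY _ _]] [-> _] [-> _].
exact: (solution_contraction gamma_gt0 C_ge1 f_cont f_diss f_growth T0 cX cY eX eY).
Qed.

End paths.
Arguments solution B x X : clear implicits.

Lemma scheme_moment p : exists c k, 0 <= c /\
  forall (B : noise R K) x0 dt N M, 0 < dt -> dt <= dt0 ->
    (\int[nprob B]_w (enorm (scheme f sigma alpha B dt x0 N w) ^+ p)%:E
      <= (c * (1 + enorm x0 + N%:R * dt) ^+ k)%:E)%E /\
    (\int[nprob B]_w (enorm (scheme f sigma alpha B (dt / M.+1%:R) x0 (N * M.+1) w) ^+ p)%:E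
      <= (c * (1 + enorm x0 + N%:R * dt) ^+ k)%:E)%E.
Proof.
have [mE /(_ p)[c [k [c0 H]]]] :=
  @tempered_envelope R d K sigma alpha gamma C dt0 q.
exists c, k; split => // B x0 dt N M dt_gt0 dt_le.
(* With cell and number of cells both equal to [N], the envelope controls the two schemes at the
   final time. *)
set pr := Params x0 dt N N M 0; have ad : admissible dt0 pr by [].
have HB := H B pr ad; have le w := scheme_envelope0 sigma alpha_gt0 gamma_gt0 C_ge1 f_diss f_growth
  x0 M dt_gt0 (B := B) w (leqnn N).
have m h n : 0 <= h -> measurable_fun setT
    (fun w => (enorm (scheme f sigma alpha B h x0 n w) ^+ p)%:E).
  move=> h0; apply/measurable_EFinP; apply: measurable_funX; apply: measurable_enorm.
  exact: measurable_scheme.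
have up (u v : R) : 0 <= u -> u <= v -> (u ^+ p <= `|v| ^+ p)%R.
  by move=> u0 uv; rewrite lerXn2r ?nnegrE// (le_trans uv)// ler_norm.
split; apply: le_trans HB; apply: ge0_le_integral => //.
- by move=> w _; rewrite lee_fin exprn_ge0 ?enorm_ge0.
- by apply: m; exact: ltW.
- by apply: measurable_absX; exact: mE.
- by move=> w _; rewrite lee_fin; have [le1 _] := le w; apply: up; rewrite ?enorm_ge0.
- by move=> w _; rewrite lee_fin exprn_ge0 ?enorm_ge0.
- by apply: m; rewrite divr_ge0// ltW.
- by apply: measurable_absX; exact: mE.
- by move=> w _; rewrite lee_fin; have [_ le2] := le w; apply: up; rewrite ?enorm_ge0.
Qed.

Lemma scheme_limit_moment p : exists c k, 0 <= c /\
  forall (B : noise R K) x0 X dt N, solution B x0 X -> 0 < dt -> dt <= dt0 ->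
    (\int[nprob B]_w (enorm (scheme_limit B dt N x0 w) ^+ p)%:E
      <= (c * (1 + enorm x0 + N%:R * dt) ^+ k)%:E)%E.
Proof.
have [c [k [c0 H]]] := scheme_moment p; exists c, k; split => // B x0 X dt N sX dt_gt0 dt_le.
apply: (@fatou_bound _ _ _ _
  (fun m w => enorm (scheme f sigma alpha B (dt / m.+1%:R) x0 (N * m.+1) w) ^+ p)).
- move=> m; apply: measurable_funX; apply: measurable_enorm; apply: measurable_scheme => //.
  by rewrite divr_ge0// ltW.
- by apply: measurable_funX; apply: measurable_enorm; exact: measurable_scheme_limit_from.
- by move=> m w; rewrite exprn_ge0 ?enorm_ge0.
- by move=> w; rewrite exprn_ge0 ?enorm_ge0.
- apply: filterS (scheme_limit_cvg N dt_gt0 sX) => w [_ cv].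
  by have := @enorm_cvg _ _ 0 p cv; rewrite subr0; under eq_fun do rewrite subr0.
- by move=> m; have [] := H B x0 dt N m dt_gt0 dt_le.
Qed.

Lemma scheme_limit_error : exists c k, 0 <= c /\
  forall (B : noise R K) x0 X dt N, solution B x0 X -> 0 < dt -> dt <= dt0 ->
    (\int[nprob B]_w (enorm (scheme_limit B dt N x0 w - scheme f sigma alpha B dt x0 N w) ^+ 2)%:E
      <= ((dt * (1 + N%:R * dt * (1 + c * (1 + enorm x0 + N%:R * dt) ^+ k))) ^+ 2)%:E)%E.
Proof.
have [c [k [c0 H]]] :=
  strong_error sigma dt0 alpha_gt0 gamma_gt0 C_ge1 f_C2 f_diss f_growth.
exists c, k; split => // B x0 X dt N sX dt_gt0 dt_le.
have ms : measurable_fun setT (scheme f sigma alpha B dt x0 N : nspace B -> borelRd R d).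
  by apply: measurable_scheme => //; exact: ltW.
apply: (@fatou_bound _ _ _ _
  (fun m w => enorm (scheme f sigma alpha B (dt / m.+1%:R) x0 (N * m.+1) w
     - scheme f sigma alpha B dt x0 N w) ^+ 2)).
- move=> m; apply: measurable_funX; apply: measurable_enorm; apply: measurable_rVB => //.
  by apply: measurable_scheme => //; rewrite divr_ge0// ltW.
- apply: measurable_funX; apply: measurable_enorm; apply: measurable_rVB => //.
  exact: measurable_scheme_limit_from.
- by move=> m w; rewrite sqr_ge0.
- by move=> w; rewrite sqr_ge0.
- apply: filterS (scheme_limit_cvg N dt_gt0 sX) => w [_ cv]; exact: enorm_cvg cv.
- move=> m; have fe := scheme_error_finite sigma alpha_gt0 gamma_gt0 C_ge1 f_C2 f_diss
    f_growth B x0 m dt_gt0 dt_le (leqnn N).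
  by rewrite mean_EFin; [rewrite lee_fin; exact: H|exact: finite_momentsX fe].
Qed.

End limit.
Arguments solution {R d K} f sigma B x X.
Arguments scheme_limit {R d K} f sigma alpha B dt N x w.

(** * Moments of the invariant distribution *)

Section law_transfer.
Context d1 d2 (T1 : measurableType d1) (T2 : measurableType d2) (R : realType)
  (P1 : probability T1 R) (P2 : probability T2 R) (phi : T1 -> T2).
Hypothesis mphi : measurable_fun setT phi.
Hypothesis law : forall A, measurable A -> P1 (phi @^-1` A) = P2 A.

Lemma law_integral (g : T2 -> \bar R) : measurable_fun setT g ->
  (forall y, 0 <= g y)%E -> (\int[P1]_x g (phi x) = \int[P2]_y g y)%E.
Proof.
move=> mg g0; rewrite -(@ge0_integral_pushforward _ _ _ _ _ _ mphi P1 setT g)//.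
by apply: eq_measure_integral => A mA _; exact: law.
Qed.

Lemma law_finite_moments (g : T2 -> R) : finite_moments P2 g ->
  finite_moments P1 (fun x => g (phi x)).
Proof.
move=> [mg fg]; split => [|p]; first exact: (measurableT_comp mg mphi).
rewrite (@law_integral (fun y => (`|g y| ^+ p)%:E))//; last exact: measurable_absX.
Qed.

Lemma law_mean (g : T2 -> R) : finite_moments P2 g ->
  (\int[P1]_x g (phi x))%R = (\int[P2]_y g y)%R.
Proof.
move=> fg; have fg' := law_finite_moments fg.
apply: EFin_inj; rewrite -!mean_EFin//.
transitivity (\int[pushforward P1 phi]_y (g y)%:E)%E.
  rewrite (integral_pushforward mphi)//.
    by apply/measurable_EFinP; case: fg.
  exact: (finite_moments_integrable fg').
by apply: eq_measure_integral => A mA _; exact: law.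
Qed.

End law_transfer.

(** The null sets may vary with [x] without any joint measurability; the set where the inequality
    fails is measurable and all its sections are null. *)
Lemma product_ae_le d1 d2 (T1 : measurableType d1) (T2 : measurableType d2) (R : realType)
    (P1 : probability T1 R) (P2 : probability T2 R) (F G : T1 * T2 -> R) :
  measurable_fun setT F -> measurable_fun setT G ->
  (forall x, {ae P2, forall y, F (x, y) <= G (x, y)}) ->
  {ae (P1 \x P2)%E, forall z, F z <= G z}.
Proof.
move=> mF mG H.
pose D := [set z | G z < F z].
have mD : measurable D.
  rewrite (_ : D = setT `&` (F \- G) @^-1` `]0, +oo[%classic); last first.
    by rewrite setTI; apply/seteqP; split => z; rewrite /D/= in_itv/= andbT subr_gt0.
  exact: (measurable_funB mF mG).
exists D; split => //; last by move=> z /= /negP; rewrite -ltNge.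
rewrite /= /product_measure1; apply: integral0_eq => x _ /=.
apply: measure_negligible; first exact: measurable_xsection.
have [E [mE E0 DE]] := H x; exists E; split => // y.
by rewrite /xsection/= inE /D/= => lt; apply: DE => /=; apply/negP; rewrite -ltNge.
Qed.

Section invariant.
Variables (R : realType) (d K : nat) (f : 'rV[R]_d -> 'rV[R]_d)
  (sigma : 'I_K -> 'rV[R]_d) (alpha gamma C dt0 : R) (q : nat).
Hypotheses (alpha_gt0 : 0 < alpha) (gamma_gt0 : 0 < gamma) (C_ge1 : 1 <= C).
Hypothesis f_C2 : class_C2 f.
Hypothesis f_diss : forall x1 x2 : 'rV[R]_d,
  inner (f x2 - f x1) (x2 - x1) <= - gamma * enorm (x2 - x1) ^+ 2.
Hypothesis f_growth : drift_growth C q f.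
Hypothesis dt0_gt0 : 0 < dt0.

Section law.
Variables (B : noise R K) (mu : probability (borelRd R d) R)
  (X : 'rV[R]_d -> R -> nspace B -> 'rV[R]_d).
Hypothesis X_sol : forall x, solution f sigma B x (X x).
Hypothesis X_inv : forall t (A : set (borelRd R d)), 0 <= t -> measurable A ->
  (\int[mu]_x nprob B (X x t @^-1` A) = mu A)%E.

Definition joint : probability (borelRd R d * nspace B)%type R := (mu \x nprob B)%E.

Let Y dt N (z : borelRd R d * nspace B) : borelRd R d :=
  scheme_limit f sigma alpha B dt N z.1 z.2.

(** The section at [x] has the probability given by the solution started at [x], and integrating
    over [x] is the invariance identity. *)
Lemma joint_limit_law dt N A : 0 < dt -> measurable A ->
  joint (Y dt N @^-1` A) = mu A.
Proof.
move=> dt_gt0 mA; rewrite -(@X_inv (N%:R * dt))//; last by rewrite mulr_ge0// ltW.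
rewrite /joint/= /product_measure1; apply: eq_integral => x _ /=.
rewrite (scheme_limit_law alpha_gt0 gamma_gt0 C_ge1 f_C2 f_diss f_growth N dt_gt0 (X_sol x) mA).
by congr (nprob B _); apply/seteqP; split => w; rewrite /xsection/= inE.
Qed.

Lemma joint_fst_law A : measurable A -> joint (fst @^-1` A) = mu A.
Proof.
move=> mA; rewrite (_ : _ @^-1` _ = A `*` setT); last first.
  by apply/seteqP; split => z //= [].
transitivity (mu A * nprob B setT)%E; first exact: product_measure1E.
by rewrite probability_setT mule1.
Qed.

Lemma joint_snd_law A : measurable A -> joint (snd @^-1` A) = nprob B A.
Proof.
move=> mA; rewrite (_ : _ @^-1` _ = setT `*` A); last first.
  by apply/seteqP; split => z //= [].
transitivity (mu setT * nprob B A)%E; first exact: product_measure1E.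
by rewrite probability_setT mul1e.
Qed.

Lemma measurable_Y dt N : 0 < dt -> measurable_fun setT (Y dt N).
Proof. by move=> dt_gt0; exact: measurable_scheme_limit. Qed.


Lemma limit_finite x0 dt N : 0 < dt -> dt <= dt0 ->
  finite_moments (nprob B) (fun w => enorm (scheme_limit f sigma alpha B dt N x0 w)).
Proof.
move=> dt_gt0 dt_le; split => [|p].
  by apply: measurable_enorm; exact: measurable_scheme_limit_from.
have [c [k [c0 H]]] :=
  scheme_limit_moment sigma dt0 alpha_gt0 gamma_gt0 C_ge1 f_C2 f_diss f_growth p.
under eq_integral do rewrite ger0_norm ?enorm_ge0//.
by apply: le_lt_trans (H B x0 _ dt N (X_sol x0) dt_gt0 dt_le) _; rewrite ltry.
Qed.

(* The truncation keeps the moments of [mu] finite before they are known to be: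
   with [m a] the integral of [min (a |x|^p, r)], invariance and contraction give
   [m a <= m (a / 2) + a D], which is summed over [a = 2^-k]. *)
Section truncated_moments.
Variables (dt : R) (N p : nat).
Hypotheses (dt_gt0 : 0 < dt) (dt_le : dt <= dt0).
Hypothesis p_gt0 : (0 < p)%N.
Hypothesis dt_long : 4 * expR (- gamma * (N%:R * dt)) <= 1.

Local Notation "''E_' P Z" := (\int[P]_w Z w)%R (at level 10, P at level 2, Z at level 9).

Definition trunc_moment a r (x : borelRd R d) : R := Num.min (a * enorm x ^+ p) r.

Definition start0_moment :=
  'E_(nprob B) (fun w => enorm (scheme_limit f sigma alpha B dt N 0 w) ^+ p).

Lemma trunc_moment_ge0 a r x : 0 <= a -> 0 <= r -> 0 <= trunc_moment a r x.
Proof.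
by move=> a0 r0; rewrite /trunc_moment le_min r0 andbT mulr_ge0 ?exprn_ge0 ?enorm_ge0.
Qed.

Lemma trunc_moment_finite a r : 0 <= a -> 0 <= r -> finite_moments mu (trunc_moment a r).
Proof.
move=> a0 r0; apply: (finite_moments_le (finite_moments_cst mu r)) => [|x].
  apply: measurable_minr => //; apply: measurable_funM => //.
  by apply: measurable_funX; apply: measurable_enorm; exact: measurable_id.
by rewrite !ger0_norm ?trunc_moment_ge0// ge_min lexx orbT.
Qed.

(** Contraction towards the solution started at 0 bounds the stationary state by a small multiple of
    its initial value plus a term free of [mu]; min(u + v, r) <= min(u, r) + v leaves the truncation
    on the first part. *)
Lemma trunc_moment_step a r : 0 <= a -> 0 <= r ->
  'E_mu (trunc_moment a r) <= 'E_mu (trunc_moment (a / 2) r) + a * 2 ^+ p * start0_moment.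
Proof.
move=> a0 r0; have a20 : 0 <= a / 2 by rewrite divr_ge0.
have fa := trunc_moment_finite a0 r0; have fa2 := trunc_moment_finite a20 r0.
have mY := measurable_Y N dt_gt0.
have lY := joint_limit_law N dt_gt0.
have mfst : measurable_fun setT (fst : borelRd R d * nspace B -> borelRd R d) by [].
have msnd : measurable_fun setT (snd : borelRd R d * nspace B -> nspace B) by [].
have fY0 := finite_momentsX p (limit_finite 0 N dt_gt0 dt_le).
rewrite -(law_mean mY lY fa) -(law_mean mfst joint_fst_law fa2).
rewrite /start0_moment -(law_mean msnd joint_snd_law fY0).
have j0 := law_finite_moments mY lY fa.
have j1 := law_finite_moments mfst joint_fst_law fa2.
have j2 := law_finite_moments msnd joint_snd_law fY0.
rewrite -meanZ// -meanD//; last exact: finite_momentsZ.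
have b0 w : 0 <= a * 2 ^+ p * enorm (scheme_limit f sigma alpha B dt N 0 w) ^+ p.
  by rewrite !mulr_ge0 ?exprn_ge0 ?enorm_ge0.
apply: ae_mean_le => //.
- by apply: finite_momentsD => //; exact: finite_momentsZ.
- by move=> z; exact: trunc_moment_ge0.
- by move=> z; rewrite addr_ge0// trunc_moment_ge0.
- apply: product_ae_le; first by case: j0.
    by have [] := finite_momentsD j1 (finite_momentsZ (a * 2 ^+ p) j2).
  move=> x; have := scheme_limit_contraction alpha_gt0 gamma_gt0 C_ge1 f_C2 f_diss
    f_growth N dt_gt0 (X_sol x) (X_sol 0).
  apply: filterS => w; rewrite subr0 /= /Y/=.
  set y := scheme_limit _ _ _ _ _ _ x w; set y0 := scheme_limit _ _ _ _ _ _ 0 w.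
  set e := expR _ => con; have e0 : 0 <= e := expR_ge0 _.
  have x0 := enorm_ge0 x; have y00 := enorm_ge0 y0.
  have yle : enorm y <= e * enorm x + enorm y0.
    by have := enormD (y - y0) y0; rewrite subrK; lra.
  have : enorm y ^+ p <= 2 ^+ p * ((e * enorm x) ^+ p + enorm y0 ^+ p).
    apply: le_trans (powerD_le _ _ _); rewrite ?mulr_ge0//.
    by rewrite lerXn2r ?nnegrE ?enorm_ge0 ?addr_ge0 ?mulr_ge0.
  (* [dt_long] gives 2e <= 1/2, and a positive power of a number below 1/2 stays below 1/2. *)
  have e2 : 2 ^+ p * e ^+ p <= 2^-1.
    rewrite -exprMn -(prednK p_gt0) exprS -[leRHS]mulr1 ler_pM ?exprn_ge0 ?mulr_ge0//.
      by have := dt_long; rewrite -/e; lra.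
    by rewrite exprn_ile1 ?mulr_ge0//; have := dt_long; rewrite -/e; lra.
  have := ler_wpM2r (exprn_ge0 p x0) e2; rewrite exprMn => h1 h2.
  have : a * enorm y ^+ p <= a / 2 * enorm x ^+ p + a * 2 ^+ p * enorm y0 ^+ p.
    rewrite -!mulrA -mulrDr ler_wpM2l//; move: h1 h2.
    by set u := enorm x ^+ p; set v := enorm y0 ^+ p; lra.
  have := b0 w; rewrite -/y0 /trunc_moment => bw le.
  rewrite ge_min; have [_|_] := leP (a / 2 * enorm x ^+ p) r; first by rewrite le.
  by rewrite [X in _ || X]lerDl bw orbT.
Qed.

Lemma start0_moment_ge0 : 0 <= start0_moment.
Proof. by apply: mean_ge0 => w; rewrite exprn_ge0 ?enorm_ge0. Qed.

(** [2 - 2 * 2^-1 ^+ k] is the sum of the first [k] terms of the geometric series 1 + 1/2 + 1/4 +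
    ... *)
Lemma trunc_moment_iter r k : 0 <= r ->
  'E_mu (trunc_moment 1 r) <= 'E_mu (trunc_moment (2^-1 ^+ k) r)
    + (2 - 2 * 2^-1 ^+ k) * (2 ^+ p * start0_moment).
Proof.
move=> r0; elim: k => [|k IH]; first by rewrite expr0 mulr1 subrr mul0r addr0.
apply: le_trans IH _; have := @trunc_moment_step (2^-1 ^+ k) r (exprn_ge0 _ _) r0.
rewrite invr_ge0 ler0n => /(_ isT); rewrite -exprSr.
set u := 'E_mu _; set v := 'E_mu _; rewrite exprSr.
by set t := 2^-1 ^+ k; set D := start0_moment; lra.
Qed.

Lemma trunc_moment_le r : 0 <= r ->
  'E_mu (trunc_moment 1 r) <= 2 ^+ p.+1 * start0_moment.
Proof.
move=> r0; have D0 := start0_moment_ge0.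
have h0 k : 0 <= 2^-1 ^+ k :> R by rewrite exprn_ge0// invr_ge0.
set A := 'E_mu _; set D := 2 ^+ p.+1 * start0_moment.
have fk k := trunc_moment_finite (h0 k) r0.
have fr := finite_moments_cst mu r.
(* Fatou's lemma is applied to the nonnegative functions [r - trunc_moment], which tend to [r] as
   the coefficient 2^-k vanishes. *)
suff : (\int[mu]_x r%:E <= (r - A + D)%:E)%E.
  by rewrite integral_cst//= probability_setT mule1 lee_fin; lra.
apply: (@fatou_bound _ _ _ _ (fun k x => r - trunc_moment (2^-1 ^+ k) r x)) => //.
- by move=> k; have [] := finite_momentsB fr (fk k).
- by move=> k x; rewrite subr_ge0 ge_min lexx orbT.
- apply: aeW => x; rewrite -[X in _ --> X]subr0; apply: cvgB; first exact: cvg_cst.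
  apply: (@squeeze_cvgr _ _ _ _ (fun=> 0) (fun k => 2^-1 ^+ k * enorm x ^+ p)).
  + by apply: nearW => k; rewrite trunc_moment_ge0// ge_min lexx.
  + exact: cvg_cst.
  + rewrite -(mul0r (enorm x ^+ p)); apply: cvgM; last exact: cvg_cst.
    by apply: cvg_expr; rewrite ger0_norm ?invr_ge0// invf_lt1 ?ltr1n.
- move=> k; rewrite mean_EFin; last exact: finite_momentsB.
  rewrite lee_fin (meanB fr (fk k)) mean_cst.
  have := trunc_moment_iter k r0; rewrite -/A.
  have : (2 - 2 * 2^-1 ^+ k) * (2 ^+ p * start0_moment) <= D.
    rewrite /D exprS -mulrA ler_wpM2r ?mulr_ge0 ?exprn_ge0//.
    by have := h0 k; lra.
  by lra.
Qed.

Lemma invariant_moment_le :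
  (\int[mu]_x (enorm x ^+ p)%:E <= (2 ^+ p.+1 * start0_moment)%:E)%E.
Proof.
apply: (@fatou_bound _ _ _ _ (fun n => trunc_moment 1 n%:R)).
- by move=> n; have [] := trunc_moment_finite (@ler01 R) (ler0n R n).
- by apply: measurable_funX; apply: measurable_enorm; exact: measurable_id.
- by move=> n x; rewrite trunc_moment_ge0.
- by move=> x; rewrite exprn_ge0 ?enorm_ge0.
- apply: aeW => x; apply: cvg_near_cst; near=> n.
  rewrite /trunc_moment mul1r; apply/min_idPl.
  by near: n; exact: nbhs_infty_ger.
- move=> n; rewrite mean_EFin; last exact: trunc_moment_finite.
  by rewrite lee_fin trunc_moment_le.
Unshelve. all: by end_near. Qed.

End truncated_moments.
End law.

Lemma invariant_moment p : exists c, 0 <= c /\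
  forall (B : noise R K) (mu : probability (borelRd R d) R) X,
    (forall x, solution f sigma B x (X x)) ->
    (forall t (A : set (borelRd R d)), 0 <= t -> measurable A ->
      (\int[mu]_x nprob B (X x t @^-1` A) = mu A)%E) ->
    (\int[mu]_x (enorm x ^+ p)%:E <= c%:E)%E.
Proof.
have [->|p0] := eqVneq p 0%N.
  exists 1; split => // B mu X _ _; under eq_integral do rewrite expr0.
  by rewrite integral_cst//= probability_setT mule1.
have [c [k [c0 H]]] :=
  scheme_limit_moment sigma dt0 alpha_gt0 gamma_gt0 C_ge1 f_C2 f_diss f_growth p.
have g0 : 0 < gamma * dt0 by exact: mulr_gt0.
(* The horizon makes [gamma * (N%:R * dt0)] at least 3, and exp y >= 1 + y then gives the factor
   4. *)
pose N := (Num.truncn (3 / (gamma * dt0))).+1.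
have long : 4 * expR (- gamma * (N%:R * dt0)) <= 1.
  rewrite mulNr expRN -ler_pdivlMr ?invr_gt0 ?expR_gt0// invrK mul1r.
  apply: le_trans (expR_ge1Dx _).
  have := truncnS_gt (3 / (gamma * dt0)); rewrite -/N ltr_pdivrMr//.
  by rewrite mulrCA; lra.
exists (2 ^+ p.+1 * (c * (1 + 0 + N%:R * dt0) ^+ k)); split.
  by rewrite !mulr_ge0 ?exprn_ge0// !addr_ge0// mulr_ge0// ltW.
move=> B mu X X_sol X_inv.
apply: le_trans (invariant_moment_le X_sol X_inv dt0_gt0 (lexx _) _ long) _.
  by rewrite lt0n.
rewrite lee_fin ler_wpM2l ?exprn_ge0// -lee_fin /start0_moment.
rewrite -mean_EFin; last by apply: finite_momentsX; exact: limit_finite.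
by have := H B 0 _ dt0 N (X_sol 0) dt0_gt0 (lexx _); rewrite enorm0.
Qed.

End invariant.

(** * Weak error *)

Lemma mean_norm_le dT (T : measurableType dT) (R : realType) (P : probability T R)
    (Z : T -> R) : finite_moments P Z ->
  `|\int[P]_x Z x|%R <= (\int[P]_x `|Z x|)%R.
Proof.
move=> fZ; have fa := finite_moments_abs fZ; have fN := finite_momentsZ (-1) fZ.
rewrite ler_norml; apply/andP; split.
  rewrite lerNl -mulN1r -meanZ//; apply: mean_le => // x.
  by rewrite mulN1r -normrN ler_norm.
by apply: mean_le => // x; exact: ler_norm.
Qed.

Lemma power3_le (R : realType) (a u v : R) m : 0 <= a -> 0 <= u -> 0 <= v ->
  (a + u + v) ^+ m <= 4 ^+ m * (a ^+ m + u ^+ m + v ^+ m).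
Proof.
move=> a0 u0 v0; have p (k : R) : 0 <= k -> 0 <= k ^+ m := @exprn_ge0 _ m k.
apply: le_trans (powerD_le _ (addr_ge0 a0 u0) v0) _.
have := powerD_le m a0 u0; have : 1 <= 2 ^+ m :> R by rewrite exprn_ege1// ler1n.
rewrite (_ : 4 = 2 * 2 :> R) ?exprMn; last by ring.
have := p _ a0; have := p _ u0; have := p _ v0.
set x := a ^+ m; set y := u ^+ m; set z := v ^+ m; set t := 2 ^+ m; set s := (a + u) ^+ m.
move=> z0 y0 x0 t1 st; rewrite -mulrA ler_wpM2l//; first by lra.
by have : 0 <= (t - 1) * z by [rewrite mulr_ge0// subr_ge0]; lra.
Qed.

Section weak_error.
Variables (R : realType) (d K : nat) (f : 'rV[R]_d -> 'rV[R]_d)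
  (sigma : 'I_K -> 'rV[R]_d) (alpha gamma C dt0 : R) (q r : nat).
Hypotheses (alpha_gt0 : 0 < alpha) (gamma_gt0 : 0 < gamma) (C_ge1 : 1 <= C).
Hypothesis f_C2 : class_C2 f.
Hypothesis f_diss : forall x1 x2 : 'rV[R]_d,
  inner (f x2 - f x1) (x2 - x1) <= - gamma * enorm (x2 - x1) ^+ 2.
Hypothesis f_growth : drift_growth C q f.
Hypothesis dt0_gt0 : 0 < dt0.

(** [A] stands for the weighted norm of the test function; the bounds are linear in it so that it
    factors out of the error. *)
Definition test_growth (A : R) (phi : 'rV[R]_d -> R) :=
  [/\ continuous phi, forall x, `|phi x| <= 2 * A * (1 + enorm x) ^+ r &
      forall x y, `|phi y - phi x| <= 2 * A * (1 + enorm x + enorm y) ^+ r * enorm (y - x)].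

Lemma test_finite A phi dT (T : measurableType dT) (P : probability T R)
    (Z : T -> borelRd R d) : 0 <= A -> test_growth A phi -> measurable_fun setT Z ->
  finite_moments P (fun x => enorm (Z x)) -> finite_moments P (fun x => phi (Z x)).
Proof.
move=> A0 [cphi bphi _] mZ fZ.
apply: (finite_moments_le (finite_momentsZ (2 * A)
  (finite_momentsX r (finite_momentsD (finite_moments_cst P 1) fZ)))).
  apply: (@measurableT_comp _ _ _ _ _ _ (phi : borelRd R d -> R)) => //.
  exact: continuous_measurable_rV.
by move=> x; apply: le_trans (bphi _) (ler_norm _).
Qed.

Lemma scheme_finite (B : noise R K) x0 dt N : 0 < dt -> dt <= dt0 ->
  finite_moments (nprob B) (fun w => enorm (scheme f sigma alpha B dt x0 N w)).
Proof.
move=> dt_gt0 dt_le; split => [|p].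
  by apply: measurable_enorm; apply: measurable_scheme => //; exact: ltW.
have [c [k [c0 H]]] :=
  scheme_moment sigma dt0 alpha_gt0 gamma_gt0 C_ge1 f_C2 f_diss f_growth p.
under eq_integral do rewrite ger0_norm ?enorm_ge0//.
have [Hx _] := H B x0 dt N 0%N dt_gt0 dt_le.
by apply: le_lt_trans Hx _; rewrite ltry.
Qed.

(** The local Lipschitz bound on the test function and Cauchy-Schwarz turn the strong error into a
    weak one, at the cost of moments of the polynomial weight. *)
Lemma scheme_weak_error : exists c k, 0 <= c /\
  forall (B : noise R K) X x0 dt N A phi, (forall x, solution f sigma B x (X x)) -> 0 < dt -> dt <= dt0 ->
    0 <= A -> test_growth A phi ->
    `|(\int[nprob B]_w phi (scheme f sigma alpha B dt x0 N w))%R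
      - (\int[nprob B]_w phi (scheme_limit f sigma alpha B dt N x0 w))%R|
    <= A * (dt * (c * (1 + enorm x0 + N%:R * dt) ^+ k)).
Proof.
have [c1 [k1 [c10 H1]]] := scheme_moment sigma dt0 alpha_gt0 gamma_gt0 C_ge1 f_C2 f_diss f_growth (2 * r).
have [c2 [k2 [c20 H2]]] := scheme_limit_moment sigma dt0 alpha_gt0 gamma_gt0 C_ge1 f_C2 f_diss f_growth (2 * r).
have [c3 [k3 [c30 H3]]] := scheme_limit_error sigma dt0 alpha_gt0 gamma_gt0 C_ge1 f_C2 f_diss f_growth.
(* [k1 + k2] comes from the moments of the weight; [2 + c3] and [k3 + 1] come from absorbing the
   horizon and the constant 1 of the strong error into powers of [rho >= 1]. *)
exists (2 * (4 ^+ (2 * r) * (1 + c1 + c2)) * (2 + c3)), (k1 + k2 + (k3 + 1))%N; split.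
  by rewrite !mulr_ge0 ?exprn_ge0 ?addr_ge0.
move=> B X x0 dt N A phi X_sol dt_gt0 dt_le A0 gphi; have sX := X_sol x0; have [_ _ lphi] := gphi.
set rho := 1 + enorm x0 + N%:R * dt.
have T0 : 0 <= N%:R * dt by rewrite mulr_ge0// ltW.
have rho1 : 1 <= rho by rewrite /rho -addrA lerDl addr_ge0 ?enorm_ge0.
have rho0 : 0 <= rho := le_trans ler01 rho1.
have Tr : N%:R * dt <= rho by rewrite /rho lerDr addr_ge0 ?enorm_ge0.
set P := nprob B; pose x w := scheme f sigma alpha B dt x0 N w.
pose y w := scheme_limit f sigma alpha B dt N x0 w.
have mx : measurable_fun setT (x : nspace B -> borelRd R d).
  by apply: measurable_scheme => //; exact: ltW.
have my : measurable_fun setT (y : nspace B -> borelRd R d).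
  exact: measurable_scheme_limit_from.
have fy : finite_moments P (fun w => enorm (y w)).
  exact: (limit_finite alpha_gt0 gamma_gt0 C_ge1 f_C2 f_diss f_growth X_sol x0 N dt_gt0 dt_le).
have fx : finite_moments P (fun w => enorm (x w)) by exact: scheme_finite.
have fd : finite_moments P (fun w => enorm (y w - x w)).
  apply: (finite_moments_le (finite_momentsD fy fx)).
    by apply: measurable_enorm; exact: measurable_rVB.
  move=> w; rewrite ger0_norm ?enorm_ge0// (le_trans _ (ler_norm _))//; exact: enormB.
have fS := finite_momentsX r (finite_momentsD (finite_momentsD (finite_moments_cst P 1) fx) fy).
have fphx := test_finite A0 gphi mx fx; have fphy := test_finite A0 gphi my fy.
have E2 : (\int[P]_w enorm (y w - x w) ^+ 2)%R <= (dt * (1 + N%:R * dt * (1 + c3 * rho ^+ k3))) ^+ 2.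
  by rewrite -lee_fin -mean_EFin; [exact: H3 sX _ _|exact: finite_momentsX].
set L := 4 ^+ (2 * r) * (1 + c1 * rho ^+ k1 + c2 * rho ^+ k2).
have L1 : 1 <= L.
  by rewrite -[1]mulr1 ler_pM ?exprn_ege1 ?ler1n// -addrA lerDl addr_ge0 ?mulr_ge0 ?exprn_ge0.
have ES : (\int[P]_w ((1 + enorm (x w) + enorm (y w)) ^+ r) ^+ 2)%R <= L.
  have fx2 := finite_momentsX (2 * r) fx; have fy2 := finite_momentsX (2 * r) fy.
  have f1 := finite_moments_cst P (1 ^+ (2 * r)).
  apply: (@le_trans _ _ (\int[P]_w (4 ^+ (2 * r) *
      (1 ^+ (2 * r) + enorm (x w) ^+ (2 * r) + enorm (y w) ^+ (2 * r))))%R).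
    apply: mean_le.
    - exact: finite_momentsX.
    - by apply: finite_momentsZ; apply: finite_momentsD => //; exact: finite_momentsD.
    - by move=> w; rewrite -exprM mulnC power3_le ?enorm_ge0.
  rewrite meanZ; last by apply: finite_momentsD => //; exact: finite_momentsD.
  rewrite ler_wpM2l ?exprn_ge0// meanD//; last exact: finite_momentsD.
  rewrite meanD// mean_cst expr1n !lerD// -lee_fin -mean_EFin//.
    by have [] := H1 B x0 dt N 0%N dt_gt0 dt_le.
  exact: H2 sX dt_gt0 dt_le.
rewrite -/P.
have fD := finite_momentsB fphx fphy.
rewrite -(meanB fphx fphy).
apply: le_trans (mean_norm_le fD) _.
have fSd := finite_momentsM fS fd.
apply: (@le_trans _ _ (\int[P]_w (2 * A * ((1 + enorm (x w) + enorm (y w)) ^+ r * enorm (y w - x w))))%R).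
  apply: mean_le; [exact: finite_moments_abs|exact: finite_momentsZ|move=> w].
  by rewrite distrC mulrA; exact: lphi.
rewrite (meanZ (2 * A) fSd) (mulrC 2 A) -[leLHS]mulrA; apply: ler_wpM2l => //.
set D := dt * (1 + N%:R * dt * (1 + c3 * rho ^+ k3)) in E2.
have D0 : 0 <= D.
  by rewrite /D !mulr_ge0 ?(ltW dt_gt0)// addr_ge0// mulr_ge0// addr_ge0// mulr_ge0// exprn_ge0.
have L0 : 0 <= L := le_trans ler01 L1.
have cs : (\int[P]_w ((1 + enorm (x w) + enorm (y w)) ^+ r * enorm (y w - x w)))%R <= L * D.
  have := mean_cauchy_schwarz fS fd; set I := (\int[P]_w _)%R => csI.
  apply: le_trans (ler_norm I) _; have LD0 := mulr_ge0 L0 D0.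
  rewrite -(@ler_pXn2r _ 2)// ?nnegrE// real_normK ?num_real//.
  apply: le_trans csI _; rewrite exprMn ler_pM//.
  - by apply: mean_ge0 => w; exact: sqr_ge0.
  - by apply: mean_ge0 => w; exact: sqr_ge0.
  - by rewrite (le_trans ES)// expr2 ler_peMl.
apply: (@le_trans _ _ (2 * (L * D))); first by rewrite ler_wpM2l.
have re k : 1 <= rho ^+ k by rewrite exprn_ege1.
have LL : L <= 4 ^+ (2 * r) * (1 + c1 + c2) * rho ^+ (k1 + k2).
  rewrite /L -mulrA ler_wpM2l ?exprn_ge0// !mulrDl !lerD//.
  - by rewrite mul1r.
  - by rewrite ler_wpM2l// ler_weXn2l// leq_addr.
  - by rewrite ler_wpM2l// ler_weXn2l// leq_addl.
have DD : D <= dt * ((2 + c3) * rho ^+ (k3 + 1)).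
  rewrite /D ler_wpM2l ?(ltW dt_gt0)//.
  have : N%:R * dt * (1 + c3 * rho ^+ k3) <= rho * ((1 + c3) * rho ^+ k3).
    rewrite ler_pM ?addr_ge0 ?mulr_ge0 ?exprn_ge0 ?(ltW dt_gt0)//.
    by rewrite mulrDl mul1r lerD.
  by have := re (k3 + 1)%N; rewrite addn1 exprS; set t := rho ^+ k3; lra.
apply: le_trans (ler_wpM2l _ (ler_pM L0 D0 LL DD)) _ => //.
by rewrite (exprD _ (k1 + k2)) le_eqVlt; apply/orP; left; apply/eqP; ring.
Qed.


Lemma invariant_finite (B : noise R K) (mu : probability (borelRd R d) R) X :
  (forall x, solution f sigma B x (X x)) ->
  (forall t (A : set (borelRd R d)), 0 <= t -> measurable A ->
    (\int[mu]_x nprob B (X x t @^-1` A) = mu A)%E) ->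
  finite_moments mu (fun x : borelRd R d => enorm x).
Proof.
move=> X_sol X_inv; split => [|p]; first by apply: measurable_enorm; exact: measurable_id.
have [c [_ H]] :=
  invariant_moment sigma alpha_gt0 gamma_gt0 C_ge1 f_C2 f_diss f_growth dt0_gt0 p.
under eq_integral do rewrite ger0_norm ?enorm_ge0//.
by apply: le_lt_trans (H _ _ _ X_sol X_inv) _; rewrite ltry.
Qed.

(** By invariance the integral against [mu] is an expectation of the solution started from [mu], so
    both terms are expectations over the same noise and the pathwise contraction applies. *)
Lemma limit_weak_error : exists c, 0 <= c /\
  forall (B : noise R K) (mu : probability (borelRd R d) R) X x0 dt N A phi,
    (forall x, solution f sigma B x (X x)) ->
    (forall t (A : set (borelRd R d)), 0 <= t -> measurable A ->
      (\int[mu]_x nprob B (X x t @^-1` A) = mu A)%E) ->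
    0 < dt -> dt <= dt0 -> 0 <= A -> test_growth A phi ->
    `|(\int[nprob B]_w phi (scheme_limit f sigma alpha B dt N x0 w))%R
      - (\int[mu]_x phi x)%R|
    <= A * (expR (- gamma * (N%:R * dt)) * (c * (1 + enorm x0) ^+ r.+1)).
Proof.
have [c1 [c10 H1]] :=
  invariant_moment sigma alpha_gt0 gamma_gt0 C_ge1 f_C2 f_diss f_growth dt0_gt0 r.+1.
exists (2 * (4 ^+ r.+1 * (1 + 2 ^+ r.+1 * c1 + c1))); split.
  by rewrite !mulr_ge0 ?exprn_ge0// !addr_ge0 ?mulr_ge0 ?exprn_ge0.
move=> B mu X x0 dt N A phi X_sol X_inv dt_gt0 dt_le A0 gphi; have [_ _ lphi] := gphi.
have T0 : 0 <= N%:R * dt by rewrite mulr_ge0// ltW.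
set e := expR _; have e0 : 0 <= e := expR_ge0 _.
have e1 : e <= 1 by rewrite -expR0 ler_expR mulNr oppr_le0 mulr_ge0// ltW.
pose J := joint B mu.
pose Y (z : borelRd R d * nspace B) : borelRd R d := scheme_limit f sigma alpha B dt N z.1 z.2.
pose y0 w : borelRd R d := scheme_limit f sigma alpha B dt N x0 w.
have mY : measurable_fun setT Y by exact: measurable_Y.
have lY A' : measurable A' -> J (Y @^-1` A') = mu A'.
  exact: (joint_limit_law alpha_gt0 gamma_gt0 C_ge1 f_C2 f_diss f_growth X_sol X_inv N dt_gt0).
have l1 := joint_fst_law B mu; have l2 := @joint_snd_law _ _ _ B mu.
have m1 : measurable_fun setT (fst : borelRd R d * nspace B -> borelRd R d) by [].
have m2 : measurable_fun setT (snd : borelRd R d * nspace B -> nspace B) by [].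
have fmu := invariant_finite X_sol X_inv.
have fy0 : finite_moments (nprob B) (fun w => enorm (y0 w)).
  exact: (limit_finite alpha_gt0 gamma_gt0 C_ge1 f_C2 f_diss f_growth X_sol x0 N dt_gt0 dt_le).
have my0 : measurable_fun setT y0 by exact: measurable_scheme_limit_from.
have fphmu : finite_moments mu phi.
  exact: (test_finite (T := borelRd R d) (Z := id) A0 gphi (@measurable_id _ _ _) fmu).
have fph0 := test_finite A0 gphi my0 fy0.
rewrite -(law_mean m2 l2 fph0) -(law_mean mY lY fphmu).
have j0 := law_finite_moments m2 l2 fph0; have jY := law_finite_moments mY lY fphmu.
have jeY := law_finite_moments mY lY fmu; have je1 := law_finite_moments m1 l1 fmu.
have je0 := law_finite_moments m2 l2 fy0.
have fD := finite_momentsB j0 jY.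
set I1 := (\int[_]_z _)%R; set I2 := (\int[_]_z _)%R.
have -> : I1 - I2 = (\int[J]_z (phi (y0 z.2) - phi (Y z)))%R.
  by rewrite (meanB j0 jY).
apply: le_trans (mean_norm_le fD) _.
(* [S] bounds both the Lipschitz weight and |x0| + |x|. The solution from x0 is eliminated, being at
   most |Y| + |x0| + |x| by contraction, which is why |Y| counts twice. What remains has law [mu],
   so the bound depends on x0 but not on the horizon. *)
pose S z := 1 + enorm x0 + 2 * enorm (Y z) + enorm z.1.
have jS : finite_moments J S.
  exact: (finite_momentsD (finite_momentsD (finite_moments_cst J (1 + enorm x0))
    (finite_momentsZ 2 jeY)) je1).
have S0 z : 0 <= S z by rewrite !addr_ge0 ?mulr_ge0 ?enorm_ge0.
apply: (@le_trans _ _ (\int[J]_z (2 * A * e * S z ^+ r.+1))%R).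
  have fS : finite_moments J (fun z => 2 * A * e * S z ^+ r.+1).
    by apply: finite_momentsZ; exact: finite_momentsX.
  have fa := finite_moments_abs fD.
  apply: ae_mean_le => //.
  - by move=> z; rewrite mulr_ge0 ?exprn_ge0 ?mulr_ge0.
  - apply: product_ae_le; [by case: fa|by case: fS|move=> x].
    have := scheme_limit_contraction alpha_gt0 gamma_gt0 C_ge1 f_C2 f_diss
      f_growth N dt_gt0 (X_sol x) (X_sol x0).
    apply: filterS => w; rewrite -/(y0 w) -/(Y (x, w)) -/e /S /= => con.
    move: (Y (x, w)) (y0 w) con => y y' con.
    have x1 := enorm_ge0 x; have x2 := enorm_ge0 x0.
    have cx : enorm (y' - y) <= e * (enorm x0 + enorm x).
      rewrite enorm_distC (le_trans con)// ler_wpM2l//.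
      by rewrite (le_trans (enormB _ _))// addrC.
    have y'le : enorm y' <= enorm y + enorm x0 + enorm x.
      have := enormD (y' - y) y; rewrite subrK.
      have : e * (enorm x0 + enorm x) <= 1 * (enorm x0 + enorm x).
        by rewrite ler_wpM2r ?addr_ge0.
      by lra.
    apply: le_trans (lphi _ _) _; rewrite exprSr -!mulrA ler_wpM2l//.
    rewrite ler_wpM2l// mulrCA.
    set s := 1 + enorm x0 + _ + _; have yy := enorm_ge0 y; have yy' := enorm_ge0 y'.
    rewrite ler_pM ?exprn_ge0 ?addr_ge0 ?enorm_ge0//.
      by rewrite lerXn2r ?nnegrE /s ?addr_ge0 ?mulr_ge0//; lra.
    apply: le_trans cx _; rewrite ler_wpM2l// /s; lra.
rewrite meanZ; last exact: finite_momentsX.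
rewrite (mulrC 2 A) -!mulrA ler_wpM2l// [leLHS]mulrCA ler_wpM2l// ler_wpM2l//.
set m := r.+1.
have g1 := finite_moments_cst J ((1 + enorm x0) ^+ m).
have g2 := finite_momentsX m (finite_momentsZ 2 jeY); have g3 := finite_momentsX m je1.
apply: (@le_trans _ _ (\int[J]_z (4 ^+ m *
    ((1 + enorm x0) ^+ m + (2 * enorm (Y z)) ^+ m + enorm z.1 ^+ m)))%R).
  apply: mean_le.
  - exact: finite_momentsX.
  - by apply: finite_momentsZ; apply: finite_momentsD => //; exact: finite_momentsD.
  - by move=> z; rewrite power3_le ?addr_ge0 ?mulr_ge0 ?enorm_ge0.
rewrite meanZ; last by apply: finite_momentsD => //; exact: finite_momentsD.
rewrite ler_wpM2l ?exprn_ge0// meanD//; last exact: finite_momentsD.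
rewrite meanD// mean_cst.
have fm := finite_momentsX m fmu.
have EM : (\int[mu]_x enorm x ^+ m)%R <= c1.
  by rewrite -lee_fin -mean_EFin//; exact: H1 X_sol X_inv.
have -> : (\int[J]_z (2 * enorm (Y z)) ^+ m)%R = 2 ^+ m * (\int[mu]_x enorm x ^+ m)%R.
  under eq_Rintegral do rewrite exprMn.
  rewrite (meanZ (2 ^+ m) (finite_momentsX m jeY)).
  by congr (_ * _); exact: (law_mean mY lY fm).
have -> : (\int[J]_z enorm z.1 ^+ m)%R = (\int[mu]_x enorm x ^+ m)%R.
  exact: (law_mean m1 l1 fm).
have X1 : 1 <= (1 + enorm x0) ^+ m by rewrite exprn_ege1// lerDl enorm_ge0.
have X0 := le_trans ler01 X1.
have b : 2 ^+ m * (\int[mu]_x enorm x ^+ m)%R <= 2 ^+ m * c1 by rewrite ler_wpM2l ?exprn_ge0.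
have cc : 0 <= 2 ^+ m * c1 by rewrite mulr_ge0 ?exprn_ge0.
rewrite !mulrDl mul1r -!addrA lerD2l lerD//.
  by rewrite (le_trans b)// ler_peMr.
by rewrite (le_trans EM)// ler_peMr.
Qed.

End weak_error.

Lemma tamed_eulerE (R : realType) (d K : nat) (f : 'rV[R]_d -> 'rV[R]_d)
    (sigma : 'I_K -> 'rV[R]_d) alpha dt (B : noise R K) x0 n w :
  tamed_euler f sigma alpha dt (@nbeta R K B) x0 n w = scheme f sigma alpha B dt x0 n w.
Proof.
elim: n => [//|n IH]; rewrite /= IH [RHS]/scheme/= -/(scheme f sigma alpha B dt x0 n w).
by rewrite /scheme_path noise_path_increment /tamed scalerA.
Qed.

Theorem theorem3p2 (R : realType) (d K : nat)
    (f : 'rV[R]_d -> 'rV[R]_d) (sigma : 'I_K -> 'rV[R]_d)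
    (gamma alpha dt0 : R)
    (f_C2 : class_C2 f)
    (f_growth : exists q : nat, (growth_norm (@enorm R d) q f < +oo)%E)
    (gamma_gt0 : 0 < gamma)
    (f_dissipative : forall x1 x2 : 'rV[R]_d,
      inner (f x2 - f x1) (x2 - x1) <= - gamma * enorm (x2 - x1) ^+ 2)
    (alpha_gt0 : 0 < alpha) (dt0_gt0 : 0 < dt0) (r : nat) :
  exists (Pr : {poly {poly R}}) (Qr : {poly R}),
  forall (dO : measure_display) (Omega : measurableType dO)
    (P : probability Omega R) (F : R -> set (set Omega))
    (beta : 'I_K -> R -> Omega -> R) (mu : probability (borelRd R d) R),
  usual_conditions P F ->
  independent_wieners P F beta ->
  invariant_distribution P F f sigma beta mu ->
  forall phi : 'rV[R]_d -> R,
  class_C2 phi -> (growth_norm (fun y : R => `|y|%R) r phi < +oo)%E ->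
  forall (N : nat) (x0 : 'rV[R]_d) (dt : R), 0 < dt -> dt <= dt0 ->
  (`| 'E_P [fun w => phi (tamed_euler f sigma alpha dt beta x0 N w)]
      - \int[mu]_x (phi x)%:E |
   <= growth_norm (fun y : R => `|y|%R) r phi *
      (expR (- gamma * N%:R * dt) * Qr.[enorm x0]
       + dt * Pr.[(enorm x0)%:P].[N%:R * dt])%:E)%E.
Proof.
have [C [q [C_ge1 fg]]] := drift_growthP f_C2 f_growth.
have [c1 [k1 [c10 H1]]] :=
  scheme_weak_error sigma dt0 r alpha_gt0 gamma_gt0 C_ge1 f_C2 f_dissipative fg.
have [c2 [c20 H2]] :=
  limit_weak_error sigma r alpha_gt0 gamma_gt0 C_ge1 f_C2 f_dissipative fg dt0_gt0.
(* In the bivariate polynomial the outer ['X] is evaluated at the initial norm and the inner one,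
   ['X%:P], at the time. *)
exists ((c1%:P)%:P * (1 + 'X + 'X%:P) ^+ k1), (c2%:P * (1 + 'X) ^+ r.+1).
move=> dO Omega P F beta mu usual [wien _] [X [X_sol X_inv]] phi phi_C2 phi_growth
  N x0 dt dt_gt0 dt_le.
have [A A0 [-> bphi lphi]] := test_growthP phi_C2 phi_growth.
pose B := Noise usual wien.
have gphi : test_growth r A phi.
  split => // x; have [dphi _ _] := phi_C2; exact/differentiable_continuous/dphi.
have b1 := H1 B X x0 dt N A phi X_sol dt_gt0 dt_le A0 gphi.
have b2 := H2 B mu X x0 dt N A phi X_sol X_inv dt_gt0 dt_le A0 gphi.
have fmu := invariant_finite alpha_gt0 gamma_gt0 C_ge1 f_C2 f_dissipative fg dt0_gt0 (B := B) X_sol X_inv.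
have fphmu : finite_moments mu phi.
  exact: (test_finite (T := borelRd R d) (Z := id) A0 gphi (@measurable_id _ _ _) fmu).
have fx := scheme_finite sigma alpha_gt0 gamma_gt0 C_ge1 f_C2 f_dissipative fg B x0 N dt_gt0 dt_le.
have mx : measurable_fun setT (scheme f sigma alpha B dt x0 N : nspace B -> borelRd R d).
  by apply: measurable_scheme => //; exact: ltW.
have fphx := test_finite A0 gphi mx fx.
have eE : tamed_euler f sigma alpha dt beta x0 N = scheme f sigma alpha B dt x0 N.
  by apply/funext => w; exact: (tamed_eulerE f sigma alpha dt (B := B) x0 N w).
rewrite unlock eE.
rewrite (mean_EFin fphx) (mean_EFin fphmu) -EFinB -EFinM abse_EFin lee_fin.
set E1 := (\int[nprob B]_w _)%R in b1 *; set E3 := (\int[mu]_x phi x)%R in b2 *.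
set E2 := (\int[nprob B]_w _)%R in b1 b2.
(* The intermediate value is the expectation for the solution at time [N%:R * dt]: the first part is
   the discretisation error, the second the distance to equilibrium. *)
apply: le_trans (ler_distD E2 _ _) _; apply: le_trans (lerD b1 b2) _.
rewrite -mulrDr ler_wpM2l// addrC.
have -> : (c2%:P * (1 + 'X) ^+ r.+1).[enorm x0] = c2 * (1 + enorm x0) ^+ r.+1.
  by rewrite hornerM horner_exp hornerD !hornerC hornerX.
have -> : ((c1%:P)%:P * (1 + 'X + 'X%:P) ^+ k1).[(enorm x0)%:P].[N%:R * dt]
    = c1 * (1 + enorm x0 + N%:R * dt) ^+ k1.
  rewrite hornerM horner_exp !hornerD hornerX !hornerC hornerM horner_exp.
  by rewrite !hornerD hornerX !hornerC.
by rewrite (mulrA (- gamma)).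
Qed.
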